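(* Let $k\ge 2$. Every Lipschitz map $f:S^k\to\mathbb{H}^1$ factors through a metric tree: there exist a metric tree $Z$ and Lipschitz maps $\psi:S^k\to Z$ and $\varphi:Z\to\mathbb{H}^1$ with $f=\varphi\circ\psi$.
   Context: $\mathbb{H}^1$ is the first Heisenberg group $\mathbb{R}^3$ with law $(x,y,z)\odot(x',y',z')=(x+x',y+y',z+z'+yx')$, equipped with its Carnot–Carathéodory metric (infimum of lengths, w.r.t. the left-invariant Riemannian metric making $X=\partial_x+y\partial_z$, $Y=\partial_y$, $Z=\partial_z$ orthonormal, of $C^1$ curves tangent to the span of $X,Y$). A metric tree ($\mathbb{R}$-tree) is a geodesic metric space in which every geodesic triangle is isometric to a tripod. *)

(* Defs.v *)
From Stdlib Require Import Reals Lra ClassicalEpsilon.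
Open Scope R_scope.

Record MetricSpace := {
  carrier :> Type;
  mdist : carrier -> carrier -> R;
  dist_nonneg : forall x y, 0 <= mdist x y;
  dist_eq0 : forall x y, mdist x y = 0 <-> x = y;
  dist_sym : forall x y, mdist x y = mdist y x;
  dist_tri : forall x y z, mdist x z <= mdist x y + mdist y z
}.

Arguments mdist {m} _ _.

Definition lipschitz {A B : Type} (dA : A -> A -> R) (dB : B -> B -> R)
  (f : A -> B) : Prop :=
  exists C : R, forall a b, dB (f a) (f b) <= C * dA a b.

Definition is_geodesic (Z : MetricSpace) (a b : Z) (s : R -> Z) : Prop :=
  s 0 = a /\ s (mdist a b) = b /\
  forall u v, 0 <= u <= mdist a b -> 0 <= v <= mdist a b ->
    mdist (s u) (s v) = Rabs (u - v).

Definition geodesic_space (Z : MetricSpace) : Prop :=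
  forall a b : Z, exists s, is_geodesic Z a b s.

(** Tripod with legs of lengths lens 0, lens 1, lens 2, glued at the
    centre: point (i,t) is at distance t from the centre on leg i.
    It is a pseudometric (all (i,0) are the centre). *)
Definition tripod_point (lens : nat -> R) (p : nat * R) : Prop :=
  (fst p < 3)%nat /\ 0 <= snd p <= lens (fst p).

Definition tripod_dist (p q : nat * R) : R :=
  if Nat.eqb (fst p) (fst q) then Rabs (snd p - snd q) else snd p + snd q.

Definition triangle_set (Z : MetricSpace) (a b c : Z) (s1 s2 s3 : R -> Z)
  (p : Z) : Prop :=
  (exists t, 0 <= t <= mdist a b /\ p = s1 t) \/
  (exists t, 0 <= t <= mdist b c /\ p = s2 t) \/
  (exists t, 0 <= t <= mdist c a /\ p = s3 t).

Definition isometric_to_tripod (Z : MetricSpace) (U : Z -> Prop) : Prop :=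
  exists (lens : nat -> R) (Phi : Z -> nat * R),
    (forall i, (i < 3)%nat -> 0 <= lens i) /\
    (forall p, U p -> tripod_point lens (Phi p)) /\
    (forall p q, U p -> U q -> tripod_dist (Phi p) (Phi q) = mdist p q) /\
    (forall tau, tripod_point lens tau ->
       exists p, U p /\ tripod_dist (Phi p) tau = 0).

Definition metric_tree (Z : MetricSpace) : Prop :=
  geodesic_space Z /\
  forall (a b c : Z) (s1 s2 s3 : R -> Z),
    is_geodesic Z a b s1 -> is_geodesic Z b c s2 -> is_geodesic Z c a s3 ->
    isometric_to_tripod Z (triangle_set Z a b c s1 s2 s3).

Definition sphere (k : nat) : Type :=
  { v : nat -> R | (forall i, (k < i)%nat -> v i = 0) /\
                   sum_f_R0 (fun i => v i ^ 2) k = 1 }.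

Definition sphere_dist (k : nat) (u v : sphere k) : R :=
  sqrt (sum_f_R0 (fun i => (proj1_sig u i - proj1_sig v i) ^ 2) k).

Definition H1 : Type := (R * R * R)%type.

(** L is the length of some C^1 horizontal curve [0,1] -> H^1 from p to q.
    Horizontal: gamma' = x' X + y' Y, i.e. z' = y x' (X = d_x + y d_z);
    its length in the metric making X, Y orthonormal is
    int_0^1 sqrt(x'^2 + y'^2). *)
Definition cc_admissible_length (p q : H1) (L : R) : Prop :=
  exists x y z dx dy dz : R -> R,
    (forall t, derivable_pt_lim x t (dx t)) /\
    (forall t, derivable_pt_lim y t (dy t)) /\
    (forall t, derivable_pt_lim z t (dz t)) /\
    continuity dx /\ continuity dy /\ continuity dz /\
    (forall t, 0 <= t <= 1 -> dz t = y t * dx t) /\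
    (x 0, y 0, z 0) = p /\ (x 1, y 1, z 1) = q /\
    exists pr : Riemann_integrable (fun t => sqrt (dx t ^ 2 + dy t ^ 2)) 0 1,
      RiemannInt pr = L.

Definition is_glb (E : R -> Prop) (m : R) : Prop :=
  (forall x, E x -> m <= x) /\ (forall b, (forall x, E x -> b <= x) -> b <= m).

Definition cc_dist (p q : H1) : R :=
  epsilon (inhabits 0) (fun r => is_glb (cc_admissible_length p q) r).

(* Main.v *)
(* In H^1 a horizontal displacement over distance r moves the symmetrized
   vertical coordinate by O(r^2). Hence for a Lipschitz map F of a square into
   H^1 the area enclosed by the horizontal projection of the image of a closed
   curve vanishes, so that, by Stokes, u dv integrates to zero over the boundary
   for u, v smooth functions of F, and then, by uniform approximation, for all u, v
   that are locally Lipschitz functions of F. Working with trapezoidal sums on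
   grids makes this elementary: no differentiability of F is needed.

   Let v be the f-length distance from a base point of S^k, approximated by
   sums of distances along chains with steps at most delta. Integrating P dv
   over a closed curve, with P a cut-off around a point, shows that two points at
   height v = c which are joined inside {v >= c} have the same image. Therefore
   f is Lipschitz for the pseudometric v(x) + v(y) - 2 m(x, y), where m(x, y) is
   the supremum of the levels c at which x and y are joined inside {v >= c}.
   Since min(m(x, y), m(y, z)) <= m(x, z), this pseudometric satisfies the four
   point condition, and its quotient is the metric tree. *)
Require Import Defs.
From Stdlib Require Import Reals Lra Lia List ClassicalEpsilon.
From Stdlib Require Import FunctionalExtensionality Classical_Prop.
From Coquelicot Require Import Coquelicot.
Open Scope R_scope.

(** * A homogeneous metric equivalent to the Carnot-Caratheodory metric *)

(** The obstacle is that the f-length distance need not be controlled by [rho (f a) (f b)] at any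
    scale, while Stokes asks for functions that are. The chain distance at a fixed scale delta is so
    controlled for points at distance at most delta. The argument on closed paths is therefore run
    at fixed delta; the Lipschitz constants there may blow up as delta shrinks, since Stokes gives
    exactly zero, and only the resulting inequality, with an error linear in delta, is passed to the
    limit. The hypothesis on k enters through the cone over a closed path: one apex has to keep the
    cones over finitely many segments away from the origin. A linear form in the first three
    coordinates that vanishes on the plane of a segment has few zeros on the curve (1, t, t^2), so a
    far point of this curve serves for all the segments. Integrals are sums over grid nodes, so the
    only closed paths that are used are those on each edge of which V is constant or P is constant
    wherever V varies; their sums do not depend on the grid. *)

(** The vertical coordinate of the group element p^-1 q after the change z - xy/2, which makes the
    group law antisymmetric in the horizontal part. It is also the increment of z minus the
    trapezoidal value of y dx, which links it to [trap]. *)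
Definition tau (p q : H1) : R :=
  snd q - snd p
  - (snd (fst p) + snd (fst q)) / 2 * (fst (fst q) - fst (fst p)).

Definition hor (p q : H1) : R :=
  Rabs (fst (fst q) - fst (fst p)) + Rabs (snd (fst q) - snd (fst p)).

(** The square root makes this homogeneous under the dilations (s x, s y, s^2 z), like the
    Carnot-Caratheodory metric. *)
Definition rho (p q : H1) : R := Rmax (hor p q) (sqrt (Rabs (tau p q))).

Lemma hor_nonneg p q : 0 <= hor p q.
Proof. apply Rplus_le_le_0_compat; apply Rabs_pos. Qed.

Lemma rho_nonneg p q : 0 <= rho p q.
Proof. eapply Rle_trans; [apply (hor_nonneg p q) | apply Rmax_l]. Qed.

Lemma hor_le_rho p q : hor p q <= rho p q.
Proof. apply Rmax_l. Qed.

Lemma tau_le_rho p q : Rabs (tau p q) <= rho p q * rho p q.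
Proof.
  rewrite <- (sqrt_sqrt (Rabs (tau p q))) by apply Rabs_pos.
  assert (H := Rmax_r (hor p q) (sqrt (Rabs (tau p q)))).
  assert (H0 := sqrt_pos (Rabs (tau p q))).
  apply Rmult_le_compat; assumption.
Qed.

Lemma rho_le p q r :
  0 <= r -> hor p q <= r -> Rabs (tau p q) <= r * r -> rho p q <= r.
Proof.
  intros Hr H1' H2. apply Rmax_lub; [assumption|].
  rewrite <- (sqrt_square r) by assumption. apply sqrt_le_1_alt. assumption.
Qed.

Lemma rho_sym p q : rho p q = rho q p.
Proof.
  unfold rho, hor.
  rewrite (Rabs_minus_sym (fst (fst q))), (Rabs_minus_sym (snd (fst q))).
  replace (tau p q) with (- tau q p) by (unfold tau; lra).
  rewrite Rabs_Ropp. reflexivity.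
Qed.

Lemma rho_refl p : rho p p = 0.
Proof.
  apply Rle_antisym; [|apply rho_nonneg].
  apply rho_le; [lra| |].
  - unfold hor. rewrite !Rminus_diag, Rabs_R0. lra.
  - unfold tau. rewrite !Rminus_diag, Rmult_0_r, Rminus_0_r, Rabs_R0. lra.
Qed.

Lemma rho_eq0 p q : rho p q <= 0 -> p = q.
Proof.
  intros H. assert (H0 := rho_nonneg p q).
  assert (Hh := hor_le_rho p q). assert (Ht := tau_le_rho p q).
  replace (rho p q) with 0 in * by lra.
  unfold hor in Hh.
  assert (A1 := Rabs_pos (fst (fst q) - fst (fst p))).
  assert (A2 := Rabs_pos (snd (fst q) - snd (fst p))).
  assert (B1 : fst (fst q) - fst (fst p) = 0)
    by (apply Rabs_eq_0; lra).
  assert (B2 : snd (fst q) - snd (fst p) = 0)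
    by (apply Rabs_eq_0; lra).
  assert (B3 : tau p q = 0)
    by (apply Rabs_eq_0; assert (A3 := Rabs_pos (tau p q)); lra).
  unfold tau in B3. rewrite B1 in B3.
  destruct p as [[x y] z], q as [[x' y'] z']; simpl in *.
  f_equal; [f_equal|]; lra.
Qed.

(** The defect of additivity is the signed area of the triangle formed by the horizontal
    projections. *)
Lemma tau_add p q r :
  tau p r = tau p q + tau q r
    + ((snd (fst q) - snd (fst p)) * (fst (fst r) - fst (fst q))
       - (fst (fst q) - fst (fst p)) * (snd (fst r) - snd (fst q))) / 2.
Proof. unfold tau. field. Qed.

(** The area defect is at most the product of the two distances, so it fits into the cross term of
    the squared sum and no constant is lost. *)
Lemma rho_tri p q r : rho p r <= rho p q + rho q r.
Proof.
  assert (P1 := rho_nonneg p q). assert (P2 := rho_nonneg q r).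
  assert (H1 := hor_le_rho p q). assert (H2 := hor_le_rho q r).
  assert (T1 := tau_le_rho p q). assert (T2 := tau_le_rho q r).
  apply rho_le; [lra| |].
  - unfold hor in *.
    assert (A1 := Rabs_triang (fst (fst q) - fst (fst p)) (fst (fst r) - fst (fst q))).
    assert (A2 := Rabs_triang (snd (fst q) - snd (fst p)) (snd (fst r) - snd (fst q))).
    replace (fst (fst q) - fst (fst p) + (fst (fst r) - fst (fst q)))
      with (fst (fst r) - fst (fst p)) in A1 by ring.
    replace (snd (fst q) - snd (fst p) + (snd (fst r) - snd (fst q)))
      with (snd (fst r) - snd (fst p)) in A2 by ring.
    lra.
  - rewrite (tau_add p q r).
    unfold hor in H1, H2.
    set (a := fst (fst q) - fst (fst p)) in *.
    set (b := snd (fst q) - snd (fst p)) in *.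
    set (c := fst (fst r) - fst (fst q)) in *.
    set (d := snd (fst r) - snd (fst q)) in *.
    assert (X : Rabs ((b * c - a * d) / 2) <= rho p q * rho q r).
    { unfold Rdiv. rewrite Rabs_mult, (Rabs_right (/ 2)) by lra.
      assert (Y := Rabs_triang (b * c) (- (a * d))).
      rewrite Rabs_Ropp, !Rabs_mult in Y. unfold Rminus.
      assert (A1 := Rabs_pos a). assert (A2 := Rabs_pos b).
      assert (A3 := Rabs_pos c). assert (A4 := Rabs_pos d).
      assert (Z : (Rabs a + Rabs b) * (Rabs c + Rabs d) <= rho p q * rho q r)
        by (apply Rmult_le_compat; lra).
      nra. }
    assert (X1 := Rabs_triang (tau p q + tau q r) ((b * c - a * d) / 2)).
    assert (X2 := Rabs_triang (tau p q) (tau q r)).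
    nra.
Qed.

Lemma cc_length_nonneg p q L : cc_admissible_length p q L -> 0 <= L.
Proof.
  intros (x & y & z & dx & dy & dz & _ & _ & _ & _ & _ & _ & _ & _ & _ & pr & <-).
  assert (P0 := RiemannInt_P14 0 1 0).
  assert (H := RiemannInt_P19 P0 pr).
  rewrite RiemannInt_P15 in H.
  replace (0 * (1 - 0)) with 0 in H by ring.
  apply H; [lra|]. intros t _. apply sqrt_pos.
Qed.

(** Everything is compared with the arc length [Lam]: x and y vary at most as fast as [Lam], and z -
    y(0) x has derivative (y - y(0)) x', at most that of [Lam]^2/2. The factor 2 comes from the sum
    norm in [hor]. *)
Lemma rho_le_cc_length p q L : cc_admissible_length p q L -> rho p q <= 2 * L.
Proof.
  intros HL. assert (L0 := cc_length_nonneg _ _ _ HL).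
  destruct HL as (x & y & z & dx & dy & dz & Hx & Hy & Hz & Cx & Cy & Cz & Hh
                  & <- & <- & pr & <-).
  set (sg := fun t => sqrt (dx t ^ 2 + dy t ^ 2)) in *.
  assert (Csg : forall t, continuous sg t).
  { intros t. apply continuity_pt_filterlim. unfold sg.
    apply (continuity_pt_comp (fun t => dx t ^ 2 + dy t ^ 2) sqrt).
    - apply continuity_pt_plus; apply (continuity_pt_comp _ (fun u => u ^ 2));
        auto; apply derivable_continuous_pt; apply derivable_pt_pow.
    - apply continuity_pt_sqrt. nra. }
  assert (Isg : forall a b, ex_RInt sg a b)
    by (intros; apply (ex_RInt_continuous (V := R_CompleteNormedModule)); auto).
  set (Lam := (fun s => RInt sg 0 s) : R -> R).
  assert (DL : forall s, is_derive Lam s (sg s)).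
  { intros s. apply (is_derive_RInt sg Lam 0); auto.
    exists (mkposreal 1 Rlt_0_1). intros b _. apply (RInt_correct (V := R_CompleteNormedModule)), Isg. }
  replace (RiemannInt pr) with (Lam 1) in * by apply RInt_Reals.
  assert (L00 : Lam 0 = 0) by apply (RInt_point (V := R_CompleteNormedModule) 0 sg).
  assert (Sx : forall t, Rabs (dx t) <= sg t).
  { intros t. rewrite <- sqrt_Rsqr_abs. apply sqrt_le_1_alt. unfold Rsqr. nra. }
  assert (Sy : forall t, Rabs (dy t) <= sg t).
  { intros t. rewrite <- sqrt_Rsqr_abs. apply sqrt_le_1_alt. unfold Rsqr. nra. }
  assert (cmp : forall g dg B dB : R -> R,
    (forall t, is_derive g t (dg t)) -> (forall t, is_derive B t (dB t)) ->
    (forall t, 0 <= t <= 1 -> Rabs (dg t) <= dB t) ->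
    forall t, 0 <= t <= 1 -> Rabs (g t - g 0) <= B t - B 0).
  { assert (mono : forall h dh : R -> R, (forall t, is_derive h t (dh t)) ->
      (forall t, 0 <= t <= 1 -> 0 <= dh t) ->
      forall t, 0 <= t <= 1 -> h 0 <= h t).
    { intros h dh Hd Hp t Ht.
      destruct (MVT_gen h 0 t dh) as (c & Hc & E).
      - intros; apply Hd.
      - intros u _. apply continuity_pt_filterlim.
        apply (ex_derive_continuous h u). eexists; apply Hd.
      - rewrite Rmin_left, Rmax_right in Hc by lra.
        assert (0 <= dh c * (t - 0)); [|lra].
        apply Rmult_le_pos; [apply Hp|]; lra. }
    intros g dg B dB Hg HB Hle t Ht.
    assert (M1 := mono (fun t => B t - g t) (fun t => dB t - dg t)).
    assert (M2 := mono (fun t => B t + g t) (fun t => dB t + dg t)).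
    apply Rabs_le. split.
    - assert (B 0 + g 0 <= B t + g t); [|lra].
      apply M2; auto.
      + intros; apply (is_derive_plus B g); auto.
      + intros u Hu. specialize (Hle u Hu). apply Rabs_le_between in Hle. lra.
    - assert (B 0 - g 0 <= B t - g t); [|lra].
      apply M1; auto.
      + intros; apply (is_derive_minus B g); auto.
      + intros u Hu. specialize (Hle u Hu). apply Rabs_le_between in Hle. lra. }
  assert (Dx : forall t, is_derive x t (dx t)) by (intros; apply is_derive_Reals, Hx).
  assert (Dy : forall t, is_derive y t (dy t)) by (intros; apply is_derive_Reals, Hy).
  assert (Dz : forall t, is_derive z t (dz t)) by (intros; apply is_derive_Reals, Hz).
  assert (Bx := cmp x dx Lam sg Dx DL (fun t _ => Sx t)).
  assert (By := cmp y dy Lam sg Dy DL (fun t _ => Sy t)).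
  rewrite L00 in Bx, By.
  assert (Bz : Rabs ((z 1 - y 0 * x 1) - (z 0 - y 0 * x 0))
               <= Lam 1 * Lam 1 / 2 - Lam 0 * Lam 0 / 2).
  { apply (cmp (fun t => z t - y 0 * x t) (fun t => dz t - y 0 * dx t)
             (fun t => Lam t * Lam t / 2) (fun t => Lam t * sg t)); [| | |lra].
    - intros t. apply (is_derive_minus z (fun t => y 0 * x t)); auto.
      apply (is_derive_scal x t (y 0)). auto.
    - intros t. apply is_derive_Reals.
      replace (Lam t * sg t)
        with ((sg t * Lam t + Lam t * sg t) * / 2 + Lam t * Lam t * 0) by field.
      assert (D : derivable_pt_lim Lam t (sg t)) by apply is_derive_Reals, DL.
      apply (derivable_pt_lim_mult (mult_fct Lam Lam) (fct_cte (/ 2))).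
      + apply derivable_pt_lim_mult; exact D.
      + apply derivable_pt_lim_const.
    - intros t Ht. rewrite Hh by assumption.
      replace (y t * dx t - y 0 * dx t) with ((y t - y 0) * dx t) by ring.
      rewrite Rabs_mult.
      apply Rmult_le_compat; try apply Rabs_pos; auto.
      specialize (By t Ht). lra. }
  rewrite L00 in Bz.
  specialize (Bx 1 ltac:(lra)). specialize (By 1 ltac:(lra)).
  apply rho_le; [lra| |].
  - unfold hor; simpl. lra.
  - unfold tau; simpl.
    replace (z 1 - z 0 - (y 0 + y 1) / 2 * (x 1 - x 0)) with
      ((z 1 - y 0 * x 1 - (z 0 - y 0 * x 0)) + - ((y 1 - y 0) * (x 1 - x 0)) / 2)
      by field.
    eapply Rle_trans; [apply Rabs_triang|].
    assert (Rabs (- ((y 1 - y 0) * (x 1 - x 0)) / 2) <= Lam 1 * Lam 1 / 2); [|nra].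
    unfold Rdiv. rewrite Rabs_mult, Rabs_Ropp, Rabs_mult, (Rabs_right (/2)) by lra.
    apply Rmult_le_compat_r; [lra|].
    apply Rmult_le_compat; try apply Rabs_pos; lra.
Qed.

(* The loop (w (1 - 2t), w - 5 w^2) with w = t (1 - t) encloses area 1/70 and
   both of its coordinates have mean zero, so adding a multiple of it to a
   straight segment changes only the vertical displacement. *)
Lemma cc_length_le_rho p q :
  exists L, cc_admissible_length p q L /\ L <= 200 * rho p q.
Proof.
  destruct p as [[x0 y0] z0], q as [[x1 y1] z1].
  set (p := (x0, y0, z0)). set (q := (x1, y1, z1)).
  set (a := x1 - x0). set (b := y1 - y0).
  (* Stretched by l in x and by m in y, the loop contributes l m / 70 to the vertical displacement.
     Splitting the product evenly keeps both factors of order [rho], as 9 exceeds the square root of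
     70. *)
  assert (Hlm : exists l m, l * m = 70 * tau p q /\ Rabs l <= 9 * rho p q
                            /\ Rabs m <= 9 * rho p q).
  { set (s := sqrt (70 * Rabs (tau p q))).
    assert (Hs : s * s = 70 * Rabs (tau p q)).
    { apply sqrt_sqrt. assert (H := Rabs_pos (tau p q)). lra. }
    assert (Hs0 : 0 <= s) by apply sqrt_pos.
    assert (Hs1 : s <= 9 * rho p q).
    { assert (H := tau_le_rho p q). assert (H0 := rho_nonneg p q).
      apply Rsqr_incr_0_var; unfold Rsqr; nra. }
    exists s, (if Rle_dec 0 (tau p q) then s else - s).
    destruct (Rle_dec 0 (tau p q)) as [Hp|Hn].
    - rewrite Rabs_right in Hs by lra. rewrite Rabs_right by lra. auto.
    - rewrite Rabs_left in Hs by lra. rewrite Rabs_Ropp, Rabs_right by lra.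
      repeat split; lra. }
  destruct Hlm as (l & m & Hlm & Hl & Hm).
  set (X := fun t => x0 + a * t + l * (t - 3 * t ^ 2 + 2 * t ^ 3)).
  set (dX := fun t => a + l * (1 - 6 * t + 6 * t ^ 2)).
  set (Y := fun t => y0 + b * t + m * (t - 6 * t ^ 2 + 10 * t ^ 3 - 5 * t ^ 4)).
  set (dY := fun t => b + m * (1 - 12 * t + 30 * t ^ 2 - 20 * t ^ 3)).
  set (Z := fun t => z0 + y0 * (a * t + l * (t - 3 * t ^ 2 + 2 * t ^ 3))
     + b * a * t ^ 2 / 2 + b * l * (t ^ 2 / 2 - 2 * t ^ 3 + 6 * t ^ 4 / 4)
     + m * a * (t ^ 2 / 2 - 2 * t ^ 3 + 10 * t ^ 4 / 4 - t ^ 5)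
     + m * l * (t ^ 2 / 2 - 4 * t ^ 3 + 13 * t ^ 4 - 101 / 5 * t ^ 5 + 15 * t ^ 6
                - 30 * t ^ 7 / 7)).
  set (dZ := fun t => Y t * dX t).
  assert (DX : forall t, is_derive X t (dX t))
    by (intros t; unfold X, dX; auto_derive; [auto|ring]).
  assert (DY : forall t, is_derive Y t (dY t))
    by (intros t; unfold Y, dY; auto_derive; [auto|ring]).
  assert (DZ : forall t, is_derive Z t (dZ t))
    by (intros t; unfold Z, dZ, Y, dX; auto_derive; [auto|field]).
  assert (CdX : continuity dX).
  { intros t. apply continuity_pt_filterlim, (ex_derive_continuous dX t).
    unfold dX. auto_derive. auto. }
  assert (CdY : continuity dY).
  { intros t. apply continuity_pt_filterlim, (ex_derive_continuous dY t).
    unfold dY. auto_derive. auto. }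
  assert (CdZ : continuity dZ).
  { intros t. apply continuity_pt_filterlim, (ex_derive_continuous dZ t).
    unfold dZ, Y, dX. auto_derive. auto. }
  assert (Cs : forall t, continuous (fun t => sqrt (dX t ^ 2 + dY t ^ 2)) t).
  { intros t. apply continuity_pt_filterlim.
    apply (continuity_pt_comp (fun t => dX t ^ 2 + dY t ^ 2) sqrt).
    - apply continuity_pt_plus; apply (continuity_pt_comp _ (fun u => u ^ 2));
        auto; apply derivable_continuous_pt; apply derivable_pt_pow.
    - apply continuity_pt_sqrt. nra. }
  assert (pr : Riemann_integrable (fun t => sqrt (dX t ^ 2 + dY t ^ 2)) 0 1).
  { apply ex_RInt_Reals_0, (ex_RInt_continuous (V := R_CompleteNormedModule)). auto. }
  exists (RiemannInt pr). split.
  - exists X, Y, Z, dX, dY, dZ.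
    split; [intros; apply is_derive_Reals; auto|].
    split; [intros; apply is_derive_Reals; auto|].
    split; [intros; apply is_derive_Reals; auto|].
    do 3 (split; [assumption|]).
    split; [reflexivity|].
    split; [|split; [|exists pr; reflexivity]].
    + unfold p, X, Y, Z. f_equal; [f_equal|]; field.
    + unfold q, X, Y, Z. f_equal; [f_equal|].
      * unfold a; ring.
      * unfold b; ring.
      * replace (m * l) with (70 * tau p q) by lra.
        unfold tau, p, q, a, b; simpl. field.
  - assert (P0 := RiemannInt_P14 0 1 (200 * rho p q)).
    assert (H := RiemannInt_P19 pr P0).
    rewrite RiemannInt_P15 in H. rewrite Rminus_0_r, Rmult_1_r in H.
    apply H; [lra|]. intros t Ht. unfold fct_cte.
    assert (Hr := rho_nonneg p q). assert (Hh := hor_le_rho p q).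
    unfold hor in Hh; simpl in Hh. fold a b in Hh.
    assert (Ha := Rabs_pos a). assert (Hb := Rabs_pos b).
    (* The speed stays below 200 [rho]: both velocity components are at most 100 [rho], the worse
       one being 1 + 9 * 11 times [rho] for y. *)
    assert (BX : Rabs (dX t) <= 100 * rho p q).
    { unfold dX. eapply Rle_trans; [apply Rabs_triang|]. rewrite Rabs_mult.
      assert (Rabs (1 - 6 * t + 6 * t ^ 2) <= 1) by (apply Rabs_le; nra).
      assert (Rabs l * Rabs (1 - 6 * t + 6 * t ^ 2) <= 9 * rho p q * 1)
        by (apply Rmult_le_compat; auto using Rabs_pos). lra. }
    assert (BY : Rabs (dY t) <= 100 * rho p q).
    { unfold dY. eapply Rle_trans; [apply Rabs_triang|]. rewrite Rabs_mult.
      assert (Rabs (1 - 12 * t + 30 * t ^ 2 - 20 * t ^ 3) <= 11).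
      { assert (0 <= t ^ 2 <= 1) by nra.
        assert (0 <= t ^ 3 <= t ^ 2) by (simpl in *; nra).
        apply Rabs_le. split; nra. }
      assert (Rabs m * Rabs (1 - 12 * t + 30 * t ^ 2 - 20 * t ^ 3) <= 9 * rho p q * 11)
        by (apply Rmult_le_compat; auto using Rabs_pos). lra. }
    apply Rabs_le_between in BX. apply Rabs_le_between in BY.
    rewrite <- (sqrt_square (200 * rho p q)) by lra.
    apply sqrt_le_1_alt. nra.
Qed.

(** The choice made by [epsilon] is meaningful because some admissible curve exists, namely the
    explicit one above. *)
Lemma cc_dist_glb p q : is_glb (cc_admissible_length p q) (cc_dist p q).
Proof.
  apply (epsilon_spec (inhabits 0)
           (fun r => is_glb (cc_admissible_length p q) r)).
  destruct (completeness (fun s => cc_admissible_length p q (- s))) as (s & Hs).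
  - exists 0. intros s Hs. apply cc_length_nonneg in Hs. lra.
  - destruct (cc_length_le_rho p q) as (L & HL & _). exists (- L).
    rewrite Ropp_involutive. assumption.
  - exists (- s). split.
    + intros L HL. assert (- L <= s); [|lra].
      apply Hs. rewrite Ropp_involutive. assumption.
    + intros b Hb. assert (s <= - b); [|lra].
      apply Hs. intros t Ht. apply Hb in Ht. lra.
Qed.

Lemma rho_le_cc p q : rho p q <= 2 * cc_dist p q.
Proof.
  assert (rho p q / 2 <= cc_dist p q); [|lra].
  apply (cc_dist_glb p q). intros L HL. apply rho_le_cc_length in HL. lra.
Qed.

Lemma cc_le_rho p q : cc_dist p q <= 200 * rho p q.
Proof.
  destruct (cc_length_le_rho p q) as (L & HL & HL').
  apply (cc_dist_glb p q) in HL. lra.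
Qed.

(** * Trapezoidal sums on grids *)

Fixpoint Rsum (n : nat) (f : nat -> R) : R :=
  match n with O => 0 | S m => Rsum m f + f m end.

Lemma Rsum_ext n f g :
  (forall i, (i < n)%nat -> f i = g i) -> Rsum n f = Rsum n g.
Proof.
  induction n as [|n IH]; intros H; simpl; [reflexivity|].
  rewrite IH by (intros; apply H; lia). rewrite H by lia. reflexivity.
Qed.

Lemma Rsum_plus n f g : Rsum n (fun i => f i + g i) = Rsum n f + Rsum n g.
Proof. induction n as [|n IH]; simpl; [|rewrite IH]; ring. Qed.

Lemma Rsum_scal n c f : Rsum n (fun i => c * f i) = c * Rsum n f.
Proof. induction n as [|n IH]; simpl; [|rewrite IH]; ring. Qed.

Lemma Rsum_add n m f : Rsum (n + m) f = Rsum n f + Rsum m (fun i => f (n + i)%nat).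
Proof.
  induction m as [|m IH]; simpl.
  - rewrite Nat.add_0_r. ring.
  - rewrite Nat.add_succ_r. simpl. rewrite IH. ring.
Qed.

Lemma Rsum_telescope n f : Rsum n (fun i => f (S i) - f i) = f n - f O.
Proof. induction n as [|n IH]; simpl; [|rewrite IH]; ring. Qed.

Lemma Rsum_abs_le n f B :
  (forall i, (i < n)%nat -> Rabs (f i) <= B) -> Rabs (Rsum n f) <= INR n * B.
Proof.
  induction n as [|n IH]; intros H.
  - simpl. rewrite Rabs_R0. lra.
  - rewrite S_INR. simpl Rsum. eapply Rle_trans; [apply Rabs_triang|].
    assert (Rabs (Rsum n f) <= INR n * B) by (apply IH; intros; apply H; lia).
    assert (Rabs (f n) <= B) by (apply H; lia). lra.
Qed.

Lemma Rsum_zero n f : (forall i, (i < n)%nat -> f i = 0) -> Rsum n f = 0.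
Proof.
  intros H. rewrite (Rsum_ext n f (fun _ => 0 * 0)).
  - rewrite Rsum_scal. ring.
  - intros. rewrite H by assumption. ring.
Qed.

(** The symmetric rule makes integration by parts exact, and on the coordinates y, x it differs from
    the increment of z by exactly [tau]. *)
Definition trap (u v u' v' : R) : R := (u + u') / 2 * (v' - v).

(* Trapezoidal sum of [U dV] along the boundary of the n x m block of grid
   cells with lower left corner (i, j). *)
Definition loop (U V : nat -> nat -> R) (i j n m : nat) : R :=
  Rsum n (fun l => trap (U (i + l) j) (V (i + l) j)
                        (U (S (i + l)) j) (V (S (i + l)) j))%nat
  + Rsum m (fun l => trap (U (i + n) (j + l)) (V (i + n) (j + l))
                          (U (i + n) (S (j + l))) (V (i + n) (S (j + l))))%nat
  - Rsum n (fun l => trap (U (i + l) (j + m)) (V (i + l) (j + m))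
                          (U (S (i + l)) (j + m)) (V (S (i + l)) (j + m)))%nat
  - Rsum m (fun l => trap (U i (j + l)) (V i (j + l))
                          (U i (S (j + l))) (V i (S (j + l))))%nat.

(** The common edge of the two blocks is traversed in opposite directions and cancels. *)
Lemma loop_hsplit U V i j n1 n2 m :
  loop U V i j (n1 + n2) m = loop U V i j n1 m + loop U V (i + n1) j n2 m.
Proof.
  unfold loop. rewrite !Rsum_add, !Nat.add_assoc.
  rewrite (Rsum_ext n2 _ (fun l => trap (U (i + n1 + l) j) (V (i + n1 + l) j)
                        (U (S (i + n1 + l)) j) (V (S (i + n1 + l)) j))%nat)
    by (intros; rewrite !Nat.add_assoc; reflexivity).
  rewrite (Rsum_ext n2 (fun l => trap (U (i + (n1 + l)) (j + m)) _ _ _)%nat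
     (fun l => trap (U (i + n1 + l) (j + m)) (V (i + n1 + l) (j + m))
              (U (S (i + n1 + l)) (j + m)) (V (S (i + n1 + l)) (j + m)))%nat)
    by (intros; rewrite !Nat.add_assoc; reflexivity).
  ring.
Qed.

Lemma loop_vsplit U V i j n m1 m2 :
  loop U V i j n (m1 + m2) = loop U V i j n m1 + loop U V i (j + m1) n m2.
Proof.
  unfold loop. rewrite !Rsum_add, !Nat.add_assoc.
  rewrite (Rsum_ext m2 _ (fun l => trap (U (i + n) (j + m1 + l)) (V (i + n) (j + m1 + l))
                        (U (i + n) (S (j + m1 + l))) (V (i + n) (S (j + m1 + l))))%nat)
    by (intros; rewrite !Nat.add_assoc; reflexivity).
  rewrite (Rsum_ext m2 (fun l => trap (U i (j + (m1 + l))) _ _ _)%nat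
     (fun l => trap (U i (j + m1 + l)) (V i (j + m1 + l))
              (U i (S (j + m1 + l))) (V i (S (j + m1 + l))))%nat)
    by (intros; rewrite !Nat.add_assoc; reflexivity).
  ring.
Qed.

Lemma loop_0_l U V i j m : loop U V i j 0 m = 0.
Proof. unfold loop. simpl. rewrite Nat.add_0_r. ring. Qed.

Lemma loop_0_r U V i j n : loop U V i j n 0 = 0.
Proof. unfold loop. simpl. rewrite Nat.add_0_r. ring. Qed.

Lemma loop_blocks U V i j K n :
  loop U V i j (K * n) (K * n) =
  Rsum K (fun A => Rsum K (fun B => loop U V (i + A * n) (j + B * n) n n))%nat.
Proof.
  assert (Hh : forall k m, loop U V i j (k * n) m
                = Rsum k (fun A => loop U V (i + A * n) j n m)%nat).
  { intros k m. induction k as [|k IH]; simpl; [apply loop_0_l|].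
    rewrite Nat.add_comm, loop_hsplit, IH. reflexivity. }
  assert (Hv : forall i' k, loop U V i' j n (k * n)
                = Rsum k (fun B => loop U V i' (j + B * n) n n)%nat).
  { intros i' k. induction k as [|k IH]; simpl; [apply loop_0_r|].
    rewrite Nat.add_comm, loop_vsplit, IH. reflexivity. }
  rewrite Hh. apply Rsum_ext. intros A _. apply Hv.
Qed.

Lemma loop_ext U V U' V' i j i' j' n m :
  (forall a b, (a <= n)%nat -> (b <= m)%nat ->
     U (i + a)%nat (j + b)%nat = U' (i' + a)%nat (j' + b)%nat /\
     V (i + a)%nat (j + b)%nat = V' (i' + a)%nat (j' + b)%nat) ->
  loop U V i j n m = loop U' V' i' j' n m.
Proof.
  intros H. unfold loop.
  assert (H0 : forall l, (l <= n)%nat -> U (i + l)%nat j = U' (i' + l)%nat j' /\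
     V (i + l)%nat j = V' (i' + l)%nat j').
  { intros l Hl. specialize (H l O Hl ltac:(lia)).
    rewrite !Nat.add_0_r in H. exact H. }
  assert (H1 : forall l, (l <= m)%nat -> U i (j + l)%nat = U' i' (j' + l)%nat /\
     V i (j + l)%nat = V' i' (j' + l)%nat).
  { intros l Hl. specialize (H O l ltac:(lia) Hl).
    rewrite !Nat.add_0_r in H. exact H. }
  f_equal; [f_equal; [f_equal|]|]; apply Rsum_ext; intros l Hl;
    rewrite <- !Nat.add_succ_r; f_equal;
    try (apply H0; lia); try (apply H1; lia); apply H; lia.
Qed.

Lemma loop_plus_l U W V i j n m :
  loop (fun a b => U a b + W a b) V i j n m = loop U V i j n m + loop W V i j n m.
Proof.
  unfold loop.
  assert (H : forall k u w v u' w' v', Rsum k (fun l => trap (u l + w l) (v l) (u' l + w' l) (v' l))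
    = Rsum k (fun l => trap (u l) (v l) (u' l) (v' l))
      + Rsum k (fun l => trap (w l) (v l) (w' l) (v' l))).
  { intros. rewrite <- Rsum_plus. apply Rsum_ext. intros. unfold trap. field. }
  rewrite !H. ring.
Qed.

Lemma loop_scal_l c U V i j n m :
  loop (fun a b => c * U a b) V i j n m = c * loop U V i j n m.
Proof.
  unfold loop.
  assert (H : forall k u v u' v', Rsum k (fun l => trap (c * u l) (v l) (c * u' l) (v' l))
    = c * Rsum k (fun l => trap (u l) (v l) (u' l) (v' l))).
  { intros. rewrite <- Rsum_scal. apply Rsum_ext. intros. unfold trap. field. }
  rewrite !H. ring.
Qed.

(** A discrete exact form sums to zero around a block. The edge form [e] is left arbitrary so that
    it can be a [trap], a sum of two of them, or the bare increment of the vertical coordinate. *)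
Lemma loop_exact W (e : R -> R -> R -> R -> R) U V i j n m :
  (forall a b a' b', e (U a b) (V a b) (U a' b') (V a' b') = W a' b' - W a b) ->
  Rsum n (fun l => e (U (i + l) j) (V (i + l) j)
                        (U (S (i + l)) j) (V (S (i + l)) j))%nat
  + Rsum m (fun l => e (U (i + n) (j + l)) (V (i + n) (j + l))
                          (U (i + n) (S (j + l))) (V (i + n) (S (j + l))))%nat
  - Rsum n (fun l => e (U (i + l) (j + m)) (V (i + l) (j + m))
                          (U (S (i + l)) (j + m)) (V (S (i + l)) (j + m)))%nat
  - Rsum m (fun l => e (U i (j + l)) (V i (j + l))
                          (U i (S (j + l))) (V i (S (j + l))))%nat = 0.
Proof.
  intros H.
  assert (T : forall k (w : nat -> R) f, (forall l, f l = w (S l) - w l) ->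
              Rsum k f = w k - w O).
  { intros k w f Hf. rewrite <- (Rsum_telescope k w). apply Rsum_ext. auto. }
  rewrite (T n (fun l => W (i + l)%nat j)), (T m (fun l => W (i + n)%nat (j + l)%nat)),
    (T n (fun l => W (i + l)%nat (j + m)%nat)), (T m (fun l => W i (j + l)%nat));
    try (intros; rewrite H, <- ?Nat.add_succ_r; reflexivity).
  rewrite !Nat.add_0_r. ring.
Qed.

Lemma loop_const_l c V i j n m : loop (fun _ _ => c) V i j n m = 0.
Proof.
  apply (loop_exact (fun a b => c * V a b) trap). intros. unfold trap. field.
Qed.

(* U dV + V dU = d(UV) holds exactly for trapezoidal sums. *)
Lemma loop_anti U V i j n m : loop U V i j n m = - loop V U i j n m.
Proof.
  assert (H := loop_exact (fun a b => U a b * V a b)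
    (fun u v u' v' => trap u v u' v' + trap v u v' u') U V i j n m).
  cbv beta in H. unfold loop. rewrite !Rsum_plus in H.
  assert (H' := H ltac:(intros; unfold trap; field)). lra.
Qed.

Lemma loop_refl U i j n m : loop U U i j n m = 0.
Proof. assert (H := loop_anti U U i j n m). lra. Qed.

Lemma loop_bound U V i j n B e :
  0 <= B -> 0 <= e ->
  (forall a b, (a <= n)%nat -> (b <= n)%nat -> Rabs (U (i + a)%nat (j + b)%nat) <= B) ->
  (forall a b, (a < n)%nat -> (b <= n)%nat ->
     Rabs (V (i + S a)%nat (j + b)%nat - V (i + a)%nat (j + b)%nat) <= e) ->
  (forall a b, (a <= n)%nat -> (b < n)%nat ->
     Rabs (V (i + a)%nat (j + S b)%nat - V (i + a)%nat (j + b)%nat) <= e) ->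
  Rabs (loop U V i j n n) <= 4 * INR n * (B * e).
Proof.
  intros HB He HU Hh Hv. unfold loop.
  assert (T : forall u v u' v', Rabs u <= B -> Rabs u' <= B -> Rabs (v' - v) <= e ->
                Rabs (trap u v u' v') <= B * e).
  { intros u v u' v' H1 H2 H3. unfold trap. rewrite Rabs_mult.
    apply Rmult_le_compat; try apply Rabs_pos; auto.
    apply Rabs_le_between in H1. apply Rabs_le_between in H2. apply Rabs_le. lra. }
  assert (HU0 : forall a, (a <= n)%nat -> Rabs (U (i + a)%nat j) <= B)
    by (intros a Ha; specialize (HU a O Ha ltac:(lia)); rewrite Nat.add_0_r in HU; auto).
  assert (HU1 : forall a, (a <= n)%nat -> Rabs (U i (j + a)%nat) <= B)
    by (intros a Ha; specialize (HU O a ltac:(lia) Ha); rewrite Nat.add_0_r in HU; auto).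
  assert (Hh0 : forall a, (a < n)%nat -> Rabs (V (i + S a)%nat j - V (i + a)%nat j) <= e)
    by (intros a Ha; specialize (Hh a O Ha ltac:(lia)); rewrite Nat.add_0_r in Hh; auto).
  assert (Hv0 : forall a, (a < n)%nat -> Rabs (V i (j + S a)%nat - V i (j + a)%nat) <= e)
    by (intros a Ha; specialize (Hv O a ltac:(lia) Ha); rewrite !Nat.add_0_r in Hv; auto).
  match goal with |- Rabs (?a + ?b - ?c - ?d) <= _ =>
    assert (Ha : Rabs a <= INR n * (B * e)); [|
    assert (Hb : Rabs b <= INR n * (B * e)); [|
    assert (Hc : Rabs c <= INR n * (B * e)); [|
    assert (Hd : Rabs d <= INR n * (B * e))]]] end.
  5: { apply Rabs_le_between in Ha. apply Rabs_le_between in Hb.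
       apply Rabs_le_between in Hc. apply Rabs_le_between in Hd.
       apply Rabs_le. lra. }
  all: apply Rsum_abs_le; intros l Hl; rewrite <- !Nat.add_succ_r; apply T; auto with arith.
Qed.

(** Replacing U and V by affine functions of X and Y leaves the determinant times the enclosed area.
    Antisymmetry is used to keep each remainder in the place of the integrand, where [loop_bound]
    needs only its size and not its increments. *)
Lemma loop_affine U V X Y u0 al be v0 ga de i j n :
  loop U V i j n n =
  (al * de - be * ga) * loop X Y i j n n
  + loop (fun a b => U a b - u0 - al * X a b - be * Y a b) V i j n n
  - al * loop (fun a b => V a b - v0 - ga * X a b - de * Y a b) X i j n n
  - be * loop (fun a b => V a b - v0 - ga * X a b - de * Y a b) Y i j n n.
Proof.
  assert (D : forall W w0 a' b' Q,
    loop W Q i j n n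
    = loop (fun a b => W a b - w0 - a' * X a b - b' * Y a b) Q i j n n
      + a' * loop X Q i j n n + b' * loop Y Q i j n n).
  { intros W w0 a' b' Q. rewrite <- !loop_scal_l, <- !loop_plus_l.
    rewrite <- (Rplus_0_r (loop (fun a b => _ + _ + _) Q i j n n)),
      <- (loop_const_l w0 Q i j n n), <- loop_plus_l.
    apply loop_ext. intros. split; ring. }
  rewrite (D U u0 al be V).
  rewrite (loop_anti X V), (loop_anti Y V), (D V v0 ga de X), (D V v0 ga de Y).
  rewrite !loop_refl, (loop_anti Y X). ring.
Qed.

(** * Functions with horizontal Taylor expansions *)

Definition unit_sq (a : R * R) : Prop := 0 <= fst a <= 1 /\ 0 <= snd a <= 1.

Definition dist1 (a b : R * R) : R := Rabs (fst a - fst b) + Rabs (snd a - snd b).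

Lemma dist1_nonneg a b : 0 <= dist1 a b.
Proof. apply Rplus_le_le_0_compat; apply Rabs_pos. Qed.

Lemma dist1_le2 a b : unit_sq a -> unit_sq b -> dist1 a b <= 2.
Proof.
  intros [A1 A2] [B1 B2]. unfold dist1.
  assert (Rabs (fst a - fst b) <= 1) by (apply Rabs_le; lra).
  assert (Rabs (snd a - snd b) <= 1) by (apply Rabs_le; lra). lra.
Qed.

Lemma unit_sq_net (eta : R) : 0 < eta ->
  exists l : list (R * R), (forall p, In p l -> unit_sq p) /\
    forall a, unit_sq a -> exists p, In p l /\ dist1 p a <= eta.
Proof.
  intros Heta.
  destruct (nfloor_ex (2 / eta)) as [N [_ HN]].
  { apply Rlt_le, Rdiv_lt_0_compat; lra. }
  set (M := S N). assert (HM : 2 / eta < INR M) by (unfold M; rewrite S_INR; lra).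
  assert (HM0 : 0 < INR M) by (unfold M; apply lt_0_INR; lia).
  assert (Hst : 1 / INR M <= eta / 2).
  { assert (X : 2 < eta * INR M).
    { apply (Rmult_lt_compat_l eta) in HM; [|lra].
      replace (eta * (2 / eta)) with 2 in HM by (field; lra). lra. }
    apply (Rmult_le_reg_r (INR M)); [lra|].
    replace (1 / INR M * INR M) with 1 by (field; lra). lra. }
  set (g := map (fun i => INR i / INR M) (seq 0 (S M))).
  assert (Hg : forall s, In s g -> 0 <= s <= 1).
  { intros s Hs. apply in_map_iff in Hs. destruct Hs as (i & <- & Hi).
    apply in_seq in Hi. assert (INR i <= INR M) by (apply le_INR; lia).
    assert (0 <= INR i) by apply pos_INR. split.
    - apply Rmult_le_pos; [lra|]. apply Rlt_le, Rinv_0_lt_compat. lra.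
    - apply (Rmult_le_reg_r (INR M)); [lra|].
      replace (INR i / INR M * INR M) with (INR i) by (field; lra). lra. }
  assert (Hn : forall s, 0 <= s <= 1 -> exists p, In p g /\ Rabs (p - s) <= eta / 2).
  { intros s Hs. destruct (nfloor_ex (s * INR M)) as [i [Hi1 Hi2]]; [nra|].
    exists (INR i / INR M). split.
    - apply in_map_iff. exists i. split; [reflexivity|]. apply in_seq.
      assert (INR i < INR (S M)) by (rewrite S_INR; nra). apply INR_lt in H. lia.
    - rewrite Rabs_minus_sym, Rabs_right.
      + apply Rle_trans with (2 := Hst).
        apply (Rmult_le_reg_r (INR M)); [lra|].
        replace ((s - INR i / INR M) * INR M) with (s * INR M - INR i) by (field; lra).
        replace (1 / INR M * INR M) with 1 by (field; lra). lra.
      + apply Rle_ge. apply (Rmult_le_reg_r (INR M)); [lra|].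
        replace ((s - INR i / INR M) * INR M) with (s * INR M - INR i) by (field; lra). lra. }
  exists (list_prod g g). split.
  - intros [s t] H. apply in_prod_iff in H. split; apply Hg, H.
  - intros [s t] [Hs Ht]. destruct (Hn s Hs) as (p & Hp & Ep).
    destruct (Hn t Ht) as (q & Hq & Eq). exists (p, q). split.
    + apply in_prod; assumption.
    + unfold dist1; simpl. lra.
Qed.

Definition lsum (l : list (R * R)) (f : R * R -> R) : R :=
  fold_right (fun p s => f p + s) 0 l.

Definition xcoord (F : R * R -> H1) (a : R * R) : R := fst (fst (F a)).
Definition ycoord (F : R * R -> H1) (a : R * R) : R := snd (fst (F a)).

Section Taylor.

Variable F : R * R -> H1.
Variable L : R.
Hypothesis HL : forall a b, unit_sq a -> unit_sq b -> rho (F a) (F b) <= L * dist1 a b.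

Local Notation X := (xcoord F).
Local Notation Y := (ycoord F).

(* Functions that have first order expansions in the horizontal coordinates
   [X], [Y] only, with a uniform quadratic remainder. *)
Definition taylor (u : R * R -> R) : Prop :=
  exists C, 0 <= C /\ forall a, unit_sq a -> exists al be,
    Rabs al <= C /\ Rabs be <= C /\
    forall b, unit_sq b ->
      Rabs (u b - u a - al * (X b - X a) - be * (Y b - Y a)) <= C * (dist1 a b * dist1 a b).

Lemma L_nonneg : 0 <= L.
Proof.
  assert (H := HL (0, 0) (1, 0)).
  unfold unit_sq, dist1 in H; simpl in H.
  rewrite Rminus_diag, Rabs_R0, Rabs_left in H by lra.
  specialize (H ltac:(lra) ltac:(lra)). assert (H0 := rho_nonneg (F (0, 0)) (F (1, 0))). lra.
Qed.

Lemma X_lip a b : unit_sq a -> unit_sq b -> Rabs (X b - X a) <= L * dist1 a b.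
Proof.
  intros Ha Hb. eapply Rle_trans; [|apply (HL a b); assumption].
  eapply Rle_trans; [|apply hor_le_rho]. unfold hor, xcoord.
  assert (H := Rabs_pos (snd (fst (F b)) - snd (fst (F a)))). lra.
Qed.

Lemma Y_lip a b : unit_sq a -> unit_sq b -> Rabs (Y b - Y a) <= L * dist1 a b.
Proof.
  intros Ha Hb. eapply Rle_trans; [|apply (HL a b); assumption].
  eapply Rle_trans; [|apply hor_le_rho]. unfold hor, ycoord.
  assert (H := Rabs_pos (fst (fst (F b)) - fst (fst (F a)))). lra.
Qed.

Lemma tau_quadratic a b : unit_sq a -> unit_sq b ->
  Rabs (tau (F a) (F b)) <= L * L * (dist1 a b * dist1 a b).
Proof.
  intros Ha Hb. eapply Rle_trans; [apply tau_le_rho|].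
  assert (H := HL a b Ha Hb). assert (H0 := rho_nonneg (F a) (F b)).
  replace (L * L * (dist1 a b * dist1 a b)) with ((L * dist1 a b) * (L * dist1 a b)) by ring.
  apply Rmult_le_compat; assumption.
Qed.

Lemma taylor_ext u v : (forall a, unit_sq a -> u a = v a) -> taylor u -> taylor v.
Proof.
  intros E (C & HC & H). exists C. split; [assumption|]. intros a Ha.
  destruct (H a Ha) as (al & be & H1 & H2 & H3). exists al, be.
  do 2 (split; [assumption|]). intros b Hb. rewrite <- !E by assumption. auto.
Qed.

Lemma taylor_lip u : taylor u ->
  exists C, 0 <= C /\ forall a b, unit_sq a -> unit_sq b -> Rabs (u b - u a) <= C * dist1 a b.
Proof.
  intros (C & HC & H). assert (HL0 := L_nonneg).
  exists (2 * C * L + 2 * C). split; [nra|].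
  intros a b Ha Hb. destruct (H a Ha) as (al & be & H1 & H2 & H3).
  specialize (H3 b Hb). assert (D0 := dist1_nonneg a b). assert (D2 := dist1_le2 a b Ha Hb).
  assert (E1 : Rabs (al * (X b - X a)) <= C * (L * dist1 a b)).
  { rewrite Rabs_mult. apply Rmult_le_compat; auto using Rabs_pos. apply X_lip; assumption. }
  assert (E2 : Rabs (be * (Y b - Y a)) <= C * (L * dist1 a b)).
  { rewrite Rabs_mult. apply Rmult_le_compat; auto using Rabs_pos. apply Y_lip; assumption. }
  assert (E3 : C * (dist1 a b * dist1 a b) <= C * (2 * dist1 a b)).
  { apply Rmult_le_compat_l; [assumption|]. apply Rmult_le_compat_r; assumption. }
  apply Rabs_le_between in H3. apply Rabs_le_between in E1. apply Rabs_le_between in E2.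
  apply Rabs_le. lra.
Qed.

Lemma taylor_bounded u : taylor u -> exists B, 0 <= B /\ forall a, unit_sq a -> Rabs (u a) <= B.
Proof.
  intros H. destruct (taylor_lip u H) as (C & HC & HC').
  exists (Rabs (u (0, 0)) + 2 * C).
  split; [assert (H0 := Rabs_pos (u (0, 0))); lra|]. intros a Ha.
  assert (O : unit_sq (0, 0)) by (unfold unit_sq; simpl; lra).
  specialize (HC' (0, 0) a O Ha). assert (D := dist1_le2 (0, 0) a O Ha).
  assert (E := Rabs_triang (u (0, 0)) (u a - u (0, 0))).
  replace (u (0, 0) + (u a - u (0, 0))) with (u a) in E by ring.
  assert (C * dist1 (0, 0) a <= C * 2) by (apply Rmult_le_compat_l; assumption). lra.
Qed.

Lemma taylor_const c : taylor (fun _ => c).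
Proof.
  exists 0. split; [lra|]. intros a _. exists 0, 0. rewrite !Rabs_R0.
  do 2 (split; [lra|]). intros b _.
  replace (c - c - 0 * (X b - X a) - 0 * (Y b - Y a)) with 0 by ring. rewrite Rabs_R0. lra.
Qed.

Lemma taylor_X : taylor X.
Proof.
  exists 1. split; [lra|]. intros a _. exists 1, 0. rewrite Rabs_R0, Rabs_R1.
  do 2 (split; [lra|]). intros b _.
  replace (X b - X a - 1 * (X b - X a) - 0 * (Y b - Y a)) with 0 by ring. rewrite Rabs_R0.
  assert (H := dist1_nonneg a b). nra.
Qed.

Lemma taylor_Y : taylor Y.
Proof.
  exists 1. split; [lra|]. intros a _. exists 0, 1. rewrite Rabs_R0, Rabs_R1.
  do 2 (split; [lra|]). intros b _.
  replace (Y b - Y a - 0 * (X b - X a) - 1 * (Y b - Y a)) with 0 by ring. rewrite Rabs_R0.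
  assert (H := dist1_nonneg a b). nra.
Qed.

(** Horizontality enters here: up to a quadratic error, dz = y dx, so the coefficients are [Y a] and
    0. *)
Lemma taylor_Z : taylor (fun a => snd (F a)).
Proof.
  destruct (taylor_bounded Y taylor_Y) as (B & HB & HB').
  assert (HL0 := L_nonneg).
  exists (B + 2 * (L * L)). split; [nra|]. intros a Ha. exists (Y a), 0.
  rewrite Rabs_R0. split; [specialize (HB' a Ha); nra|]. split; [nra|].
  intros b Hb.
  replace (snd (F b) - snd (F a) - Y a * (X b - X a) - 0 * (Y b - Y a))
    with (tau (F a) (F b) + (Y b - Y a) * (X b - X a) / 2)
    by (unfold tau, xcoord, ycoord; field).
  assert (T := tau_quadratic a b Ha Hb).
  assert (E : Rabs ((Y b - Y a) * (X b - X a)) <= (L * dist1 a b) * (L * dist1 a b)).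
  { rewrite Rabs_mult. apply Rmult_le_compat; auto using Rabs_pos, X_lip, Y_lip. }
  assert (D := dist1_nonneg a b).
  assert (0 <= B * (dist1 a b * dist1 a b)) by (apply Rmult_le_pos; nra).
  apply Rabs_le_between in T. apply Rabs_le_between in E. apply Rabs_le. nra.
Qed.

Lemma taylor_plus u v : taylor u -> taylor v -> taylor (fun a => u a + v a).
Proof.
  intros (C & HC & Hu) (C' & HC' & Hv). exists (C + C'). split; [lra|].
  intros a Ha. destruct (Hu a Ha) as (al & be & H1 & H2 & H3).
  destruct (Hv a Ha) as (al' & be' & H1' & H2' & H3').
  exists (al + al'), (be + be').
  split; [eapply Rle_trans; [apply Rabs_triang|]; lra|].
  split; [eapply Rle_trans; [apply Rabs_triang|]; lra|].
  intros b Hb. specialize (H3 b Hb). specialize (H3' b Hb).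
  apply Rabs_le_between in H3. apply Rabs_le_between in H3'. apply Rabs_le. lra.
Qed.

Lemma taylor_mult u v : taylor u -> taylor v -> taylor (fun a => u a * v a).
Proof.
  intros Tu Tv.
  destruct (taylor_lip u Tu) as (Lu & HLu & Hlu). destruct (taylor_lip v Tv) as (Lv & HLv & Hlv).
  destruct (taylor_bounded u Tu) as (Bu & HBu & Hbu).
  destruct (taylor_bounded v Tv) as (Bv & HBv & Hbv).
  destruct Tu as (C & HC & Hu). destruct Tv as (C' & HC' & Hv).
  exists (Bu * C' + Bv * C + Lu * Lv).
  assert (P1 : 0 <= Bu * C') by (apply Rmult_le_pos; assumption).
  assert (P2 : 0 <= Bv * C) by (apply Rmult_le_pos; assumption).
  assert (P3 : 0 <= Lu * Lv) by (apply Rmult_le_pos; assumption).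
  split; [lra|].
  intros a Ha. destruct (Hu a Ha) as (al & be & H1 & H2 & H3).
  destruct (Hv a Ha) as (al' & be' & H1' & H2' & H3').
  specialize (Hbu a Ha). specialize (Hbv a Ha).
  exists (u a * al' + v a * al), (u a * be' + v a * be).
  assert (S : forall p q, Rabs p <= C' -> Rabs q <= C ->
     Rabs (u a * p + v a * q) <= Bu * C' + Bv * C + Lu * Lv).
  { intros p q Hp Hq. eapply Rle_trans; [apply Rabs_triang|]. rewrite !Rabs_mult.
    assert (Rabs (u a) * Rabs p <= Bu * C') by (apply Rmult_le_compat; auto using Rabs_pos).
    assert (Rabs (v a) * Rabs q <= Bv * C) by (apply Rmult_le_compat; auto using Rabs_pos). lra. }
  do 2 (split; [apply S; assumption|]).
  intros b Hb. specialize (H3 b Hb). specialize (H3' b Hb).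
  specialize (Hlu a b Ha Hb). specialize (Hlv a b Ha Hb).
  set (e := u b - u a - al * (X b - X a) - be * (Y b - Y a)) in *.
  set (e' := v b - v a - al' * (X b - X a) - be' * (Y b - Y a)) in *.
  replace (u b * v b - u a * v a - (u a * al' + v a * al) * (X b - X a)
           - (u a * be' + v a * be) * (Y b - Y a))
    with (u a * e' + v a * e + (u b - u a) * (v b - v a)) by (unfold e, e'; ring).
  set (D := dist1 a b * dist1 a b) in *.
  assert (E1 : Rabs (u a * e') <= Bu * (C' * D))
    by (rewrite Rabs_mult; apply Rmult_le_compat; auto using Rabs_pos).
  assert (E2 : Rabs (v a * e) <= Bv * (C * D))
    by (rewrite Rabs_mult; apply Rmult_le_compat; auto using Rabs_pos).
  assert (E3 : Rabs ((u b - u a) * (v b - v a)) <= (Lu * dist1 a b) * (Lv * dist1 a b))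
    by (rewrite Rabs_mult; apply Rmult_le_compat; auto using Rabs_pos).
  apply Rabs_le_between in E1. apply Rabs_le_between in E2. apply Rabs_le_between in E3.
  replace ((Bu * C' + Bv * C + Lu * Lv) * D)
    with (Bu * (C' * D) + Bv * (C * D) + (Lu * dist1 a b) * (Lv * dist1 a b))
    by (unfold D; ring).
  apply Rabs_le. lra.
Qed.

(** The range S is explicit because g is only asked to have a quadratic remainder there: the inverse
    needs values bounded away from 0, the squared positive part bounded values. *)
Lemma taylor_comp u (g g' : R -> R) (S : R -> Prop) K :
  taylor u -> 0 <= K -> (forall a, unit_sq a -> S (u a)) ->
  (forall s, S s -> Rabs (g' s) <= K) ->
  (forall s t, S s -> S t -> Rabs (g t - g s - g' s * (t - s)) <= K * ((t - s) * (t - s))) ->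
  taylor (fun a => g (u a)).
Proof.
  intros Tu HK HS Hg' Hg.
  destruct (taylor_lip u Tu) as (Lu & HLu & Hlu). destruct Tu as (C & HC & Hu).
  exists (K * C + K * (Lu * Lu)).
  assert (P1 : 0 <= K * C) by (apply Rmult_le_pos; assumption).
  assert (P2 : 0 <= K * (Lu * Lu)) by (apply Rmult_le_pos; nra).
  split; [lra|].
  intros a Ha. destruct (Hu a Ha) as (al & be & H1 & H2 & H3).
  exists (g' (u a) * al), (g' (u a) * be).
  assert (S1 : forall p, Rabs p <= C -> Rabs (g' (u a) * p) <= K * C + K * (Lu * Lu)).
  { intros p Hp. rewrite Rabs_mult.
    assert (Rabs (g' (u a)) * Rabs p <= K * C)
      by (apply Rmult_le_compat; auto using Rabs_pos). lra. }
  do 2 (split; [apply S1; assumption|]).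
  intros b Hb. specialize (H3 b Hb). specialize (Hlu a b Ha Hb).
  specialize (Hg (u a) (u b) (HS a Ha) (HS b Hb)).
  set (e := u b - u a - al * (X b - X a) - be * (Y b - Y a)) in *.
  set (h := g (u b) - g (u a) - g' (u a) * (u b - u a)) in *.
  replace (g (u b) - g (u a) - g' (u a) * al * (X b - X a) - g' (u a) * be * (Y b - Y a))
    with (h + g' (u a) * e) by (unfold h, e; ring).
  assert (E1 : Rabs (g' (u a) * e) <= K * (C * (dist1 a b * dist1 a b)))
    by (rewrite Rabs_mult; apply Rmult_le_compat; auto using Rabs_pos).
  assert (E2 : (u b - u a) * (u b - u a) <= (Lu * dist1 a b) * (Lu * dist1 a b)).
  { assert (E := Rsqr_abs (u b - u a)). unfold Rsqr in E. rewrite E.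
    apply Rmult_le_compat; auto using Rabs_pos. }
  apply (Rmult_le_compat_l K) in E2; [|assumption].
  apply Rabs_le_between in E1. apply Rabs_le_between in Hg. apply Rabs_le. lra.
Qed.

(** Squaring the positive part gives a cut-off with Lipschitz derivative, which is all the
    smoothness that a quadratic remainder requires. *)
Lemma taylor_relu_sqr u : taylor u -> taylor (fun a => Rmax 0 (u a) * Rmax 0 (u a)).
Proof.
  intros Tu. destruct (taylor_bounded u Tu) as (B & HB & HB').
  apply (taylor_comp u (fun s => Rmax 0 s * Rmax 0 s) (fun s => 2 * Rmax 0 s)
           (fun s => Rabs s <= B) (2 * B + 1)); auto; [lra| |].
  - intros s Hs. apply Rabs_le_between in Hs. cbv beta. unfold Rmax.
    destruct (Rle_dec 0 s); apply Rabs_le; lra.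
  - intros s t Hs Ht. clear Hs Ht.
    assert (H := Rle_0_sqr (t - s)). unfold Rsqr in H.
    assert (E : Rabs (Rmax 0 t * Rmax 0 t - Rmax 0 s * Rmax 0 s - 2 * Rmax 0 s * (t - s))
                <= (t - s) * (t - s))
      by (unfold Rmax;
          destruct (Rle_dec 0 s) as [h|h], (Rle_dec 0 t) as [h'|h'];
          try apply Rnot_le_lt in h; try apply Rnot_le_lt in h';
          apply Rabs_le; split; nra).
    assert (0 <= 2 * B * ((t - s) * (t - s))) by (apply Rmult_le_pos; lra). lra.
Qed.

Lemma taylor_inv u kap : taylor u -> 0 < kap -> (forall a, unit_sq a -> kap <= u a) ->
  taylor (fun a => / u a).
Proof.
  intros Tu Hk Hu.
  assert (Hik := Rinv_0_lt_compat _ Hk).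
  apply (taylor_comp u Rinv (fun s => - (/ s * / s)) (fun s => kap <= s)
           (/ kap * / kap + / kap * / kap * / kap)); auto.
  - assert (0 < / kap * / kap) by nra. assert (0 < / kap * / kap * / kap) by nra. lra.
  - intros s Hs. assert (Hs' := Rinv_le_contravar _ _ Hk Hs).
    assert (0 < / s) by (apply Rinv_0_lt_compat; lra).
    assert (/ s * / s <= / kap * / kap) by (apply Rmult_le_compat; lra).
    assert (0 < / kap * / kap * / kap) by (repeat apply Rmult_lt_0_compat; assumption).
    rewrite Rabs_Ropp, Rabs_right; nra.
  - intros s t Hs Ht.
    replace (/ t - / s - - (/ s * / s) * (t - s))
      with (/ s * / s * / t * ((t - s) * (t - s))) by (field; lra).
    assert (Hs' := Rinv_le_contravar _ _ Hk Hs). assert (Ht' := Rinv_le_contravar _ _ Hk Ht).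
    assert (0 < / s) by (apply Rinv_0_lt_compat; lra).
    assert (0 < / t) by (apply Rinv_0_lt_compat; lra).
    assert (Q : / s * / s * / t <= / kap * / kap * / kap).
    { apply Rmult_le_compat; try lra; [nra|]. apply Rmult_le_compat; lra. }
    assert (0 < / s * / s * / t) by (repeat apply Rmult_lt_0_compat; assumption).
    assert (0 < / kap * / kap) by (apply Rmult_lt_0_compat; assumption).
    assert (Hsq := Rle_0_sqr (t - s)). unfold Rsqr in Hsq.
    rewrite Rabs_right by (apply Rle_ge, Rmult_le_pos; lra).
    apply Rmult_le_compat_r; lra.
Qed.

Lemma taylor_lsum l (f : R * R -> R * R -> R) :
  (forall p, In p l -> taylor (f p)) -> taylor (fun a => lsum l (fun p => f p a)).
Proof.
  induction l as [|p l IH]; intros H; simpl.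
  - apply taylor_const.
  - apply (taylor_plus (f p) (fun a => lsum l (fun p => f p a))).
    + apply H. left; reflexivity.
    + apply IH. intros; apply H. right; assumption.
Qed.

(* A partition of unity subordinate to small rho-balls, built from the smooth
   gauge hor^4 + tau^2, which is a polynomial in the coordinates. *)
Lemma taylor_dense u C eps :
  0 <= C -> 0 < eps ->
  (forall a b, unit_sq a -> unit_sq b -> Rabs (u a - u b) <= C * rho (F a) (F b)) ->
  exists w, taylor w /\ forall a, unit_sq a -> Rabs (u a - w a) <= eps.
Proof.
  intros HC Heps Hu. assert (HL0 := L_nonneg).
  (* The bump [phi p] will live in the [rho]-ball of radius 2 r around [F p], where u oscillates by
     at most eps. *)
  set (r := eps / (2 * (C + 1))).
  assert (Hr : 0 < r) by (apply Rdiv_lt_0_compat; lra).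
  assert (HCr : C * (2 * r) <= eps).
  { unfold r. apply (Rmult_le_reg_r (C + 1)); [lra|].
    replace (C * (2 * (eps / (2 * (C + 1)))) * (C + 1)) with (C * eps) by (field; lra). nra. }
  clearbody r. set (R4 := r * r * (r * r)).
  assert (HR4 : 0 < R4) by (unfold R4; repeat apply Rmult_lt_0_compat; assumption).
  (* This mesh puts every point within [rho]-distance r/2 of a centre, well inside the support of
     its bump; hence the lower bound [kap] on the sum of the bumps. *)
  destruct (unit_sq_net (r / (2 * (L + 1)))) as (l & Hl & Hnet).
  { apply Rdiv_lt_0_compat; lra. }
  set (G := fun p b => (((X b - X p) * (X b - X p) + (Y b - Y p) * (Y b - Y p))
                      * ((X b - X p) * (X b - X p) + (Y b - Y p) * (Y b - Y p)))
                     + tau (F p) (F b) * tau (F p) (F b)).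
  set (phi := fun p b => Rmax 0 (R4 - G p b) * Rmax 0 (R4 - G p b)).
  assert (Tphi : forall p, taylor (phi p)).
  { intros p.
    assert (TX : taylor (fun b => X b - X p))
      by exact (taylor_plus X (fun _ => - X p) taylor_X (taylor_const _)).
    assert (TY : taylor (fun b => Y b - Y p))
      by exact (taylor_plus Y (fun _ => - Y p) taylor_Y (taylor_const _)).
    assert (TT : taylor (fun b => tau (F p) (F b))).
    { apply (taylor_ext (fun b => (snd (F b) + - snd (F p))
                            + (- / 2) * ((Y b + Y p) * (X b - X p)))).
      - intros. unfold tau, xcoord, ycoord. field.
      - apply taylor_plus; [apply taylor_plus; [apply taylor_Z|apply taylor_const]|].
        apply taylor_mult; [apply taylor_const|]. apply taylor_mult; [|assumption].
        apply taylor_plus; [apply taylor_Y|apply taylor_const]. }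
    apply (taylor_relu_sqr (fun b => R4 - G p b)).
    apply (taylor_ext (fun b => R4 + (-1) * G p b)); [intros; ring|].
    apply taylor_plus; [apply taylor_const|].
    apply taylor_mult; [apply taylor_const|].
    repeat (assumption || apply taylor_mult || apply taylor_plus). }
  assert (phi0 : forall p b, 0 <= phi p b) by (intros; unfold phi; nra).
  assert (phi_pos : forall p b, unit_sq b -> In p l -> Rabs (u p - u b) * phi p b <= eps * phi p b).
  { intros p b Hb Hp. destruct (Rle_lt_dec R4 (G p b)) as [Hge|Hlt].
    - unfold phi. rewrite Rmax_left by lra. lra.
    - apply Rmult_le_compat_r; [apply phi0|].
      eapply Rle_trans; [apply Hu; auto|].
      apply Rle_trans with (2 := HCr). apply Rmult_le_compat_l; [assumption|].
      unfold G, R4 in Hlt.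
      set (A := (X b - X p) * (X b - X p)) in *. set (B := (Y b - Y p) * (Y b - Y p)) in *.
      assert (HA : 0 <= A) by apply Rle_0_sqr. assert (HB : 0 <= B) by apply Rle_0_sqr.
      assert (HT : 0 <= tau (F p) (F b) * tau (F p) (F b)) by apply Rle_0_sqr.
      assert (HAB : A + B <= r * r).
      { apply Rsqr_incr_0_var; unfold Rsqr; nra. }
      assert (Ht : Rabs (tau (F p) (F b)) <= r * r).
      { apply Rsqr_incr_0_var; [|nra]. rewrite <- Rsqr_abs. unfold Rsqr. nra. }
      apply rho_le; [lra| |nra].
      unfold hor. fold (X b) (X p) (Y b) (Y p).
      assert (Rabs (X b - X p) <= r).
      { apply Rsqr_incr_0_var; [|lra]. rewrite <- Rsqr_abs. unfold Rsqr, A in *. lra. }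
      assert (Rabs (Y b - Y p) <= r).
      { apply Rsqr_incr_0_var; [|lra]. rewrite <- Rsqr_abs. unfold Rsqr, B in *. lra. }
      lra. }
  set (kap := (R4 / 2) * (R4 / 2)).
  assert (Hkap : 0 < kap) by (unfold kap; nra).
  set (S := fun b => lsum l (fun p => phi p b)).
  assert (HS : forall b, unit_sq b -> kap <= S b).
  { intros b Hb. destruct (Hnet b Hb) as (p & Hp & Hd).
    assert (Hpb : kap <= phi p b).
    { assert (Hrho : rho (F p) (F b) <= r / 2).
      { eapply Rle_trans; [apply HL; auto|].
        eapply Rle_trans; [apply Rmult_le_compat_l; [assumption|apply Hd]|].
        apply (Rmult_le_reg_r (2 * (L + 1))); [lra|].
        replace (L * (r / (2 * (L + 1))) * (2 * (L + 1))) with (L * r) by (field; lra). nra. }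
      assert (Hr0 := rho_nonneg (F p) (F b)).
      assert (Hh := hor_le_rho (F p) (F b)). assert (Ht := tau_le_rho (F p) (F b)).
      unfold hor in Hh. fold (X b) (X p) (Y b) (Y p) in Hh.
      set (q := rho (F p) (F b)) in *.
      assert (Hq2 : q * q <= r * r / 4) by nra.
      assert (HAB : (X b - X p) * (X b - X p) + (Y b - Y p) * (Y b - Y p) <= r * r / 4).
      { assert (E1 := Rsqr_abs (X b - X p)). assert (E2 := Rsqr_abs (Y b - Y p)).
        unfold Rsqr in E1, E2. rewrite E1, E2.
        assert (P1 := Rabs_pos (X b - X p)). assert (P2 := Rabs_pos (Y b - Y p)). nra. }
      assert (HT : tau (F p) (F b) * tau (F p) (F b) <= (r * r / 4) * (r * r / 4)).
      { assert (E1 := Rsqr_abs (tau (F p) (F b))). unfold Rsqr in E1. rewrite E1.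
        apply Rmult_le_compat; try apply Rabs_pos; lra. }
      assert (HG : G p b <= R4 / 2).
      { unfold G, R4.
        assert (Q1 := Rle_0_sqr (X b - X p)). assert (Q2 := Rle_0_sqr (Y b - Y p)).
        unfold Rsqr in Q1, Q2.
        assert (((X b - X p) * (X b - X p) + (Y b - Y p) * (Y b - Y p))
                      * ((X b - X p) * (X b - X p) + (Y b - Y p) * (Y b - Y p))
                <= (r * r / 4) * (r * r / 4)) by (apply Rmult_le_compat; lra).
        assert (0 <= r * r * (r * r)) by nra. lra. }
      unfold phi, kap. rewrite Rmax_right by lra. apply Rmult_le_compat; lra. }
    apply Rle_trans with (1 := Hpb). unfold S. clear - Hp phi0.
    assert (Hnn : forall l, 0 <= lsum l (fun p => phi p b)).
    { intros l0. induction l0 as [|q l0 IH]; simpl; [lra|]. specialize (phi0 q b). lra. }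
    induction l as [|q l IH]; simpl in *; [contradiction|].
    destruct Hp as [<-|Hp].
    - specialize (Hnn l). lra.
    - specialize (IH Hp). specialize (phi0 q b). lra. }
  exists (fun b => lsum l (fun p => u p * phi p b) * / S b). split.
  - apply taylor_mult.
    + apply (taylor_lsum l (fun p b => u p * phi p b)). intros p _.
      apply taylor_mult; [apply taylor_const|apply Tphi].
    + apply (taylor_inv S kap); auto. apply (taylor_lsum l phi). auto.
  - intros b Hb. specialize (HS b Hb).
    replace (u b - lsum l (fun p => u p * phi p b) * / S b)
      with (- ((lsum l (fun p => u p * phi p b) - u b * S b) * / S b)) by (field; lra).
    (* The approximant is a weighted mean of values u p, and only centres with u p within eps of u b
       carry weight. *)
    assert (E : Rabs (lsum l (fun p => u p * phi p b) - u b * S b) <= eps * S b).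
    { unfold S. clear - Hb phi_pos phi0. induction l as [|q l IH]; simpl.
      - rewrite !Rmult_0_r, Rminus_0_r, Rabs_R0. lra.
      - assert (IH' := IH (fun p b Hb Hp => phi_pos p b Hb (or_intror Hp))).
        assert (Hq := phi_pos q b Hb (or_introl eq_refl)).
        specialize (phi0 q b).
        replace (u q * phi q b + lsum l (fun p => u p * phi p b)
                 - u b * (phi q b + lsum l (fun p => phi p b)))
          with ((u q - u b) * phi q b
                + (lsum l (fun p => u p * phi p b) - u b * lsum l (fun p => phi p b))) by ring.
        eapply Rle_trans; [apply Rabs_triang|]. rewrite Rabs_mult, (Rabs_right (phi q b)) by lra.
        lra. }
    assert (Hi : 0 < / S b) by (apply Rinv_0_lt_compat; lra).
    rewrite Rabs_Ropp, Rabs_mult, (Rabs_right (/ S b)) by lra.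
    apply (Rmult_le_compat_r (/ S b)) in E; [|lra].
    replace (eps * S b * / S b) with eps in E by (field; lra). exact E.
Qed.

End Taylor.

(** * Stokes' theorem *)

(* The multiples [K * n], [n] large, generate a filter base on [nat]; it allows
   subdividing grids while keeping finitely many conditions compatible. *)
Definition evm (P : nat -> Prop) : Prop :=
  exists K n0, (1 <= K)%nat /\ (1 <= n0)%nat /\ forall n, (n0 <= n)%nat -> P (K * n)%nat.

Lemma evm_impl (P Q : nat -> Prop) :
  (forall q, (1 <= q)%nat -> P q -> Q q) -> evm P -> evm Q.
Proof.
  intros H (K & n0 & HK & Hn & HP). exists K, n0. do 2 (split; [assumption|]).
  intros n Hle. apply H; [nia|auto].
Qed.

Lemma evm_and P Q : evm P -> evm Q -> evm (fun q => P q /\ Q q).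
Proof.
  intros (K & n0 & HK & Hn & HP) (K' & n0' & HK' & Hn' & HQ).
  exists (K * K')%nat, (n0 + n0')%nat. split; [nia|]. split; [lia|].
  intros n Hle. split.
  - rewrite <- Nat.mul_assoc. apply HP. nia.
  - rewrite (Nat.mul_comm K), <- Nat.mul_assoc. apply HQ. nia.
Qed.

Lemma evm_true : evm (fun _ => True).
Proof. exists 1%nat, 1%nat. auto. Qed.

Lemma evm_forall_lt (P : nat -> nat -> Prop) N :
  (forall i, (i < N)%nat -> evm (P i)) -> evm (fun q => forall i, (i < N)%nat -> P i q).
Proof.
  induction N as [|N IH]; intros H.
  - apply (evm_impl (fun _ => True)); [intros; lia|apply evm_true].
  - apply (evm_impl (fun q => (forall i, (i < N)%nat -> P i q) /\ P N q)).
    + intros q _ [H1 H2] i Hi.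
      destruct (Nat.eq_dec i N) as [->|]; [assumption|apply H1; lia].
    + apply evm_and; [apply IH; intros; apply H; lia|apply H; lia].
Qed.

Lemma evm_forall_in {A} (P : A -> nat -> Prop) l :
  (forall a, In a l -> evm (P a)) -> evm (fun q => forall a, In a l -> P a q).
Proof.
  induction l as [|b l IH]; intros H.
  - apply (evm_impl (fun _ => True)); [intros; contradiction|apply evm_true].
  - apply (evm_impl (fun q => P b q /\ forall a, In a l -> P a q)).
    + intros q _ [H1 H2] a [<-|Ha]; auto.
    + apply evm_and; [apply H; left; reflexivity|apply IH; intros; apply H; right; auto].
Qed.

Lemma evm_mul (P : nat -> Prop) J : (1 <= J)%nat -> evm (fun q => P (J * q)%nat) -> evm P.
Proof.
  intros HJ (K & n0 & HK & Hn & HP). exists (J * K)%nat, n0.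
  split; [nia|]. split; [assumption|].
  intros n Hle. rewrite <- Nat.mul_assoc. auto.
Qed.

Lemma evm_ex P : evm P -> exists q, (1 <= q)%nat /\ P q.
Proof. intros (K & n0 & HK & Hn & HP). exists (K * n0)%nat. split; [nia|auto]. Qed.

Definition grid (n : nat) (u : R * R -> R) (i j : nat) : R :=
  u (INR i / INR n, INR j / INR n).

Lemma node_unit n i : (1 <= n)%nat -> (i <= n)%nat -> 0 <= INR i / INR n <= 1.
Proof.
  intros Hn Hi. assert (0 < INR n) by (apply lt_0_INR; lia).
  assert (0 <= INR i) by apply pos_INR. apply le_INR in Hi. split.
  - apply Rmult_le_pos; [lra|]. apply Rlt_le, Rinv_0_lt_compat. lra.
  - apply (Rmult_le_reg_r (INR n)); [lra|].
    replace (INR i / INR n * INR n) with (INR i) by (field; lra). lra.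
Qed.

Lemma INR_ratio n i k : (1 <= n)%nat -> INR (i + k) / INR n - INR i / INR n = INR k / INR n.
Proof.
  intros Hn. assert (0 < INR n) by (apply lt_0_INR; lia). rewrite plus_INR. field. lra.
Qed.

Lemma dist1_node_S_l n i k j :
  (1 <= n)%nat ->
  dist1 (INR (i + k) / INR n, INR j / INR n) (INR (i + S k) / INR n, INR j / INR n)
  = / INR n.
Proof.
  intros Hn. unfold dist1; simpl fst; simpl snd.
  assert (0 < INR n) by (apply lt_0_INR; lia).
  replace (i + S k)%nat with (i + k + 1)%nat by lia.
  rewrite Rabs_minus_sym, INR_ratio, Rminus_diag, Rabs_R0 by assumption. simpl INR.
  rewrite Rabs_right; [field; lra|].
  apply Rle_ge, Rmult_le_pos; [lra|apply Rlt_le, Rinv_0_lt_compat; lra].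
Qed.

Lemma dist1_node_S_r n i j k :
  (1 <= n)%nat ->
  dist1 (INR j / INR n, INR (i + k) / INR n) (INR j / INR n, INR (i + S k) / INR n)
  = / INR n.
Proof.
  intros Hn. rewrite <- (dist1_node_S_l n i k j Hn). unfold dist1; simpl fst; simpl snd. ring.
Qed.

Lemma grid_loop_bound q u v i j n B e :
  (1 <= q)%nat -> (i + n <= q)%nat -> (j + n <= q)%nat -> 0 <= B -> 0 <= e ->
  (forall a b, (a <= n)%nat -> (b <= n)%nat ->
     Rabs (u (INR (i + a) / INR q, INR (j + b) / INR q)) <= B) ->
  (forall a b, unit_sq a -> unit_sq b -> dist1 a b <= / INR q -> Rabs (v b - v a) <= e) ->
  Rabs (loop (grid q u) (grid q v) i j n n) <= 4 * INR n * (B * e).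
Proof.
  intros Hq Hi Hj HB He Hu Hv. apply loop_bound; auto; intros a b Ha Hb; apply Hv;
    try (split; simpl; apply node_unit; lia).
  - rewrite dist1_node_S_l by assumption. lra.
  - rewrite dist1_node_S_r by assumption. lra.
Qed.

Section Cell.

Variable F : R * R -> H1.
Variable L : R.
Hypothesis HL : forall a b, unit_sq a -> unit_sq b -> rho (F a) (F b) <= L * dist1 a b.

Local Notation X := (xcoord F).
Local Notation Y := (ycoord F).

(* The vertical coordinate closes up along a loop, which bounds the enclosed
   area by the sum of the quadratic errors along the edges. *)
Lemma area_bound q i j n :
  (1 <= q)%nat -> (i + n <= q)%nat -> (j + n <= q)%nat ->
  Rabs (loop (grid q Y) (grid q X) i j n n) <= 4 * INR n * (L * L * (/ INR q * / INR q)).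
Proof.
  intros Hq Hi Hj.
  set (P := fun a b => (INR a / INR q, INR b / INR q)).
  assert (HP : forall a b, (a <= q)%nat -> (b <= q)%nat -> unit_sq (P a b))
    by (intros; split; simpl; apply node_unit; assumption).
  assert (E : forall a b a' b', trap (grid q Y a b) (grid q X a b) (grid q Y a' b') (grid q X a' b')
     = - tau (F (P a b)) (F (P a' b')) + (snd (F (P a' b')) - snd (F (P a b)))).
  { intros. unfold trap, tau, grid, P, xcoord, ycoord. ring. }
  assert (HT : forall a b a' b', unit_sq (P a b) -> unit_sq (P a' b') ->
     dist1 (P a b) (P a' b') <= / INR q ->
     Rabs (- tau (F (P a b)) (F (P a' b'))) <= L * L * (/ INR q * / INR q)).
  { intros a b a' b' H1 H2 H3. rewrite Rabs_Ropp.
    eapply Rle_trans; [apply (tau_quadratic F L HL); assumption|].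
    apply Rmult_le_compat_l; [apply Rle_0_sqr|].
    apply Rmult_le_compat; auto using dist1_nonneg. }
  (* The increments of the vertical coordinate telescope around the block, leaving only the [tau]
     terms. *)
  assert (Z0 := loop_exact (fun a b => snd (F (P a b))) (fun a b c d => d - b)
    (fun a b => 0) (fun a b => snd (F (P a b))) i j n n ltac:(reflexivity)).
  cbv beta in Z0.
  unfold loop.
  rewrite (Rsum_ext n _ _ (fun l _ => E (i + l) j (S (i + l)) j)%nat).
  rewrite (Rsum_ext n _ _ (fun l _ => E (i + n) (j + l) (i + n) (S (j + l)))%nat).
  rewrite (Rsum_ext n _ _ (fun l _ => E (i + l) (j + n) (S (i + l)) (j + n))%nat).
  rewrite (Rsum_ext n _ _ (fun l _ => E i (j + l) i (S (j + l)))%nat).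
  rewrite !Rsum_plus.
  match goal with |- Rabs (?a + _ + (?b + _) - (?c + _) - (?d + _)) <= _ =>
    assert (Ha : Rabs a <= INR n * (L * L * (/ INR q * / INR q))); [|
    assert (Hb : Rabs b <= INR n * (L * L * (/ INR q * / INR q))); [|
    assert (Hc : Rabs c <= INR n * (L * L * (/ INR q * / INR q))); [|
    assert (Hd : Rabs d <= INR n * (L * L * (/ INR q * / INR q)))]]] end.
  5: { apply Rabs_le_between in Ha. apply Rabs_le_between in Hb.
       apply Rabs_le_between in Hc. apply Rabs_le_between in Hd.
       apply Rabs_le. lra. }
  all: apply Rsum_abs_le; intros l Hl; apply HT; try (apply HP; lia);
    unfold P; rewrite <- ?Nat.add_succ_r;
    first [rewrite dist1_node_S_l by assumption | rewrite dist1_node_S_r by assumption]; lra.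
Qed.

(** Two scales are needed: K by K blocks of n by n cells, with the affine approximation taken at a
    corner of each block. The area terms add up to order 1/n and the remainders to order 1/K, so n
    at least K with K large suffices. *)
Lemma stokes_taylor u v eps :
  taylor F u -> taylor F v -> 0 < eps ->
  evm (fun q => Rabs (loop (grid q u) (grid q v) 0 0 q q) <= eps).
Proof.
  intros Tu Tv Heps.
  assert (HL0 := L_nonneg F L HL).
  destruct (taylor_lip F L HL v Tv) as (M & HM & HvM).
  destruct Tu as (Cu & HCu & Hu). destruct Tv as (Cv & HCv & Hv).
  set (c0 := 8 * (Cu * Cv) * (L * L)).
  set (c1 := 16 * Cu * M + 2 * Cu * (16 * Cv * L)).
  assert (Hc0 : 0 <= c0) by (unfold c0; repeat apply Rmult_le_pos; lra).
  assert (Hc1 : 0 <= c1)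
    by (unfold c1; apply Rplus_le_le_0_compat; repeat apply Rmult_le_pos; lra).
  destruct (nfloor_ex (4 * (c0 + c1) / eps)) as [N [_ HN]].
  { apply Rmult_le_pos; [lra|]. apply Rlt_le, Rinv_0_lt_compat; lra. }
  set (K := S N). assert (HK : 4 * (c0 + c1) / eps < INR K) by (unfold K; rewrite S_INR; lra).
  assert (HK0 : 0 < INR K) by (unfold K; apply lt_0_INR; lia).
  assert (HKe : 4 * (c0 + c1) <= eps * INR K).
  { apply (Rmult_lt_compat_l eps) in HK; [|assumption].
    replace (eps * (4 * (c0 + c1) / eps)) with (4 * (c0 + c1)) in HK by (field; lra). lra. }
  exists K, K. split; [unfold K; lia|]. split; [unfold K; lia|]. intros n Hn.
  assert (Hn0 : 0 < INR n) by (apply lt_0_INR; unfold K in Hn; lia).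
  set (q := (K * n)%nat).
  assert (Hq1 : (1 <= q)%nat) by (unfold q; unfold K in *; nia).
  assert (Hq : INR q = INR K * INR n) by apply mult_INR.
  assert (Hq0 : 0 < INR q) by (rewrite Hq; nra).
  assert (Hiq : 0 < / INR q) by (apply Rinv_0_lt_compat; lra).
  unfold q at 3 4. rewrite loop_blocks.
  set (bd := c0 * (INR n * (/ INR q * / INR q))
             + c1 * (INR n * (/ INR K * / INR K * / INR q))).
  apply Rle_trans with (INR K * (INR K * bd)).
  - apply Rsum_abs_le. intros A HA. apply Rsum_abs_le. intros B HB. rewrite !Nat.add_0_l.
    set (i := (A * n)%nat). set (j := (B * n)%nat).
    assert (Hi : (i + n <= q)%nat) by (unfold i, q; nia).
    assert (Hj : (j + n <= q)%nat) by (unfold j, q; nia).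
    set (P := fun a b => (INR a / INR q, INR b / INR q)).
    assert (HP : forall a b, (a <= q)%nat -> (b <= q)%nat -> unit_sq (P a b))
      by (intros; split; simpl; apply node_unit; assumption).
    set (p0 := P i j). assert (Hp0 : unit_sq p0) by (apply HP; lia).
    destruct (Hu p0 Hp0) as (al & be & Hal & Hbe & Eu).
    destruct (Hv p0 Hp0) as (ga & de & Hga & Hde & Ev).
    (* A block has side 1/K, so its points are within 2/K of the corner in [dist1]. *)
    assert (HD : forall a b, (a <= n)%nat -> (b <= n)%nat ->
       dist1 p0 (P (i + a)%nat (j + b)%nat) * dist1 p0 (P (i + a)%nat (j + b)%nat)
       <= 4 * (/ INR K * / INR K)).
    { intros a b Ha Hb.
      assert (Hr : forall i a, (a <= n)%nat -> Rabs (INR i / INR q - INR (i + a) / INR q) <= / INR K).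
      { intros i0 a0 Ha0. rewrite Rabs_minus_sym, INR_ratio by assumption.
        rewrite Rabs_right by (apply Rle_ge, Rmult_le_pos; [apply pos_INR|lra]).
        rewrite Hq. apply le_INR in Ha0.
        apply (Rmult_le_reg_r (INR K * INR n)); [nra|].
        replace (INR a0 / (INR K * INR n) * (INR K * INR n)) with (INR a0) by (field; lra).
        replace (/ INR K * (INR K * INR n)) with (INR n) by (field; lra). lra. }
      assert (Dl : dist1 p0 (P (i + a)%nat (j + b)%nat) <= 2 * / INR K).
      { unfold dist1, p0, P; simpl fst; simpl snd.
        assert (H1 := Hr i a Ha). assert (H2 := Hr j b Hb). lra. }
      assert (D0 := dist1_nonneg p0 (P (i + a)%nat (j + b)%nat)).
      replace (4 * (/ INR K * / INR K)) with ((2 * / INR K) * (2 * / INR K)) by ring.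
      apply Rmult_le_compat; assumption. }
    set (eu := fun a : R * R => u a - u p0 - al * (X a - X p0) - be * (Y a - Y p0)).
    set (ev := fun a : R * R => v a - v p0 - ga * (X a - X p0) - de * (Y a - Y p0)).
    rewrite (loop_affine (grid q u) (grid q v) (grid q X) (grid q Y)
               (u p0 - al * X p0 - be * Y p0) al be (v p0 - ga * X p0 - de * Y p0) ga de).
    rewrite (loop_ext _ (grid q v) (grid q eu) (grid q v) i j i j)
      by (intros; split; [unfold eu, grid; cbv beta; ring|reflexivity]).
    rewrite (loop_ext _ (grid q X) (grid q ev) (grid q X) i j i j)
      by (intros; split; [unfold ev, grid; cbv beta; ring|reflexivity]).
    rewrite (loop_anti (grid q X)).
    rewrite (loop_ext _ (grid q Y) (grid q ev) (grid q Y) i j i j)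
      by (intros; split; [unfold ev, grid; cbv beta; ring|reflexivity]).
    assert (HiK : 0 < / INR K) by (apply Rinv_0_lt_compat; lra).
    assert (HKK : 0 <= / INR K * / INR K) by nra.
    assert (Beu : Rabs (loop (grid q eu) (grid q v) i j n n)
              <= 4 * INR n * (Cu * (4 * (/ INR K * / INR K)) * (M * / INR q))).
    { apply grid_loop_bound; auto.
      - apply Rmult_le_pos; lra.
      - apply Rmult_le_pos; lra.
      - intros a b Ha Hb. eapply Rle_trans; [apply Eu; apply HP; lia|].
        apply Rmult_le_compat_l; [assumption|]. apply HD; assumption.
      - intros a b Ha Hb Hd. eapply Rle_trans; [apply HvM; assumption|].
        apply Rmult_le_compat_l; assumption. }
    assert (Bev : forall W : R * R -> R, (forall a b, unit_sq a -> unit_sq b -> Rabs (W b - W a) <= L * dist1 a b) ->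
       Rabs (loop (grid q ev) (grid q W) i j n n)
              <= 4 * INR n * (Cv * (4 * (/ INR K * / INR K)) * (L * / INR q))).
    { intros W HW. apply grid_loop_bound; auto.
      - apply Rmult_le_pos; lra.
      - apply Rmult_le_pos; lra.
      - intros a b Ha Hb. eapply Rle_trans; [apply Ev; apply HP; lia|].
        apply Rmult_le_compat_l; [assumption|]. apply HD; assumption.
      - intros a b Ha Hb Hd. eapply Rle_trans; [apply HW; assumption|].
        apply Rmult_le_compat_l; assumption. }
    assert (BX := Bev X (X_lip F L HL)). assert (BY := Bev Y (Y_lip F L HL)).
    assert (BA := area_bound q i j n Hq1 Hi Hj).
    set (lYX := loop (grid q Y) (grid q X) i j n n) in *.
    set (lu := loop (grid q eu) (grid q v) i j n n) in *.
    set (lX := loop (grid q ev) (grid q X) i j n n) in *.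
    set (lY := loop (grid q ev) (grid q Y) i j n n) in *.
    assert (G1 : Rabs ((al * de - be * ga) * - lYX)
       <= 2 * (Cu * Cv) * (4 * INR n * (L * L * (/ INR q * / INR q)))).
    { rewrite Rabs_mult, Rabs_Ropp. apply Rmult_le_compat; auto using Rabs_pos.
      unfold Rminus. eapply Rle_trans; [apply Rabs_triang|]. rewrite Rabs_Ropp, !Rabs_mult.
      assert (Rabs al * Rabs de <= Cu * Cv) by (apply Rmult_le_compat; auto using Rabs_pos).
      assert (Rabs be * Rabs ga <= Cu * Cv) by (apply Rmult_le_compat; auto using Rabs_pos). lra. }
    assert (G2 : Rabs (al * lX) <= Cu * (4 * INR n * (Cv * (4 * (/ INR K * / INR K)) * (L * / INR q))))
      by (rewrite Rabs_mult; apply Rmult_le_compat; auto using Rabs_pos).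
    assert (G3 : Rabs (be * lY) <= Cu * (4 * INR n * (Cv * (4 * (/ INR K * / INR K)) * (L * / INR q))))
      by (rewrite Rabs_mult; apply Rmult_le_compat; auto using Rabs_pos).
    replace bd with
      (2 * (Cu * Cv) * (4 * INR n * (L * L * (/ INR q * / INR q)))
       + 4 * INR n * (Cu * (4 * (/ INR K * / INR K)) * (M * / INR q))
       + 2 * (Cu * (4 * INR n * (Cv * (4 * (/ INR K * / INR K)) * (L * / INR q)))))
      by (unfold bd, c0, c1; ring).
    apply Rabs_le_between in G1. apply Rabs_le_between in G2. apply Rabs_le_between in G3.
    apply Rabs_le_between in Beu. apply Rabs_le. lra.
  - assert (HnK : INR K <= INR n) by (apply le_INR; assumption).
    unfold bd. rewrite Hq.
    replace (INR K * (INR K * (c0 * (INR n * (/ (INR K * INR n) * / (INR K * INR n))) +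
       c1 * (INR n * (/ INR K * / INR K * / (INR K * INR n))))))
      with (c0 * / INR n + c1 * / INR K) by (field; lra).
    assert (/ INR n <= / INR K) by (apply Rinv_le_contravar; lra).
    assert (c0 * / INR n <= c0 * / INR K) by (apply Rmult_le_compat_l; assumption).
    apply (Rmult_le_reg_r (INR K)); [assumption|].
    assert (E : (c0 * / INR K + c1 * / INR K) * INR K = c0 + c1) by (field; lra).
    nra.
Qed.

(** The order of the approximations matters. The Lipschitz constant of the approximant u' is not
    controlled by C, so v' is chosen after it, with an error adapted to that constant. Integration
    by parts lets v - v' be measured in sup norm only. The 12 stands for three terms with four sides
    each. *)
Lemma stokes_global u v C eps :
  0 <= C -> 0 < eps ->
  (forall a b, unit_sq a -> unit_sq b -> Rabs (u a - u b) <= C * rho (F a) (F b)) ->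
  (forall a b, unit_sq a -> unit_sq b -> Rabs (v a - v b) <= C * rho (F a) (F b)) ->
  evm (fun q => Rabs (loop (grid q u) (grid q v) 0 0 q q) <= eps).
Proof.
  intros HC Heps Hu Hv. assert (HL0 := L_nonneg F L HL).
  assert (HCL : 0 <= C * L) by (apply Rmult_le_pos; assumption).
  set (e1 := eps / (12 * (C * L + 1))).
  assert (He1 : 0 < e1) by (apply Rdiv_lt_0_compat; lra).
  destruct (taylor_dense F L HL u C e1 HC He1 Hu) as (u' & Tu & Eu).
  destruct (taylor_lip F L HL u' Tu) as (M & HM & HuM).
  set (e2 := eps / (12 * (M + 1))).
  assert (He2 : 0 < e2) by (apply Rdiv_lt_0_compat; lra).
  destruct (taylor_dense F L HL v C e2 HC He2 Hv) as (v' & Tv & Ev).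
  apply (evm_impl (fun q => Rabs (loop (grid q u') (grid q v') 0 0 q q) <= eps / 3));
    [|apply stokes_taylor; auto; lra].
  intros q Hq H. assert (Hq0 : 0 < INR q) by (apply lt_0_INR; lia).
  assert (Hiq : 0 < / INR q) by (apply Rinv_0_lt_compat; lra).
  assert (node : forall a b, (a <= q)%nat -> (b <= q)%nat ->
     unit_sq (INR (0 + a) / INR q, INR (0 + b) / INR q))
    by (intros; split; simpl; apply node_unit; assumption).
  assert (D1 : Rabs (loop (grid q (fun a => u a - u' a)) (grid q v) 0 0 q q)
               <= 4 * INR q * (e1 * (C * L * / INR q))).
  { apply grid_loop_bound; auto; try lia; try lra.
    - apply Rmult_le_pos; lra.
    - intros a b Ha Hb Hd. rewrite Rabs_minus_sym.
      eapply Rle_trans; [apply Hv; assumption|].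
      rewrite Rmult_assoc. apply Rmult_le_compat_l; [assumption|].
      eapply Rle_trans; [apply HL; assumption|]. apply Rmult_le_compat_l; assumption. }
  assert (D2 : Rabs (loop (grid q (fun a => v a - v' a)) (grid q u') 0 0 q q)
               <= 4 * INR q * (e2 * (M * / INR q))).
  { apply grid_loop_bound; auto; try lia; try lra.
    - apply Rmult_le_pos; lra.
    - intros a b Ha Hb Hd.
      eapply Rle_trans; [apply HuM; assumption|]. apply Rmult_le_compat_l; assumption. }
  replace (4 * INR q * (e1 * (C * L * / INR q))) with (4 * e1 * (C * L)) in D1 by (field; lra).
  replace (4 * INR q * (e2 * (M * / INR q))) with (4 * e2 * M) in D2 by (field; lra).
  assert (B1 : 4 * e1 * (C * L) <= eps / 3).
  { unfold e1. apply (Rmult_le_reg_r (C * L + 1)); [lra|].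
    replace (4 * (eps / (12 * (C * L + 1))) * (C * L) * (C * L + 1))
      with (eps / 3 * (C * L)) by (field; lra). nra. }
  assert (B2 : 4 * e2 * M <= eps / 3).
  { unfold e2. apply (Rmult_le_reg_r (M + 1)); [lra|].
    replace (4 * (eps / (12 * (M + 1))) * M * (M + 1))
      with (eps / 3 * M) by (field; lra). nra. }
  assert (S1 : loop (grid q u) (grid q v) 0 0 q q
    = loop (grid q (fun a => u a - u' a)) (grid q v) 0 0 q q
      - (loop (grid q (fun a => v a - v' a)) (grid q u') 0 0 q q
         - loop (grid q u') (grid q v') 0 0 q q)).
  { rewrite (loop_anti (grid q u') (grid q v')).
    assert (E1 : loop (grid q (fun a => v a - v' a)) (grid q u') 0 0 q q
       + loop (grid q v') (grid q u') 0 0 q q = loop (grid q v) (grid q u') 0 0 q q).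
    { rewrite <- loop_plus_l. apply loop_ext. intros; split; [unfold grid; ring|reflexivity]. }
    assert (E2 : loop (grid q (fun a => u a - u' a)) (grid q v) 0 0 q q
       + loop (grid q u') (grid q v) 0 0 q q = loop (grid q u) (grid q v) 0 0 q q).
    { rewrite <- loop_plus_l. apply loop_ext. intros; split; [unfold grid; ring|reflexivity]. }
    rewrite (loop_anti (grid q u') (grid q v)) in E2. lra. }
  rewrite S1.
  apply Rabs_le_between in D1. apply Rabs_le_between in D2. apply Rabs_le_between in H.
  apply Rabs_le. lra.
Qed.

End Cell.

(** On squares of side 1/J, of diameter at most delta, the local hypotheses become global; the sums
    over the J^2 squares add up because only grids divisible by J are considered. *)
Lemma stokes_local F L u v C delta eps :
  0 <= C -> 0 < delta -> 0 < eps ->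
  (forall a b, unit_sq a -> unit_sq b -> rho (F a) (F b) <= L * dist1 a b) ->
  (forall a b, unit_sq a -> unit_sq b -> dist1 a b <= delta ->
     Rabs (u a - u b) <= C * rho (F a) (F b)) ->
  (forall a b, unit_sq a -> unit_sq b -> dist1 a b <= delta ->
     Rabs (v a - v b) <= C * rho (F a) (F b)) ->
  evm (fun q => Rabs (loop (grid q u) (grid q v) 0 0 q q) <= eps).
Proof.
  intros HC Hd Heps HL Hu Hv.
  destruct (nfloor_ex (2 / delta)) as [N [_ HN]].
  { apply Rlt_le, Rdiv_lt_0_compat; lra. }
  set (J := S N). assert (HJ : 2 / delta < INR J) by (unfold J; rewrite S_INR; lra).
  assert (HJ0 : 0 < INR J) by (unfold J; apply lt_0_INR; lia).
  assert (HJ1 : 1 <= INR J) by (unfold J; rewrite S_INR; assert (H := pos_INR N); lra).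
  assert (HJn : (1 <= J)%nat) by (unfold J; lia). clearbody J.
  assert (HJd : 2 * / INR J <= delta).
  { apply (Rmult_lt_compat_l delta) in HJ; [|lra].
    replace (delta * (2 / delta)) with 2 in HJ by (field; lra).
    apply (Rmult_le_reg_r (INR J)); [lra|].
    replace (2 * / INR J * INR J) with 2 by (field; lra). lra. }
  assert (HiJ : 0 < / INR J) by (apply Rinv_0_lt_compat; lra).
  set (sub := fun (A B : nat) (a : R * R) => ((INR A + fst a) / INR J, (INR B + snd a) / INR J)).
  assert (sub_unit : forall A B a, (A < J)%nat -> (B < J)%nat -> unit_sq a -> unit_sq (sub A B a)).
  { assert (K : forall A t, (A < J)%nat -> 0 <= t <= 1 -> 0 <= (INR A + t) / INR J <= 1).
    { intros A t HA Ht. assert (0 <= INR A) by apply pos_INR.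
      assert (INR A + 1 <= INR J) by (rewrite <- S_INR; apply le_INR; lia). split.
      - apply Rmult_le_pos; lra.
      - apply (Rmult_le_reg_r (INR J)); [lra|].
        replace ((INR A + t) / INR J * INR J) with (INR A + t) by (field; lra). lra. }
    intros A B a HA HB [H1 H2]. split; apply K; assumption. }
  assert (sub_dist : forall A B a b, dist1 (sub A B a) (sub A B b) = / INR J * dist1 a b).
  { intros. unfold dist1, sub; simpl fst; simpl snd.
    replace ((INR A + fst a) / INR J - (INR A + fst b) / INR J)
      with (/ INR J * (fst a - fst b)) by (field; lra).
    replace ((INR B + snd a) / INR J - (INR B + snd b) / INR J)
      with (/ INR J * (snd a - snd b)) by (field; lra).
    rewrite !Rabs_mult, (Rabs_right (/ INR J)) by lra. ring. }
  set (e' := eps / (INR J * INR J)).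
  assert (He' : 0 < e') by (apply Rdiv_lt_0_compat; nra).
  apply (evm_mul _ J); [assumption|].
  apply (evm_impl (fun q => forall A, (A < J)%nat -> forall B, (B < J)%nat ->
    Rabs (loop (grid q (fun a => u (sub A B a))) (grid q (fun a => v (sub A B a))) 0 0 q q) <= e')).
  - intros q Hq H. rewrite loop_blocks.
    replace eps with (INR J * (INR J * e')) by (unfold e'; field; lra).
    apply Rsum_abs_le. intros A HA. apply Rsum_abs_le. intros B HB.
    rewrite <- (loop_ext (grid q (fun a => u (sub A B a))) (grid q (fun a => v (sub A B a)))
               _ _ 0 0 (0 + A * q) (0 + B * q)); [apply H; assumption|].
    intros a b _ _. assert (Hq0 : 0 < INR q) by (apply lt_0_INR; lia).
    unfold grid, sub; simpl fst; simpl snd. rewrite !Nat.add_0_l.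
    rewrite !plus_INR, !mult_INR. split; f_equal; f_equal; field; lra.
  - apply evm_forall_lt. intros A HA. apply evm_forall_lt. intros B HB.
    (* Rescaling a subsquare contracts distances by 1/J, so the same Lipschitz constant serves; its
       absolute value spares a discussion of signs. *)
    apply (stokes_global (fun a => F (sub A B a)) (Rabs L)) with (C := C); auto.
    + intros a b Ha Hb. eapply Rle_trans; [apply HL; apply sub_unit; assumption|].
      rewrite sub_dist. assert (D := dist1_nonneg a b).
      assert (/ INR J * dist1 a b <= dist1 a b).
      { assert (/ INR J <= 1) by (rewrite <- Rinv_1; apply Rinv_le_contravar; lra). nra. }
      assert (0 <= / INR J * dist1 a b) by nra.
      eapply Rle_trans; [apply Rmult_le_compat_r; [assumption|apply Rle_abs]|].
      apply Rmult_le_compat_l; [apply Rabs_pos|assumption].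
    + intros a b Ha Hb. apply Hu; auto. rewrite sub_dist.
      assert (D := dist1_le2 a b Ha Hb). nra.
    + intros a b Ha Hb. apply Hv; auto. rewrite sub_dist.
      assert (D := dist1_le2 a b Ha Hb). nra.
Qed.

(** * Trees from four-point metrics and merge heights *)

(** Gromov's condition with hyperbolicity constant 0. *)
Definition four_point (Z : MetricSpace) : Prop :=
  forall x y z t : Z,
    mdist x y + mdist z t <= Rmax (mdist x z + mdist y t) (mdist x t + mdist y z).

Section Tripod.

Variable Z : MetricSpace.
Hypothesis H4 : four_point Z.

Definition between (a p b : Z) : Prop := mdist a p + mdist p b = mdist a b.

(** The four-point condition for p, q against a, b bounds the distance of p and q by the difference
    of their positions, so two geodesics with the same ends coincide. *)
Lemma between_dist a b p q : between a p b -> between a q b ->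
  mdist p q = Rabs (mdist a p - mdist a q).
Proof.
  unfold between. intros Hp Hq.
  assert (F := H4 p q a b).
  rewrite (Defs.dist_sym _ p a), (Defs.dist_sym _ q a) in F.
  assert (T1 := Defs.dist_tri _ a p q). assert (T2 := Defs.dist_tri _ a q p).
  rewrite (Defs.dist_sym _ q p) in T2.
  unfold Rmax in F. destruct (Rle_dec _ _) in F; unfold Rabs; destruct (Rcase_abs _); lra.
Qed.

Lemma between_sym a p b : between a p b -> between b p a.
Proof. unfold between. rewrite (Defs.dist_sym _ b p), (Defs.dist_sym _ p a), (Defs.dist_sym _ b a). lra. Qed.

Lemma geodesic_between a b s t : is_geodesic Z a b s -> 0 <= t <= mdist a b ->
  between a (s t) b /\ mdist a (s t) = t.
Proof.
  intros (E0 & E1 & Hs) Ht.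
  assert (D0 := Hs 0 t ltac:(lra) Ht). rewrite E0 in D0.
  assert (D1 := Hs t (mdist a b) Ht ltac:(lra)). rewrite E1 in D1.
  rewrite Rabs_minus_sym, Rminus_0_r, Rabs_right in D0 by lra.
  rewrite Rabs_minus_sym, Rabs_right in D1 by lra.
  unfold between. rewrite D0, D1. split; lra.
Qed.

Lemma tripod_of_triangle a b c s1 s2 s3 :
  is_geodesic Z a b s1 -> is_geodesic Z b c s2 -> is_geodesic Z c a s3 ->
  isometric_to_tripod Z (triangle_set Z a b c s1 s2 s3).
Proof.
  intros G1 G2 G3.
  (* The legs of the tripod have the Gromov products of the triangle as lengths. *)
  set (la := (mdist a b + mdist c a - mdist b c) / 2).
  set (lb := (mdist a b + mdist b c - mdist c a) / 2).
  set (lc := (mdist c a + mdist b c - mdist a b) / 2).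
  assert (Ta := Defs.dist_tri _ b a c). assert (Tb := Defs.dist_tri _ a b c). assert (Tc := Defs.dist_tri _ a c b).
  rewrite (Defs.dist_sym _ b a), (Defs.dist_sym _ a c) in Ta. rewrite (Defs.dist_sym _ a c) in Tb, Tc.
  rewrite (Defs.dist_sym _ c b) in Tc.
  assert (Hla : 0 <= la) by (unfold la; lra).
  assert (Hlb : 0 <= lb) by (unfold lb; lra).
  assert (Hlc : 0 <= lc) by (unfold lc; lra).
  assert (Eab : mdist a b = la + lb) by (unfold la, lb; lra).
  assert (Ebc : mdist b c = lb + lc) by (unfold lb, lc; lra).
  assert (Eca : mdist c a = lc + la) by (unfold la, lc; lra).
  clearbody la lb lc. clear Ta Tb Tc.
  set (o := s1 la).
  destruct (geodesic_between a b s1 la G1 ltac:(lra)) as [Bo Oa]. fold o in Bo, Oa.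
  assert (Ob : mdist o b = lb) by (unfold between in Bo; lra).
  (* The candidate centre lies on the side from a to b; the four-point condition with c puts it on
     the other two sides as well. *)
  assert (Oc : mdist o c = lc).
  { assert (F := H4 o c a b).
    rewrite (Defs.dist_sym _ o a), (Defs.dist_sym _ c b) in F.
    assert (T := Defs.dist_tri _ b o c). assert (T' := Defs.dist_tri _ a o c).
    rewrite (Defs.dist_sym _ b o) in T.
    unfold Rmax in F. destruct (Rle_dec _ _) in F; lra. }
  set (vx := fun i => match i with 0%nat => a | 1%nat => b | _ => c end).
  set (lens := fun i => match i with 0%nat => la | 1%nat => lb | _ => lc end).
  assert (Hlens : forall i, 0 <= lens i) by (intros [|[|i]]; assumption).
  assert (Hov : forall i, mdist (vx i) o = lens i).
  { intros [|[|i]]; simpl; [assumption|rewrite Defs.dist_sym; assumption|rewrite Defs.dist_sym; assumption]. }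
  assert (Hvv : forall i j, (i < 3)%nat -> (j < 3)%nat -> i <> j ->
                  mdist (vx i) (vx j) = lens i + lens j).
  { intros [|[|[|i]]] [|[|[|j]]] Hi Hj Hij; simpl; try lia;
      rewrite ?(Defs.dist_sym _ b a), ?(Defs.dist_sym _ a c), ?(Defs.dist_sym _ c b); lra. }
  set (on := fun i p => mdist (vx i) p + mdist o p = lens i).
  assert (side : forall i j p, (i < 3)%nat -> (j < 3)%nat -> i <> j ->
            between (vx i) p (vx j) -> on i p \/ on j p).
  { intros i j p Hi Hj Hij Hp.
    assert (Ho : between (vx i) o (vx j)).
    { unfold between. rewrite (Defs.dist_sym _ o), !Hov, Hvv by assumption. reflexivity. }
    assert (E := between_dist _ _ _ _ Ho Hp).
    unfold between in Hp. rewrite Hvv in Hp by assumption. rewrite Hov in E.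
    rewrite (Defs.dist_sym _ p) in Hp. unfold on.
    unfold Rabs in E. destruct (Rcase_abs _); [right|left]; lra. }
  assert (on_between : forall i j p, (i < 3)%nat -> (j < 3)%nat -> i <> j -> on i p ->
            between (vx i) p (vx j)).
  { intros i j p Hi Hj Hij Hp. unfold on in Hp. unfold between.
    assert (T1 := Defs.dist_tri _ (vx i) p (vx j)). assert (T2 := Defs.dist_tri _ p o (vx j)).
    rewrite (Defs.dist_sym _ o (vx j)), Hov, (Defs.dist_sym _ p o) in T2.
    rewrite Hvv in T1 |- * by assumption. lra. }
  assert (dist_on_same : forall i p q, (i < 3)%nat -> on i p -> on i q ->
            mdist p q = Rabs (mdist o p - mdist o q)).
  { intros i p q Hi Hp Hq.
    assert (Hj : exists j, (j < 3)%nat /\ i <> j).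
    { destruct i as [|i]; [exists 1%nat|exists 0%nat]; lia. }
    destruct Hj as (j & Hj & Hij).
    rewrite (between_dist (vx i) (vx j) p q) by (apply on_between; assumption).
    unfold on in Hp, Hq. rewrite <- Rabs_Ropp. f_equal. lra. }
  assert (dist_on_diff : forall i j p q, (i < 3)%nat -> (j < 3)%nat -> i <> j ->
            on i p -> on j q -> mdist p q = mdist o p + mdist o q).
  { intros i j p q Hi Hj Hij Hp Hq.
    assert (Bp := on_between i j p Hi Hj Hij Hp).
    assert (Bq := between_sym _ _ _ (on_between j i q Hj Hi (not_eq_sym Hij) Hq)).
    rewrite (between_dist (vx i) (vx j) p q) by assumption.
    unfold between in Bq. rewrite Hvv in Bq by assumption. unfold on in Hp, Hq.
    rewrite (Defs.dist_sym _ q) in Bq.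
    assert (P1 := dist_nonneg _ o p). assert (P2 := dist_nonneg _ o q).
    rewrite Rabs_minus_sym, Rabs_right; lra. }
  (* The centre lies on all three legs, so the first suitable index is taken; 2 is also the default
     for points off the tripod. *)
  set (leg := fun p => if Req_dec_T (mdist (vx 0%nat) p + mdist o p) (lens 0%nat) then 0%nat
                       else if Req_dec_T (mdist (vx 1%nat) p + mdist o p) (lens 1%nat) then 1%nat
                       else 2%nat).
  assert (leg3 : forall p, (leg p < 3)%nat).
  { intros p. unfold leg. destruct (Req_dec_T _ _); [lia|]. destruct (Req_dec_T _ _); lia. }
  assert (legP : forall p i, (i < 3)%nat -> on i p -> on (leg p) p).
  { intros p i Hi Hp. unfold leg. destruct (Req_dec_T _ _) as [E|E]; [exact E|].
    destruct (Req_dec_T _ _) as [E'|E']; [exact E'|].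
    destruct i as [|[|[|i]]]; try contradiction; [exact Hp|lia]. }
  assert (HU : forall p, triangle_set Z a b c s1 s2 s3 p -> on (leg p) p).
  { intros p [(t & Ht & ->)|[(t & Ht & ->)|(t & Ht & ->)]].
    - destruct (geodesic_between a b s1 t G1 Ht) as [B _].
      destruct (side 0%nat 1%nat _ ltac:(lia) ltac:(lia) ltac:(lia) B) as [O|O];
        (eapply legP; [|exact O]; lia).
    - destruct (geodesic_between b c s2 t G2 Ht) as [B _].
      destruct (side 1%nat 2%nat _ ltac:(lia) ltac:(lia) ltac:(lia) B) as [O|O];
        (eapply legP; [|exact O]; lia).
    - destruct (geodesic_between c a s3 t G3 Ht) as [B _].
      destruct (side 2%nat 0%nat _ ltac:(lia) ltac:(lia) ltac:(lia) B) as [O|O];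
        (eapply legP; [|exact O]; lia). }
  exists lens, (fun p => (leg p, mdist o p)).
  split; [intros; apply Hlens|]. split; [|split].
  - intros p Hp. split; [apply leg3|]. simpl. split; [apply dist_nonneg|].
    assert (E := HU p Hp). unfold on in E. assert (P := dist_nonneg _ (vx (leg p)) p). lra.
  - intros p q Hp Hq. unfold tripod_dist; simpl.
    destruct (Nat.eqb_spec (leg p) (leg q)) as [E|E].
    + symmetry. apply (dist_on_same (leg p)); auto. rewrite E. auto.
    + symmetry. apply (dist_on_diff (leg p) (leg q)); auto.
  - intros [i r] [Hi Hr]. simpl in Hi, Hr.
    assert (Hp : exists p, triangle_set Z a b c s1 s2 s3 p /\ on i p /\ mdist o p = r).
    { assert (K : forall p, between (vx i) p (vx (match i with 0 => 1 | 1 => 0 | _ => 0 end)%nat) ->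
                 mdist (vx i) p = lens i - r -> on i p /\ mdist o p = r).
      { intros p B D.
        set (j := (match i with 0 => 1 | 1 => 0 | _ => 0 end)%nat) in *.
        assert (Hj : (j < 3)%nat /\ i <> j) by (unfold j; destruct i as [|[|i]]; lia).
        destruct Hj as [Hj Hij].
        assert (Ho : between (vx i) o (vx j)).
        { unfold between. rewrite (Defs.dist_sym _ o), !Hov, Hvv by assumption. reflexivity. }
        assert (E := between_dist _ _ _ _ Ho B). rewrite Hov, D in E.
        rewrite Rabs_right in E by lra. unfold on. rewrite E, D. split; lra. }
      destruct i as [|[|[|i]]]; [| | |lia]; simpl in Hr, K.
      - destruct (geodesic_between a b s1 (la - r) G1 ltac:(lra)) as [B D].
        exists (s1 (la - r)). split; [left; exists (la - r); split; [lra|reflexivity]|].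
        apply K; assumption.
      - destruct (geodesic_between a b s1 (la + r) G1 ltac:(lra)) as [B D].
        exists (s1 (la + r)). split; [left; exists (la + r); split; [lra|reflexivity]|].
        apply K; [apply between_sym; assumption|].
        unfold between in B. rewrite Defs.dist_sym. lra.
      - destruct (geodesic_between c a s3 (lc - r) G3 ltac:(lra)) as [B D].
        exists (s3 (lc - r)). split; [right; right; exists (lc - r); split; [lra|reflexivity]|].
        apply K; assumption. }
    destruct Hp as (p & Hp & Op & Dp). exists p. split; [assumption|].
    unfold tripod_dist; simpl. rewrite Dp.
    destruct (Nat.eqb_spec (leg p) i) as [E|E].
    + rewrite Rminus_diag. apply Rabs_R0.
    (* A point on two different legs is the centre, so r is 0 and the two codes of the centre are at
       tripod distance 0. *)
    + assert (D := dist_on_diff _ _ p p (leg3 p) Hi E (HU p Hp) Op).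
      rewrite Dp, (proj2 (dist_eq0 _ p p) eq_refl) in D. lra.
Qed.

Lemma four_point_tree : geodesic_space Z -> metric_tree Z.
Proof. intros HG. split; [assumption|]. intros. apply tripod_of_triangle; assumption. Qed.

End Tripod.

(* A height function [v] together with merge heights [m] (the level at which
   two points become connected) is the data of a rooted tree. *)
Section MergeTree.

Variable X : Type.
Variable x0 : X.
Variable v : X -> R.
Variable m : X -> X -> R.
Hypothesis m_nonneg : forall x y, 0 <= m x y.
Hypothesis m_le : forall x y, m x y <= v x.
Hypothesis m_sym : forall x y, m x y = m y x.
Hypothesis m_refl : forall x, m x x = v x.
Hypothesis m_ultra : forall x y z, Rmin (m x y) (m y z) <= m x z.
Hypothesis ancestor : forall x c, 0 <= c <= v x -> exists a, v a = c /\ m x a = c.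

Definition merge_dist (x y : X) : R := v x + v y - 2 * m x y.

Local Notation d := merge_dist.

Lemma merge_dist_nonneg x y : 0 <= d x y.
Proof.
  unfold d. assert (H1 := m_le x y). assert (H2 := m_le y x).
  rewrite m_sym in H2. lra.
Qed.

Lemma merge_dist_refl x : d x x = 0.
Proof. unfold d. rewrite m_refl. ring. Qed.

Lemma merge_dist_sym x y : d x y = d y x.
Proof. unfold d. rewrite (m_sym x y). ring. Qed.

(** The heights of all four points occur in each of the three sums and cancel; what remains is a
    consequence of the ultrametric inequality for m. *)
Lemma merge_dist_four_point x y z t :
  d x y + d z t <= Rmax (d x z + d y t) (d x t + d y z).
Proof.
  assert (H1 := m_ultra x z y). assert (H2 := m_ultra x t y).
  assert (H3 := m_ultra z x t). assert (H4 := m_ultra z y t).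
  rewrite (m_sym z x) in H3. rewrite (m_sym t y) in H2. rewrite (m_sym z y) in *.
  unfold d, Rmax, Rmin in *. repeat destruct (Rle_dec _ _); lra.
Qed.

(** This is the four-point inequality with a repeated point. *)
Lemma merge_dist_tri x y z : d x z <= d x y + d y z.
Proof.
  assert (H := merge_dist_four_point x z y y).
  rewrite merge_dist_refl, (merge_dist_sym z y), Rplus_0_r in H.
  rewrite Rmax_left in H by lra. exact H.
Qed.

(** The quotient is realised as a set of representatives: equivalent points define equal predicates,
    hence receive the same choice. *)
Definition merge_rep (x : X) : X := epsilon (inhabits x0) (fun y => d x y = 0).

Lemma merge_rep_spec x : d x (merge_rep x) = 0.
Proof.
  apply (epsilon_spec (inhabits x0) (fun y => d x y = 0)).
  exists x. apply merge_dist_refl.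
Qed.

Lemma merge_dist_cong x x' y : d x x' = 0 -> d x y = d x' y.
Proof.
  intros H. assert (T1 := merge_dist_tri x x' y). assert (T2 := merge_dist_tri x' x y).
  rewrite (merge_dist_sym x' x) in T2. lra.
Qed.

Lemma merge_rep_eq x y : d x y = 0 -> merge_rep x = merge_rep y.
Proof.
  intros H. unfold merge_rep. f_equal. apply functional_extensionality. intros z.
  rewrite (merge_dist_cong x y z H). reflexivity.
Qed.

Definition merge_carrier : Type := { x : X | merge_rep x = x }.

Lemma merge_carrier_eq (a b : merge_carrier) : proj1_sig a = proj1_sig b -> a = b.
Proof.
  destruct a as [x Hx], b as [y Hy]; simpl. intros ->.
  f_equal. apply proof_irrelevance.
Qed.

Lemma merge_dist_eq0 (a b : merge_carrier) : d (proj1_sig a) (proj1_sig b) = 0 <-> a = b.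
Proof.
  split.
  - intros H. apply merge_carrier_eq. rewrite <- (proj2_sig a), <- (proj2_sig b).
    apply merge_rep_eq, H.
  - intros ->. apply merge_dist_refl.
Qed.

Definition merge_space : MetricSpace :=
  Build_MetricSpace merge_carrier (fun a b => d (proj1_sig a) (proj1_sig b))
    (fun a b => merge_dist_nonneg _ _) merge_dist_eq0
    (fun a b => merge_dist_sym _ _) (fun a b c => merge_dist_tri _ _ _).

Definition merge_class (x : X) : merge_space :=
  exist _ (merge_rep x) (eq_sym (merge_rep_eq _ _ (merge_rep_spec x))).

Lemma merge_class_dist x y : mdist (merge_class x) (merge_class y) = d x y.
Proof.
  simpl. rewrite <- (merge_dist_cong x _ _ (merge_rep_spec x)).
  rewrite merge_dist_sym, <- (merge_dist_cong y _ _ (merge_rep_spec y)).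
  apply merge_dist_sym.
Qed.

Lemma merge_class_proj (a : merge_space) : merge_class (proj1_sig a) = a.
Proof. apply merge_carrier_eq. exact (proj2_sig a). Qed.

(** The path descends through the ancestors of x to the merge height and climbs back through those
    of y. *)
Lemma merge_geodesic x y : exists s : R -> X,
  d (s 0) x = 0 /\ d (s (d x y)) y = 0 /\
  forall a b, 0 <= a <= d x y -> 0 <= b <= d x y -> d (s a) (s b) = Rabs (a - b).
Proof.
  assert (Hx := m_le x y). assert (Hy := m_le y x). rewrite m_sym in Hy.
  assert (Hm := m_nonneg x y).
  set (anc := fun z c => epsilon (inhabits x0) (fun a => v a = c /\ m z a = c)).
  assert (Hanc : forall z c, 0 <= c <= v z -> v (anc z c) = c /\ m z (anc z c) = c).
  { intros z c Hc. apply (epsilon_spec (inhabits x0) (fun a => v a = c /\ m z a = c)).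
    apply ancestor, Hc. }
  assert (same : forall z c c', 0 <= c <= v z -> 0 <= c' <= v z ->
            d (anc z c) (anc z c') = Rabs (c - c')).
  { intros z c c' Hc Hc'. destruct (Hanc z c Hc) as [V M], (Hanc z c' Hc') as [V' M'].
    assert (U := m_ultra (anc z c) z (anc z c')). rewrite (m_sym _ z), M, M' in U.
    assert (L := m_le (anc z c) (anc z c')). assert (L' := m_le (anc z c') (anc z c)).
    rewrite m_sym in L'. rewrite V in L. rewrite V' in L'.
    unfold d. rewrite V, V'.
    unfold Rmin, Rabs in *. destruct (Rle_dec c c'), (Rcase_abs (c - c')); lra. }
  assert (across : forall c c', m x y <= c <= v x -> m x y <= c' <= v y ->
            d (anc x c) (anc y c') = c + c' - 2 * m x y).
  { intros c c' Hc Hc'.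
    destruct (Hanc x c ltac:(lra)) as [V M], (Hanc y c' ltac:(lra)) as [V' M'].
    assert (U1 := m_ultra (anc x c) x (anc y c')). assert (U2 := m_ultra x y (anc y c')).
    assert (U3 := m_ultra x (anc x c) y). assert (U4 := m_ultra (anc x c) (anc y c') y).
    rewrite (m_sym (anc x c) x) in U1. rewrite (m_sym (anc y c') y) in U4.
    rewrite M in U1, U3. rewrite M' in U2, U4.
    assert (L := m_le (anc x c) (anc y c')). assert (L' := m_le (anc y c') (anc x c)).
    rewrite m_sym in L'. rewrite V in L. rewrite V' in L'.
    unfold d. rewrite V, V'.
    unfold Rmin in *. repeat destruct (Rle_dec _ _); lra. }
  set (L := d x y). assert (EL : L = v x + v y - 2 * m x y) by reflexivity.
  exists (fun u => if Rle_dec u (v x - m x y) then anc x (v x - u) else anc y (v y - (L - u))).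
  split; [|split].
  - destruct (Rle_dec 0 (v x - m x y)); [|lra].
    destruct (Hanc x (v x - 0) ltac:(lra)) as [V M].
    unfold d. rewrite m_sym, V, M. lra.
  - destruct (Rle_dec L (v x - m x y)) as [Hl|Hl].
    (* Degenerate case: y itself is at the merge height and the climbing half has length 0. *)
    + assert (Ey : v y = m x y) by lra.
      destruct (Hanc x (v x - L) ltac:(lra)) as [V M].
      assert (U := m_ultra (anc x (v x - L)) x y). rewrite (m_sym _ x), M in U.
      assert (L1 := m_le y (anc x (v x - L))). rewrite m_sym in L1.
      unfold d. rewrite V. unfold Rmin in U. destruct (Rle_dec _ _); lra.
    + destruct (Hanc y (v y - (L - L)) ltac:(lra)) as [V M].
      unfold d. rewrite m_sym, V, M. lra.
  - intros a b Ha Hb.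
    destruct (Rle_dec a (v x - m x y)), (Rle_dec b (v x - m x y)).
    + rewrite same by lra. rewrite <- Rabs_Ropp. f_equal. ring.
    + rewrite across by lra. rewrite Rabs_left by lra. lra.
    + rewrite merge_dist_sym, across by lra. rewrite Rabs_right by lra. lra.
    + rewrite same by lra. f_equal. ring.
Qed.

Lemma merge_space_tree : metric_tree merge_space.
Proof.
  apply four_point_tree.
  - intros x y z t. apply merge_dist_four_point.
  - intros a b. destruct (merge_geodesic (proj1_sig a) (proj1_sig b)) as (s & S0 & S1 & Hs).
    exists (fun u => merge_class (s u)). split; [|split].
    + apply dist_eq0. rewrite <- (merge_class_proj a), merge_class_dist. exact S0.
    + apply dist_eq0. rewrite <- (merge_class_proj b) at 2. rewrite merge_class_dist. exact S1.
    + intros u w Hu Hw. rewrite merge_class_dist. apply Hs; assumption.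
Qed.

End MergeTree.

(** * The sphere *)

Section Sphere.

Variable k : nat.

Local Notation ssum f := (sum_f_R0 f k).

Definition norm1 (v : nat -> R) : R := ssum (fun i => Rabs (v i)).
Definition norm2 (v : nat -> R) : R := sqrt (ssum (fun i => v i ^ 2)).
Definition dot (v w : nat -> R) : R := ssum (fun i => v i * w i).

Lemma sqsum_nonneg v : 0 <= ssum (fun i => v i ^ 2).
Proof. apply cond_pos_sum. intros. apply pow2_ge_0. Qed.

Lemma norm1_nonneg v : 0 <= norm1 v.
Proof. apply cond_pos_sum. intros. apply Rabs_pos. Qed.

Lemma norm2_nonneg v : 0 <= norm2 v.
Proof. apply sqrt_pos. Qed.

Lemma norm2_sqr v : norm2 v * norm2 v = ssum (fun i => v i ^ 2).
Proof. apply sqrt_sqrt, sqsum_nonneg. Qed.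

Lemma norm1_le v w c : (forall i, (i <= k)%nat -> Rabs (v i) <= c * w i) ->
  norm1 v <= c * ssum w.
Proof.
  intros H. rewrite scal_sum. apply sum_Rle. intros i Hi. rewrite Rmult_comm. auto.
Qed.

Lemma coord_le_norm2 v i : (i <= k)%nat -> Rabs (v i) <= norm2 v.
Proof.
  intros Hi. unfold norm2. rewrite <- sqrt_Rsqr_abs. apply sqrt_le_1_alt.
  unfold Rsqr. induction k as [|n IH]; simpl.
  - replace i with O by lia. lra.
  - assert (P := cond_pos_sum (fun i => v i * (v i * 1)) n
      ltac:(intros; cbv beta; rewrite Rmult_1_r; apply Rle_0_sqr)).
    destruct (Nat.eq_dec i (S n)) as [->|].
    + lra.
    + assert (E : (i <= n)%nat) by lia. specialize (IH E). simpl in IH.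
      assert (0 <= v (S n) * v (S n)) by apply Rle_0_sqr. lra.
Qed.

(** The difference of the squared norms is factored coordinatewise; dividing by the sum of the norms
    avoids the Minkowski inequality. *)
Lemma norm2_diff v w : Rabs (norm2 v - norm2 w) <= norm1 (fun i => v i - w i).
Proof.
  assert (P := norm1_nonneg (fun i => v i - w i)).
  assert (Pv := norm2_nonneg v). assert (Pw := norm2_nonneg w).
  destruct (Rle_lt_dec (norm2 v + norm2 w) 0) as [H|H].
  { replace (norm2 v) with 0 by lra. replace (norm2 w) with 0 by lra.
    rewrite Rminus_diag, Rabs_R0. assumption. }
  apply (Rmult_le_reg_r (norm2 v + norm2 w)); [assumption|].
  rewrite <- (Rabs_right (norm2 v + norm2 w)) at 1 by lra. rewrite <- Rabs_mult.
  replace ((norm2 v - norm2 w) * (norm2 v + norm2 w))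
    with (ssum (fun i => (v i - w i) * (v i + w i))).
  - eapply Rle_trans; [apply Rsum_abs|].
    rewrite Rmult_comm. apply (norm1_le (fun i => (v i - w i) * (v i + w i))
      (fun i => Rabs (v i - w i))). intros i Hi.
    rewrite Rabs_mult, Rmult_comm. apply Rmult_le_compat_r; [apply Rabs_pos|].
    assert (Hv := coord_le_norm2 v i Hi). assert (Hw := coord_le_norm2 w i Hi).
    eapply Rle_trans; [apply Rabs_triang|]. lra.
  - replace ((norm2 v - norm2 w) * (norm2 v + norm2 w))
      with (norm2 v * norm2 v - norm2 w * norm2 w) by ring.
    rewrite !norm2_sqr, <- minus_sum. apply sum_eq. intros. ring.
Qed.

Lemma sum_delta (g : nat -> R) j : (j <= k)%nat ->
  ssum (fun i => if Nat.eqb i j then g i else 0) = g j.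
Proof.
  intros Hj. induction k as [|n IH]; cbn [sum_f_R0].
  - replace j with O by lia. reflexivity.
  - destruct (Nat.eq_dec j (S n)) as [->|Hn].
    + rewrite Nat.eqb_refl.
      rewrite (sum_eq _ (fun _ => 0)).
      * rewrite sum_cte. ring.
      * intros i Hi. destruct (Nat.eqb_spec i (S n)); [lia|reflexivity].
    + rewrite IH by lia. destruct (Nat.eqb_spec (S n) j); [lia|]. ring.
Qed.

Definition delta (j : nat) (c : R) (i : nat) : R := if Nat.eqb i j then c else 0.

Lemma delta_sphere j c : (j <= k)%nat -> c * c = 1 ->
  (forall i, (k < i)%nat -> delta j c i = 0) /\ ssum (fun i => delta j c i ^ 2) = 1.
Proof.
  intros Hj Hc. split.
  - intros i Hi. unfold delta. destruct (Nat.eqb_spec i j); [lia|reflexivity].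
  - rewrite (sum_eq _ (fun i => if Nat.eqb i j then c * c else 0)).
    + rewrite (sum_delta (fun _ => c * c)); assumption.
    + intros i _. unfold delta. destruct (Nat.eqb i j); ring.
Qed.

Definition base : sphere k :=
  exist _ (delta 0 1) (delta_sphere 0 1 (Nat.le_0_l k) (Rmult_1_l 1)).

Lemma normalize_sphere v : 0 < norm2 v ->
  let w := fun i => if Compare_dec.le_dec i k then v i / norm2 v else 0 in
  (forall i, (k < i)%nat -> w i = 0) /\ ssum (fun i => w i ^ 2) = 1.
Proof.
  intros Hv w. split.
  - intros i Hi. unfold w. destruct (Compare_dec.le_dec i k); [lia|reflexivity].
  - rewrite (sum_eq _ (fun i => v i ^ 2 * (/ norm2 v * / norm2 v))).
    + rewrite <- scal_sum, <- norm2_sqr. field. lra.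
    + intros i Hi. unfold w. destruct (Compare_dec.le_dec i k); [|lia]. field. lra.
Qed.

(** [base] is only a default value where the norm vanishes; coordinates beyond k are cut to 0. *)
Definition normalize (v : nat -> R) : sphere k :=
  match Rlt_dec 0 (norm2 v) with
  | left H => exist _ _ (normalize_sphere v H)
  | right _ => base
  end.

Lemma normalize_coord v i : 0 < norm2 v -> (i <= k)%nat ->
  proj1_sig (normalize v) i = v i / norm2 v.
Proof.
  intros Hv Hi. unfold normalize. destruct (Rlt_dec 0 (norm2 v)); [|lra]. simpl.
  destruct (Compare_dec.le_dec i k); [reflexivity|lia].
Qed.

(** The sum metric, treated one coordinate at a time; it lies between [sphere_dist] and k + 1 times
    [sphere_dist]. *)
Definition sdist (p q : sphere k) : R :=
  norm1 (fun i => proj1_sig p i - proj1_sig q i).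

Lemma sdist_nonneg p q : 0 <= sdist p q.
Proof. apply norm1_nonneg. Qed.

Lemma sdist_sym p q : sdist p q = sdist q p.
Proof. apply sum_eq. intros. apply Rabs_minus_sym. Qed.

Lemma sdist_tri p q r : sdist p r <= sdist p q + sdist q r.
Proof.
  unfold sdist, norm1. rewrite <- plus_sum. apply sum_Rle. intros i _.
  replace (proj1_sig p i - proj1_sig r i)
    with ((proj1_sig p i - proj1_sig q i) + (proj1_sig q i - proj1_sig r i)) by ring.
  apply Rabs_triang.
Qed.

Lemma sphere_norm2 (p : sphere k) : norm2 (proj1_sig p) = 1.
Proof. unfold norm2. destruct p as (v & Hv & E); simpl proj1_sig. rewrite E. apply sqrt_1. Qed.

Lemma sphere_norm1 (p : sphere k) : norm1 (proj1_sig p) <= INR (S k).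
Proof.
  eapply Rle_trans; [apply (norm1_le _ (fun _ => 1) 1)|].
  - intros i Hi. assert (H := coord_le_norm2 (proj1_sig p) i Hi).
    rewrite sphere_norm2 in H. lra.
  - rewrite sum_cte. lra.
Qed.

Lemma sdist_le_sphere_dist p q : sdist p q <= INR (S k) * sphere_dist k p q.
Proof.
  rewrite Rmult_comm, <- sum_cte, <- (Rmult_1_l (ssum _)). apply norm1_le. intros i Hi.
  rewrite Rmult_1_l. apply (coord_le_norm2 (fun i => proj1_sig p i - proj1_sig q i) i Hi).
Qed.

Lemma norm2_le_norm1 v : norm2 v <= norm1 v.
Proof.
  assert (H := norm2_diff v (fun _ => 0)). cbv beta in H.
  replace (norm1 (fun i => v i - 0)) with (norm1 v) in H
    by (apply sum_eq; intros; rewrite Rminus_0_r; reflexivity).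
  replace (norm2 (fun _ => 0)) with 0 in H.
  - rewrite Rminus_0_r in H. eapply Rle_trans; [apply Rle_abs|exact H].
  - unfold norm2. rewrite (sum_eq _ (fun _ => 0)) by (intros; ring).
    rewrite sum_cte, Rmult_0_l. symmetry. apply sqrt_0.
Qed.

Lemma sphere_dist_le_sdist p q : sphere_dist k p q <= sdist p q.
Proof. apply norm2_le_norm1. Qed.

Lemma sdist_bounded p q : sdist p q <= 2 * INR (S k).
Proof.
  assert (Hp := sphere_norm1 p). assert (Hq := sphere_norm1 q).
  apply Rle_trans with (norm1 (proj1_sig p) + norm1 (proj1_sig q)); [|lra].
  unfold sdist, norm1. rewrite <- plus_sum. apply sum_Rle. intros i _.
  unfold Rminus. eapply Rle_trans; [apply Rabs_triang|]. rewrite Rabs_Ropp. lra.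
Qed.

(** Each coordinate difference splits into the change of v and the change of the norm. The former
    sum to d/r, the latter contribute d/r for each of the k + 1 coordinates. *)
Lemma normalize_lip v w r :
  0 < r -> r <= norm2 v -> r <= norm2 w ->
  sdist (normalize v) (normalize w) <= (INR k + 2) / r * norm1 (fun i => v i - w i).
Proof.
  intros Hr Hv Hw. set (d := norm1 (fun i => v i - w i)).
  assert (Hd : 0 <= d) by apply norm1_nonneg.
  assert (Hir : 0 < / r) by (apply Rinv_0_lt_compat; assumption).
  apply Rle_trans with (ssum (fun i => Rabs (v i - w i) * / r + d * / r)).
  - apply sum_Rle. intros i Hi. rewrite !normalize_coord by (assumption || lra).
    replace (v i / norm2 v - w i / norm2 w)
      with ((v i - w i) * / norm2 v + (w i * / norm2 w) * ((norm2 w - norm2 v) * / norm2 v))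
      by (field; lra).
    assert (Hiv : 0 < / norm2 v) by (apply Rinv_0_lt_compat; lra).
    assert (Hiv' : / norm2 v <= / r) by (apply Rinv_le_contravar; lra).
    assert (Hiw : 0 < / norm2 w) by (apply Rinv_0_lt_compat; lra).
    eapply Rle_trans; [apply Rabs_triang|]. apply Rplus_le_compat.
    + rewrite Rabs_mult, (Rabs_right (/ _)) by lra.
      apply Rmult_le_compat_l; [apply Rabs_pos|assumption].
    + rewrite Rabs_mult, <- (Rmult_1_l (d * / r)).
      apply Rmult_le_compat; try apply Rabs_pos.
      * rewrite Rabs_mult, (Rabs_right (/ _)) by lra.
        apply (Rmult_le_reg_r (norm2 w)); [lra|].
        rewrite Rmult_assoc, Rinv_l, Rmult_1_r, Rmult_1_l by lra.
        apply coord_le_norm2. assumption.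
      * rewrite Rabs_mult, (Rabs_right (/ _)) by lra.
        apply Rmult_le_compat; try apply Rabs_pos; try lra.
        rewrite Rabs_minus_sym. apply norm2_diff.
  - rewrite plus_sum, <- scal_sum, sum_cte, S_INR. fold (norm1 (fun i => v i - w i)).
    fold d. apply Req_le. field. lra.
Qed.

(** Points of the sphere are identified by distance 0 rather than by equality; the functions used
    later cannot tell the difference. *)
Lemma normalize_ext v w : (forall i, (i <= k)%nat -> v i = w i) ->
  sdist (normalize v) (normalize w) = 0.
Proof.
  intros H.
  assert (E : norm2 v = norm2 w)
    by (unfold norm2; f_equal; apply sum_eq; intros; rewrite H by assumption; reflexivity).
  unfold sdist, norm1. rewrite (sum_eq _ (fun _ => 0)); [rewrite sum_cte; ring|].
  intros i Hi. destruct (Rlt_dec 0 (norm2 v)) as [Hv|Hv].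
  - rewrite !normalize_coord by (assumption || lra).
    rewrite E, H, Rminus_diag by assumption. apply Rabs_R0.
  - unfold normalize. destruct (Rlt_dec 0 (norm2 v)), (Rlt_dec 0 (norm2 w)); try lra.
    rewrite Rminus_diag. apply Rabs_R0.
Qed.

Lemma normalize_self (p : sphere k) v : (forall i, (i <= k)%nat -> v i = proj1_sig p i) ->
  sdist (normalize v) p = 0.
Proof.
  intros H. apply Rle_antisym; [|apply sdist_nonneg].
  eapply Rle_trans; [apply (sdist_tri _ (normalize (proj1_sig p)))|].
  rewrite normalize_ext, Rplus_0_l by assumption.
  unfold sdist, norm1. rewrite (sum_eq _ (fun _ => 0)); [rewrite sum_cte; lra|].
  intros i Hi. rewrite normalize_coord by (try assumption; rewrite sphere_norm2; lra).
  rewrite sphere_norm2, Rdiv_1_r, Rminus_diag. apply Rabs_R0.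
Qed.

(** * Spherical segments and cones over them *)

Definition near (p q : sphere k) : Prop := 0 <= dot (proj1_sig p) (proj1_sig q).

Definition segment (p q : sphere k) (t : R) : sphere k :=
  normalize (fun i => (1 - t) * proj1_sig p i + t * proj1_sig q i).

Lemma sphere_sqsum (p : sphere k) : ssum (fun i => proj1_sig p i ^ 2) = 1.
Proof. destruct p as (v & Hv & E). exact E. Qed.

Lemma near_of_close p q : sdist p q <= 1 -> near p q.
Proof.
  intros H. unfold near.
  assert (H1 := norm2_le_norm1 (fun i => proj1_sig p i - proj1_sig q i)).
  assert (H2 := norm2_sqr (fun i => proj1_sig p i - proj1_sig q i)).
  assert (H0 := norm2_nonneg (fun i => proj1_sig p i - proj1_sig q i)).
  fold (sdist p q) in H1.
  rewrite (sum_eq _ (fun i => (proj1_sig p i ^ 2 + proj1_sig q i ^ 2)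
            - (proj1_sig p i * proj1_sig q i) * 2)) in H2 by (intros; ring).
  rewrite minus_sum, plus_sum, !sphere_sqsum, <- scal_sum in H2.
  unfold dot. nra.
Qed.

(** A nonnegative inner product leaves the squared norm at least (1-t)^2 + t^2, hence at least
    1/2. *)
Lemma segment_norm2 p q t : near p q -> 0 <= t <= 1 ->
  1 / 2 <= norm2 (fun i => (1 - t) * proj1_sig p i + t * proj1_sig q i).
Proof.
  intros Hn Ht. unfold near, dot in Hn.
  assert (H2 := norm2_sqr (fun i => (1 - t) * proj1_sig p i + t * proj1_sig q i)).
  rewrite (sum_eq _ (fun i => (proj1_sig p i ^ 2 * ((1 - t) * (1 - t)) + proj1_sig q i ^ 2 * (t * t))
            + (proj1_sig p i * proj1_sig q i) * (2 * t * (1 - t)))) in H2 by (intros; ring).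
  rewrite !plus_sum, <- !scal_sum, !sphere_sqsum in H2.
  set (N := norm2 _) in *. assert (HN : 0 <= N) by apply norm2_nonneg.
  set (c := ssum _) in *.
  assert (0 <= 2 * t * (1 - t) * c) by (apply Rmult_le_pos; nra).
  apply Rsqr_incr_0_var; [|assumption]. unfold Rsqr. nra.
Qed.

Lemma segment_lip p q s t : near p q -> 0 <= s <= 1 -> 0 <= t <= 1 ->
  sdist (segment p q s) (segment p q t) <= 2 * (INR k + 2) * (sdist p q * Rabs (s - t)).
Proof.
  intros Hn Hs Ht. eapply Rle_trans.
  - apply (normalize_lip _ _ (1 / 2)); [lra| |]; apply segment_norm2; assumption.
  - replace ((INR k + 2) / (1 / 2)) with (2 * (INR k + 2)) by field.
    apply Rmult_le_compat_l; [assert (H := pos_INR k); lra|].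
    rewrite Rmult_comm. apply norm1_le. intros i _.
    rewrite <- Rabs_mult. apply Req_le. rewrite <- Rabs_Ropp. f_equal. ring.
Qed.

Lemma segment_0 p q : sdist (segment p q 0) p = 0.
Proof. apply normalize_self. intros. ring. Qed.

Lemma segment_1 p q : sdist (segment p q 1) q = 0.
Proof. apply normalize_self. intros. ring. Qed.

(** A point that may be opposite to the base point is reached by a detour through plus or minus the
    second basis vector. *)
Lemma near_base (x : sphere k) : (1 <= k)%nat -> exists z, near x z /\ near z base.
Proof.
  intros Hk.
  assert (D : forall v c j, (j <= k)%nat -> dot v (delta j c) = v j * c).
  { intros v c j Hj. unfold dot, delta.
    rewrite <- (sum_delta (fun i => v i * c) j Hj). apply sum_eq. intros i _.
    destruct (Nat.eqb i j); ring. }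
  destruct (Rle_lt_dec 0 (proj1_sig x O)) as [H0|H0].
  - exists base. unfold near. change (proj1_sig base) with (delta 0 1). rewrite !D by lia. unfold delta. cbn [Nat.eqb]. split; lra.
  - assert (Hc : exists c, c * c = 1 /\ 0 <= proj1_sig x 1%nat * c).
    { destruct (Rle_lt_dec 0 (proj1_sig x 1%nat)); [exists 1|exists (-1)]; split; lra. }
    destruct Hc as (c & Hc & Hxc).
    exists (exist _ (delta 1 c) (delta_sphere 1 c Hk Hc)).
    unfold near. change (proj1_sig base) with (delta 0 1). cbn [proj1_sig].
    rewrite !D by lia. unfold delta. cbn [Nat.eqb]. split; lra.
Qed.

(** The cross product, with a substitute when the truncated vectors are parallel. The resulting form
    vanishes on all combinations of p and q, so it bounds from below how far a cone over the segment
    stays from the origin. *)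
Lemma common_orthogonal (p q : nat -> R) : exists a b c,
  (a <> 0 \/ b <> 0 \/ c <> 0) /\
  a * p 0%nat + b * p 1%nat + c * p 2%nat = 0 /\
  a * q 0%nat + b * q 1%nat + c * q 2%nat = 0.
Proof.
  set (x := p 1%nat * q 2%nat - p 2%nat * q 1%nat).
  set (y := p 2%nat * q 0%nat - p 0%nat * q 2%nat).
  set (z := p 0%nat * q 1%nat - p 1%nat * q 0%nat).
  assert (W : forall w : nat -> R, exists a b c, (a <> 0 \/ b <> 0 \/ c <> 0) /\
     a * w 0%nat + b * w 1%nat + c * w 2%nat = 0).
  { intros w. destruct (Req_dec (w 1%nat) 0) as [h|h].
    - exists 0, 1, 0. split; [right; left; lra|]. rewrite h. ring.
    - exists (- w 1%nat), (w 0%nat), 0. split; [left; lra|]. ring. }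
  destruct (Req_dec x 0) as [hx|hx]; [destruct (Req_dec y 0) as [hy|hy];
    [destruct (Req_dec z 0) as [hz|hz]|]|];
    try (exists x, y, z; split; [tauto|]; split; unfold x, y, z; ring).
  destruct (Req_dec (p 0%nat) 0) as [h0|h0]; [destruct (Req_dec (p 1%nat) 0) as [h1|h1]|].
  - destruct (Req_dec (p 2%nat) 0) as [h2|h2].
    + destruct (W q) as (a & b & c & Hn & E). exists a, b, c. repeat split; auto.
      rewrite h0, h1, h2. ring.
    + exists 1, 0, 0. split; [left; lra|]. split; [rewrite h0; ring|].
      unfold y in hy. rewrite h0 in hy.
      assert (p 2%nat * q 0%nat = 0) by lra.
      apply Rmult_integral in H. destruct H; [contradiction|lra].
  - exists (- p 1%nat), (p 0%nat), 0. split; [left; lra|]. unfold z in hz. split; lra.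
  - exists (- p 1%nat), (p 0%nat), 0. split; [right; left; lra|]. unfold z in hz. split; lra.
Qed.

(** The linear form (a, b, c) evaluated on the curve of possible apexes. A threshold for t, unlike a
    set of roots to avoid, combines over finitely many segments by a maximum. *)
Lemma quadratic_eventually_nonzero a b c : (a <> 0 \/ b <> 0 \/ c <> 0) ->
  exists T, forall t, T <= t -> a + b * t + c * (t * t) <> 0.
Proof.
  intros H.
  destruct (Req_dec c 0) as [hc|hc]; [destruct (Req_dec b 0) as [hb|hb]|].
  - exists 0. intros t _. subst. destruct H as [H|[H|H]]; lra.
  - exists (Rabs a / Rabs b + 1). intros t Ht E. subst c.
    assert (Hb : 0 < Rabs b) by (apply Rabs_pos_lt; assumption).
    assert (Ha : 0 <= Rabs a / Rabs b)
      by (apply Rmult_le_pos; [apply Rabs_pos|apply Rlt_le, Rinv_0_lt_compat; assumption]).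
    assert (E' : Rabs (b * t) = Rabs a).
    { replace (b * t) with (- a) by lra. apply Rabs_Ropp. }
    rewrite Rabs_mult, (Rabs_right t) in E' by lra.
    assert (Rabs b * (Rabs a / Rabs b + 1) <= Rabs b * t) by (apply Rmult_le_compat_l; lra).
    replace (Rabs b * (Rabs a / Rabs b + 1)) with (Rabs a + Rabs b) in H0 by (field; lra). lra.
  - exists ((Rabs a + Rabs b) / Rabs c + 1). intros t Ht E.
    assert (Hc : 0 < Rabs c) by (apply Rabs_pos_lt; assumption).
    assert (Pa := Rabs_pos a). assert (Pb := Rabs_pos b).
    assert (Hab : 0 <= (Rabs a + Rabs b) / Rabs c)
      by (apply Rmult_le_pos; [lra|apply Rlt_le, Rinv_0_lt_compat; assumption]).
    assert (Hct : Rabs c * ((Rabs a + Rabs b) / Rabs c + 1) <= Rabs c * t)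
      by (apply Rmult_le_compat_l; lra).
    replace (Rabs c * ((Rabs a + Rabs b) / Rabs c + 1)) with (Rabs a + Rabs b + Rabs c)
      in Hct by (field; lra).
    assert (E' : Rabs (c * (t * t)) = Rabs (a + b * t)).
    { replace (c * (t * t)) with (- (a + b * t)) by lra. apply Rabs_Ropp. }
    assert (T := Rabs_triang a (b * t)). rewrite <- E' in T.
    rewrite !Rabs_mult, (Rabs_right t) in T by lra. nra.
Qed.

(* The cone of apex [(1, t, t^2, 0, ..)] over each of finitely many segments
   misses the origin for large [t]. *)
Lemma cone_exists (l : list (sphere k * sphere k)) :
  (2 <= k)%nat -> (forall pq, In pq l -> near (fst pq) (snd pq)) ->
  exists (h : sphere k -> R -> sphere k) (Q : sphere k -> sphere k -> R * R -> sphere k),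
    forall p q, In (p, q) l ->
      (exists L, forall a b, unit_sq a -> unit_sq b ->
         sdist (Q p q a) (Q p q b) <= L * dist1 a b) /\
      forall t, 0 <= t <= 1 ->
        sdist (Q p q (t, 0)) (h p t) = 0 /\ sdist (Q p q (t, 1)) (h q t) = 0 /\
        sdist (Q p q (1, t)) (segment p q t) = 0 /\ sdist (Q p q (0, t)) (Q p q (0, 0)) = 0.
Proof.
  intros Hk Hl.
  assert (HT : exists T, forall t, T <= t -> forall pq, In pq l -> exists a b c,
     a + b * t + c * (t * t) <> 0 /\
     a * proj1_sig (fst pq) 0%nat + b * proj1_sig (fst pq) 1%nat + c * proj1_sig (fst pq) 2%nat = 0 /\
     a * proj1_sig (snd pq) 0%nat + b * proj1_sig (snd pq) 1%nat + c * proj1_sig (snd pq) 2%nat = 0).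
  { clear Hl. induction l as [|[p q] l [T IH]].
    - exists 0. intros t _ pq [].
    - destruct (common_orthogonal (proj1_sig p) (proj1_sig q)) as (a & b & c & Hn & Ep & Eq).
      destruct (quadratic_eventually_nonzero a b c Hn) as (T' & HT').
      exists (Rmax T T'). intros t Ht pq [<-|Hin].
      + exists a, b, c. split; [apply HT'; eapply Rle_trans; [apply Rmax_r|exact Ht]|].
        split; assumption.
      + apply IH; [eapply Rle_trans; [apply Rmax_l|exact Ht]|assumption]. }
  destruct HT as (t0 & HT). specialize (HT t0 (Rle_refl _)).
  set (e := fun i => match i with 0%nat => 1 | 1%nat => t0 | 2%nat => t0 * t0 | _ => 0 end).
  (* The radial edge depends on the vertex alone, so cones over consecutive segments share it. *)
  exists (fun p s => normalize (fun i => (1 - s) * e i + s * proj1_sig p i)).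
  exists (fun p q a => normalize (fun i => (1 - fst a) * e i
     + fst a * ((1 - snd a) * proj1_sig p i + snd a * proj1_sig q i))).
  intros p q Hin. split.
  - destruct (HT _ Hin) as (a & b & c & He & Ep & Eq). cbn [fst snd] in Ep, Eq.
    specialize (Hl _ Hin). cbn [fst snd] in Hl.
    set (E := norm1 e + norm1 (proj1_sig p) + norm1 (proj1_sig q) + 1).
    assert (HE : 0 < E).
    { assert (H1 := norm1_nonneg e). assert (H2 := norm1_nonneg (proj1_sig p)).
      assert (H3 := norm1_nonneg (proj1_sig q)). unfold E. lra. }
    set (N := Rabs a + Rabs b + Rabs c + 1).
    assert (HN : 0 < N).
    { assert (H1 := Rabs_pos a). assert (H2 := Rabs_pos b).
      assert (H3 := Rabs_pos c). unfold N. lra. }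
    set (lam := Rabs (a + b * t0 + c * (t0 * t0))).
    assert (Hlam : 0 < lam) by (apply Rabs_pos_lt; assumption).
    set (r := Rmin (1 / 4) (lam / (4 * N * E))).
    assert (Hr : 0 < r).
    { apply Rmin_pos; [lra|]. apply Rdiv_lt_0_compat; nra. }
    assert (Hlow : forall x, unit_sq x -> r <= norm2 (fun i => (1 - fst x) * e i
     + fst x * ((1 - snd x) * proj1_sig p i + snd x * proj1_sig q i))).
    { intros [s t] [Hs Ht]. cbn [fst snd] in *. set (w := fun i => _).
      (* Close to the segment the norm is at least 1/2 - 1/4. Elsewhere the form (a, b, c) takes the
         value (1 - s) [lam] up to sign on w, because it vanishes on p and q. *)
      destruct (Rle_lt_dec ((1 - s) * E) (1 / 4)) as [Hc|Hc].
      - eapply Rle_trans; [apply Rmin_l|].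
        assert (H := norm2_diff (fun i => (1 - t) * proj1_sig p i + t * proj1_sig q i) w).
        assert (Hs2 := segment_norm2 p q t Hl Ht).
        assert (Hd : norm1 (fun i => (1 - t) * proj1_sig p i + t * proj1_sig q i - w i)
                     <= (1 - s) * E).
        { eapply Rle_trans.
          - apply (norm1_le _ (fun i => Rabs (e i) + Rabs (proj1_sig p i) + Rabs (proj1_sig q i)) (1 - s)).
            intros i _. unfold w.
            replace ((1 - t) * proj1_sig p i + t * proj1_sig q i -
               ((1 - s) * e i + s * ((1 - t) * proj1_sig p i + t * proj1_sig q i)))
              with ((1 - s) * (- e i + (1 - t) * proj1_sig p i + t * proj1_sig q i)) by ring.
            rewrite Rabs_mult, (Rabs_right (1 - s)) by lra.
            apply Rmult_le_compat_l; [lra|].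
            eapply Rle_trans; [apply Rabs_triang|]. apply Rplus_le_compat.
            + eapply Rle_trans; [apply Rabs_triang|]. rewrite Rabs_Ropp.
              rewrite Rabs_mult, (Rabs_right (1 - t)) by lra.
              assert (H2 := Rabs_pos (proj1_sig p i)). nra.
            + rewrite Rabs_mult, (Rabs_right t) by lra.
              assert (H2 := Rabs_pos (proj1_sig q i)). nra.
          - apply Rmult_le_compat_l; [lra|]. rewrite !plus_sum.
            fold (norm1 e) (norm1 (proj1_sig p)) (norm1 (proj1_sig q)). unfold E. lra. }
        apply Rabs_le_between in H. lra.
      - eapply Rle_trans; [apply Rmin_r|].
        assert (Hlw : Rabs (a * w 0%nat + b * w 1%nat + c * w 2%nat) = (1 - s) * lam).
        { replace (a * w 0%nat + b * w 1%nat + c * w 2%nat)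
            with ((1 - s) * (a + b * t0 + c * (t0 * t0))
             + (s * (1 - t)) * (a * proj1_sig p 0%nat + b * proj1_sig p 1%nat + c * proj1_sig p 2%nat)
             + (s * t) * (a * proj1_sig q 0%nat + b * proj1_sig q 1%nat + c * proj1_sig q 2%nat))
            by (unfold w, e; ring).
          rewrite Ep, Eq, !Rmult_0_r, !Rplus_0_r, Rabs_mult, (Rabs_right (1 - s)) by lra.
          reflexivity. }
        assert (Hw0 := coord_le_norm2 w 0 ltac:(lia)).
        assert (Hw1 := coord_le_norm2 w 1 ltac:(lia)).
        assert (Hw2 := coord_le_norm2 w 2 Hk).
        assert (H0 := norm2_nonneg w).
        assert (Hle : (1 - s) * lam <= N * norm2 w).
        { rewrite <- Hlw. eapply Rle_trans; [apply Rabs_triang|].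
          eapply Rle_trans; [apply Rplus_le_compat_r, Rabs_triang|]. rewrite !Rabs_mult.
          assert (Rabs a * Rabs (w 0%nat) <= Rabs a * norm2 w)
            by (apply Rmult_le_compat_l; auto using Rabs_pos).
          assert (Rabs b * Rabs (w 1%nat) <= Rabs b * norm2 w)
            by (apply Rmult_le_compat_l; auto using Rabs_pos).
          assert (Rabs c * Rabs (w 2%nat) <= Rabs c * norm2 w)
            by (apply Rmult_le_compat_l; auto using Rabs_pos).
          unfold N. lra. }
        apply (Rmult_le_reg_r (4 * N * E)); [nra|].
        replace (lam / (4 * N * E) * (4 * N * E)) with lam by (field; lra).
        assert (lam * (1 / 4) <= lam * ((1 - s) * E)) by (apply Rmult_le_compat_l; lra).
        assert (E * ((1 - s) * lam) <= E * (N * norm2 w)) by (apply Rmult_le_compat_l; lra).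
        lra. }
    exists ((INR k + 2) / r * E). intros x y Hx Hy.
    eapply Rle_trans; [apply (normalize_lip _ _ r Hr); apply Hlow; assumption|].
    rewrite Rmult_assoc. apply Rmult_le_compat_l.
    { apply Rmult_le_pos; [assert (H := pos_INR k); lra|].
      apply Rlt_le, Rinv_0_lt_compat; assumption. }
    destruct x as [s t], y as [s' t']. destruct Hx as [Hs Ht], Hy as [Hs' Ht']. cbn [fst snd] in *.
    set (d := dist1 (s, t) (s', t')).
    assert (Hd1 : Rabs (s - s') <= d)
      by (unfold d, dist1; cbn [fst snd]; assert (H := Rabs_pos (t - t')); lra).
    assert (Hd0 : 0 <= d) by apply dist1_nonneg.
    eapply Rle_trans.
    + apply (norm1_le _ (fun i => Rabs (e i) + Rabs (proj1_sig p i) + Rabs (proj1_sig q i)) d).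
      intros i _.
      replace ((1 - s) * e i + s * ((1 - t) * proj1_sig p i + t * proj1_sig q i) -
         ((1 - s') * e i + s' * ((1 - t') * proj1_sig p i + t' * proj1_sig q i)))
        with (- (s - s') * e i
              + (s * (1 - t) - s' * (1 - t')) * proj1_sig p i
              + (s * t - s' * t') * proj1_sig q i) by ring.
      assert (K1 : Rabs (s * (1 - t) - s' * (1 - t')) <= d).
      { replace (s * (1 - t) - s' * (1 - t'))
          with ((s - s') * (1 - t) + s' * - (t - t')) by ring.
        eapply Rle_trans; [apply Rabs_triang|].
        rewrite !Rabs_mult, Rabs_Ropp, (Rabs_right (1 - t)), (Rabs_right s') by lra.
        unfold d, dist1; cbn [fst snd].
        assert (H1 := Rabs_pos (s - s')). assert (H2 := Rabs_pos (t - t')). nra. }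
      assert (K2 : Rabs (s * t - s' * t') <= d).
      { replace (s * t - s' * t') with ((s - s') * t + s' * (t - t')) by ring.
        eapply Rle_trans; [apply Rabs_triang|].
        rewrite !Rabs_mult, (Rabs_right t), (Rabs_right s') by lra.
        unfold d, dist1; cbn [fst snd].
        assert (H1 := Rabs_pos (s - s')). assert (H2 := Rabs_pos (t - t')). nra. }
      eapply Rle_trans; [apply Rabs_triang|].
      eapply Rle_trans; [apply Rplus_le_compat_r, Rabs_triang|].
      rewrite !Rabs_mult, Rabs_Ropp.
      assert (Rabs (s - s') * Rabs (e i) <= d * Rabs (e i))
        by (apply Rmult_le_compat_r; auto using Rabs_pos).
      assert (Rabs (s * (1 - t) - s' * (1 - t')) * Rabs (proj1_sig p i) <= d * Rabs (proj1_sig p i))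
        by (apply Rmult_le_compat_r; auto using Rabs_pos).
      assert (Rabs (s * t - s' * t') * Rabs (proj1_sig q i) <= d * Rabs (proj1_sig q i))
        by (apply Rmult_le_compat_r; auto using Rabs_pos).
      lra.
    + rewrite !plus_sum. fold (norm1 e) (norm1 (proj1_sig p)) (norm1 (proj1_sig q)).
      rewrite Rmult_comm. apply Rmult_le_compat_r; [assumption|]. unfold E. lra.
  - intros t _. cbn [fst snd]. repeat split; apply normalize_ext; intros; ring.
Qed.

End Sphere.

(** * Chains, closed paths and the height function *)

Inductive rpath {A : Type} (R : A -> A -> Prop) : A -> A -> Prop :=
| rpath_nil x : rpath R x x
| rpath_cons x y z : R x y -> rpath R y z -> rpath R x z.

Lemma rpath_app {A} (R : A -> A -> Prop) x y z : rpath R x y -> rpath R y z -> rpath R x z.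
Proof. induction 1; [auto|]. intros. eapply rpath_cons; eauto. Qed.

Lemma rpath_rev {A} (R : A -> A -> Prop) x y :
  (forall p q, R p q -> R q p) -> rpath R x y -> rpath R y x.
Proof.
  intros HR. induction 1; [constructor|].
  eapply rpath_app; [eassumption|]. eapply rpath_cons; [apply HR; eassumption|constructor].
Qed.

Lemma rpath_impl {A} (R R' : A -> A -> Prop) x y :
  (forall p q, R p q -> R' p q) -> rpath R x y -> rpath R' x y.
Proof. intros HR. induction 1; [constructor|]. eapply rpath_cons; eauto. Qed.

Lemma rpath_seq {A} (R : A -> A -> Prop) (g : nat -> A) N :
  (forall i, (i < N)%nat -> R (g i) (g (S i))) -> rpath R (g O) (g N).
Proof.
  induction N as [|N IH]; intros H; [constructor|].
  eapply rpath_app; [apply IH; intros; apply H; lia|].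
  eapply rpath_cons; [apply H; lia|constructor].
Qed.

Definition clamp (a b x : R) : R := Rmax a (Rmin b x).

Lemma clamp_lip a b x y : Rabs (clamp a b x - clamp a b y) <= Rabs (x - y).
Proof.
  unfold clamp. apply Rle_trans with (Rabs (Rmin b x - Rmin b y)).
  - generalize (Rmin b x) (Rmin b y). intros u w. unfold Rmax, Rabs.
    destruct (Rle_dec a u), (Rle_dec a w); repeat destruct (Rcase_abs _); lra.
  - unfold Rmin, Rabs.
    destruct (Rle_dec b x), (Rle_dec b y); repeat destruct (Rcase_abs _); lra.
Qed.

Lemma clamp_low a b x : a <= b -> x <= a -> clamp a b x = a.
Proof. intros. unfold clamp. rewrite Rmin_right, Rmax_left; lra. Qed.

Lemma clamp_high a b x : a <= b -> b <= x -> clamp a b x = b.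
Proof. intros. unfold clamp. rewrite Rmin_left, Rmax_right; lra. Qed.

Section Chains.

Variable k : nat.
Hypothesis hk : (2 <= k)%nat.
Variable f : sphere k -> H1.
Variable Lf : R.
Hypothesis Lf_nonneg : 0 <= Lf.
Hypothesis f_lip : forall a b, rho (f a) (f b) <= Lf * sdist k a b.

Local Notation X := (sphere k).
Local Notation d := (sdist k).
Local Notation cost a b := (rho (f a) (f b)).
Local Notation seg := (segment k).
Local Notation o := (base k).

Definition Bseg : R := Lf * (2 * (INR k + 2)).

Lemma Bseg_nonneg : 0 <= Bseg.
Proof. unfold Bseg. assert (H := pos_INR k). apply Rmult_le_pos; lra. Qed.

Lemma cost_zero a b : d a b = 0 -> cost a b = 0.
Proof.
  intros H. apply Rle_antisym; [|apply rho_nonneg].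
  eapply Rle_trans; [apply f_lip|]. rewrite H. lra.
Qed.

Lemma segment_subdivision p q s t delta : near k p q -> 0 <= s <= 1 -> 0 <= t <= 1 -> 0 < delta ->
  exists N (g : nat -> R), (1 <= N)%nat /\ g O = s /\ g N = t /\
    (forall i, (i <= N)%nat -> Rmin s t <= g i <= Rmax s t) /\
    forall i, (i < N)%nat ->
      d (seg p q (g i)) (seg p q (g (S i))) <= delta /\
      cost (seg p q (g i)) (seg p q (g (S i))) <= Bseg * (d p q * Rabs (s - t)) / INR N.
Proof.
  intros Hn Hs Ht Hd.
  assert (HA : 0 <= 2 * (INR k + 2)) by (assert (H := pos_INR k); lra).
  assert (Hl : 0 <= 2 * (INR k + 2) * (d p q * Rabs (s - t))).
  { apply Rmult_le_pos; [assumption|]. apply Rmult_le_pos; [apply sdist_nonneg|apply Rabs_pos]. }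
  destruct (nfloor_ex (2 * (INR k + 2) * (d p q * Rabs (s - t)) / delta)) as [M [_ HM]].
  { apply Rmult_le_pos; [assumption|]. apply Rlt_le, Rinv_0_lt_compat; assumption. }
  set (N := S M).
  assert (HN : 2 * (INR k + 2) * (d p q * Rabs (s - t)) / delta < INR N)
    by (unfold N; rewrite S_INR; lra).
  assert (HN1 : (1 <= N)%nat) by (unfold N; lia). clearbody N. clear M HM.
  assert (HN0 : 0 < INR N) by (apply lt_0_INR; lia).
  assert (Hi : 0 < / INR N) by (apply Rinv_0_lt_compat; assumption).
  assert (Hstep : 2 * (INR k + 2) * (d p q * Rabs (s - t)) / INR N <= delta).
  { apply (Rmult_le_reg_r (INR N / delta)); [apply Rdiv_lt_0_compat; assumption|].
    replace (2 * (INR k + 2) * (d p q * Rabs (s - t)) / INR N * (INR N / delta))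
      with (2 * (INR k + 2) * (d p q * Rabs (s - t)) / delta) by (field; lra).
    replace (delta * (INR N / delta)) with (INR N) by (field; lra). lra. }
  set (g := fun i => s + (t - s) * (INR i / INR N)).
  assert (Hg : forall i, (i <= N)%nat -> Rmin s t <= g i <= Rmax s t).
  { intros i Hi'. destruct (node_unit N i HN1 Hi') as [H1 H2]. unfold g.
    unfold Rmin, Rmax. destruct (Rle_dec s t); split; nra. }
  assert (Hu : forall i, (i <= N)%nat -> 0 <= g i <= 1).
  { intros i Hi'. specialize (Hg i Hi'). unfold Rmin, Rmax in Hg.
    destruct (Rle_dec s t); lra. }
  exists N, g. split; [assumption|]. split; [unfold g; simpl; field; lra|].
  split; [unfold g; field; lra|]. split; [assumption|].
  intros i Hi'.
  assert (Hdist : d (seg p q (g i)) (seg p q (g (S i)))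
                  <= 2 * (INR k + 2) * (d p q * Rabs (s - t)) / INR N).
  { eapply Rle_trans; [apply segment_lip; auto; apply Hu; lia|].
    replace (g i - g (S i)) with ((s - t) * / INR N)
      by (unfold g; rewrite S_INR; field; lra).
    rewrite Rabs_mult, (Rabs_right (/ INR N)) by lra. apply Req_le. field. lra. }
  split; [lra|]. eapply Rle_trans; [apply f_lip|].
  unfold Bseg.
  replace (Lf * (2 * (INR k + 2)) * (d p q * Rabs (s - t)) / INR N)
    with (Lf * (2 * (INR k + 2) * (d p q * Rabs (s - t)) / INR N)) by (field; lra).
  apply Rmult_le_compat_l; assumption.
Qed.

(** Steps are limited on the sphere but paid for in the image, so the infimum of the costs is a
    discrete f-length. *)
Inductive chain (delta : R) : X -> X -> R -> Prop :=
| chain_nil x : chain delta x x 0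
| chain_cons x y z c : d x y <= delta -> chain delta y z c -> chain delta x z (cost x y + c).

Lemma chain_nonneg delta x y c : chain delta x y c -> 0 <= c.
Proof.
  induction 1; [lra|]. assert (H1 := rho_nonneg (f x) (f y)). lra.
Qed.

Lemma chain_app delta x y z c c' :
  chain delta x y c -> chain delta y z c' -> chain delta x z (c + c').
Proof.
  induction 1 as [x|x w y c Hd H IH]; intros H'.
  - rewrite Rplus_0_l. assumption.
  - rewrite Rplus_assoc. apply chain_cons; auto.
Qed.

Lemma chain_single delta x y : d x y <= delta -> chain delta x y (cost x y).
Proof. intros H. rewrite <- Rplus_0_r. apply chain_cons; [assumption|constructor]. Qed.

Lemma chain_rev delta x y c : chain delta x y c -> chain delta y x c.
Proof.
  induction 1 as [x|x w y c Hd H IH]; [constructor|].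
  rewrite Rplus_comm. eapply chain_app; [eassumption|].
  rewrite rho_sym. apply chain_single. rewrite sdist_sym. assumption.
Qed.

Lemma chain_mono delta delta' x y c : delta <= delta' -> chain delta x y c -> chain delta' x y c.
Proof. intros Hd. induction 1; constructor; auto; lra. Qed.

Lemma chain_seq delta (g : nat -> X) e N :
  (forall i, (i < N)%nat -> d (g i) (g (S i)) <= delta /\ cost (g i) (g (S i)) <= e) ->
  exists c, chain delta (g O) (g N) c /\ c <= INR N * e.
Proof.
  induction N as [|N IH]; intros H.
  - exists 0. split; [constructor|]. simpl. lra.
  - destruct IH as (c & Hc & Hle); [intros; apply H; lia|].
    destruct (H N ltac:(lia)) as [Hd He].
    exists (c + cost (g N) (g (S N))). split.
    + eapply chain_app; [eassumption|]. apply chain_single. assumption.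
    + rewrite S_INR. lra.
Qed.

Lemma chain_segment delta p q s t : 0 < delta -> near k p q -> 0 <= s <= 1 -> 0 <= t <= 1 ->
  exists c, chain delta (seg p q s) (seg p q t) c /\ c <= Bseg * (d p q * Rabs (s - t)).
Proof.
  intros Hd Hn Hs Ht.
  destruct (segment_subdivision p q s t delta Hn Hs Ht Hd) as (N & g & HN & E0 & E1 & _ & Hg).
  destruct (chain_seq delta (fun i => seg p q (g i)) _ N Hg) as (c & Hc & Hle).
  exists c. rewrite <- E0 at 1. rewrite <- E1 at 1. split; [assumption|].
  assert (HN0 : 0 < INR N) by (apply lt_0_INR; lia).
  eapply Rle_trans; [exact Hle|]. apply Req_le. field. lra.
Qed.

Lemma chain_near delta p q : 0 < delta -> near k p q ->
  exists c, chain delta p q c /\ c <= Bseg * d p q.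
Proof.
  intros Hd Hn.
  destruct (chain_segment delta p q 0 1 Hd Hn ltac:(lra) ltac:(lra)) as (c & Hc & Hle).
  rewrite Rminus_0_l, Rabs_Ropp, Rabs_R1, Rmult_1_r in Hle.
  exists c. split; [|assumption].
  assert (Z0 : cost p (seg p q 0) = 0)
    by (apply cost_zero; rewrite sdist_sym; apply segment_0).
  assert (Z1 : cost (seg p q 1) q = 0) by apply cost_zero, segment_1.
  replace c with (cost p (seg p q 0) + (c + cost (seg p q 1) q)) by (rewrite Z0, Z1; ring).
  apply chain_cons; [rewrite sdist_sym, segment_0; lra|].
  eapply chain_app; [eassumption|]. apply chain_single. rewrite segment_1. lra.
Qed.

(** Any two points are joined through the base point by four segments, each of [sdist]-length at
    most 2 (k + 1). *)
Definition Dmax : R := 4 * (Bseg * (2 * INR (S k))).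

Lemma chain_exists delta x y : 0 < delta -> exists c, chain delta x y c /\ c <= Dmax.
Proof.
  intros Hd.
  assert (K : forall x, exists c, chain delta x o c /\ c <= 2 * (Bseg * (2 * INR (S k)))).
  { intros a. destruct (near_base k a ltac:(lia)) as (z & Hz & Hzo).
    destruct (chain_near delta a z Hd Hz) as (c & Hc & Hle).
    destruct (chain_near delta z o Hd Hzo) as (c' & Hc' & Hle').
    exists (c + c'). split; [eapply chain_app; eassumption|].
    assert (D1 := sdist_bounded k a z). assert (D2 := sdist_bounded k z o).
    assert (HB := Bseg_nonneg).
    assert (Bseg * d a z <= Bseg * (2 * INR (S k))) by (apply Rmult_le_compat_l; assumption).
    assert (Bseg * d z o <= Bseg * (2 * INR (S k))) by (apply Rmult_le_compat_l; assumption).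
    lra. }
  destruct (K x) as (c & Hc & Hle). destruct (K y) as (c' & Hc' & Hle').
  exists (c + c'). split; [|unfold Dmax; lra].
  eapply chain_app; [eassumption|]. apply chain_rev. assumption.
Qed.

Definition cdist (delta : R) (x y : X) : R :=
  epsilon (inhabits 0) (fun r => is_glb (chain delta x y) r).

Lemma cdist_glb delta x y : 0 < delta -> is_glb (chain delta x y) (cdist delta x y).
Proof.
  intros Hd. apply (epsilon_spec (inhabits 0) (fun r => is_glb (chain delta x y) r)).
  destruct (completeness (fun s => chain delta x y (- s))) as (s & Hs).
  - exists 0. intros s Hs. apply chain_nonneg in Hs. lra.
  - destruct (chain_exists delta x y Hd) as (c & Hc & _). exists (- c).
    rewrite Ropp_involutive. assumption.
  - exists (- s). split.
    + intros c Hc. assert (- c <= s); [|lra].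
      apply Hs. rewrite Ropp_involutive. assumption.
    + intros b Hb. assert (s <= - b); [|lra].
      apply Hs. intros t Ht. apply Hb in Ht. lra.
Qed.

Section Scale.

Variable delta : R.
Hypothesis Hdelta : 0 < delta.

Local Notation cd := (cdist delta).

Lemma cdist_le x y c : chain delta x y c -> cd x y <= c.
Proof. apply (cdist_glb delta x y Hdelta). Qed.

Lemma cdist_ge x y b : (forall c, chain delta x y c -> b <= c) -> b <= cd x y.
Proof. apply (cdist_glb delta x y Hdelta). Qed.

Lemma cdist_approx x y eta : 0 < eta -> exists c, chain delta x y c /\ c <= cd x y + eta.
Proof.
  intros He. apply NNPP. intros H.
  assert (cd x y + eta <= cd x y); [|lra].
  apply cdist_ge. intros c Hc. apply Rnot_lt_le. intros Hlt.
  apply H. exists c. split; [assumption|lra].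
Qed.

Lemma cdist_nonneg x y : 0 <= cd x y.
Proof. apply cdist_ge. intros c Hc. apply (chain_nonneg _ _ _ _ Hc). Qed.

Lemma cdist_refl x : cd x x = 0.
Proof. apply Rle_antisym; [apply cdist_le; constructor|apply cdist_nonneg]. Qed.

Lemma cdist_sym x y : cd x y = cd y x.
Proof.
  apply Rle_antisym; apply cdist_ge; intros c Hc; apply cdist_le, chain_rev, Hc.
Qed.

Lemma cdist_tri x y z : cd x z <= cd x y + cd y z.
Proof.
  apply le_epsilon. intros e He.
  destruct (cdist_approx x y (e / 2) ltac:(lra)) as (c & Hc & Hle).
  destruct (cdist_approx y z (e / 2) ltac:(lra)) as (c' & Hc' & Hle').
  assert (H := cdist_le x z (c + c') (chain_app _ _ _ _ _ _ Hc Hc')). lra.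
Qed.

(** This makes chain distances from a point locally Lipschitz functions of f, as [stokes_local]
    requires. *)
Lemma cdist_step x y : d x y <= delta -> cd x y <= cost x y.
Proof. intros. apply cdist_le, chain_single. assumption. Qed.

Lemma cost_le_cdist x y : cost x y <= cd x y.
Proof.
  apply cdist_ge. intros c Hc. induction Hc as [x|x w y c Hd H IH].
  - rewrite rho_refl. lra.
  - assert (T := rho_tri (f x) (f w) (f y)). lra.
Qed.

Lemma cdist_bounded x y : cd x y <= Dmax.
Proof.
  destruct (chain_exists delta x y Hdelta) as (c & Hc & Hle). apply cdist_le in Hc. lra.
Qed.

Lemma cdist_segment p q s t : near k p q -> 0 <= s <= 1 -> 0 <= t <= 1 ->
  cd (seg p q s) (seg p q t) <= Bseg * (d p q * Rabs (s - t)).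
Proof.
  intros Hn Hs Ht. destruct (chain_segment delta p q s t Hdelta Hn Hs Ht) as (c & Hc & Hle).
  apply cdist_le in Hc. lra.
Qed.

Lemma cdist_segment_le p q s t : near k p q -> 0 <= s <= 1 -> 0 <= t <= 1 ->
  cd (seg p q s) (seg p q t) <= Bseg * d p q.
Proof.
  intros Hn Hs Ht. eapply Rle_trans; [apply cdist_segment; assumption|].
  apply Rmult_le_compat_l; [apply Bseg_nonneg|].
  rewrite <- (Rmult_1_r (d p q)) at 2.
  apply Rmult_le_compat_l; [apply sdist_nonneg|]. apply Rabs_le. lra.
Qed.

Lemma cdist_zero x y : d x y = 0 -> cd x y = 0.
Proof.
  intros H. apply Rle_antisym; [|apply cdist_nonneg].
  rewrite <- (cost_zero x y H). apply cdist_step. lra.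
Qed.

Lemma cdist_vertex_segment p q t : near k p q -> 0 <= t <= 1 ->
  cd p (seg p q t) <= Bseg * d p q.
Proof.
  intros Hn Ht. eapply Rle_trans; [apply (cdist_tri _ (seg p q 0))|].
  rewrite cdist_zero by (rewrite sdist_sym; apply segment_0). rewrite Rplus_0_l.
  apply cdist_segment_le; auto; lra.
Qed.

End Scale.

(** Smaller steps leave fewer chains, so the distances grow as delta decreases; the supremum in
    [height] is a limit. *)
Lemma cdist_mono delta delta' x y : 0 < delta -> delta <= delta' ->
  cdist delta' x y <= cdist delta x y.
Proof.
  intros H0 Hle. apply cdist_ge; [assumption|]. intros c Hc.
  apply cdist_le; [lra|]. apply (chain_mono delta); assumption.
Qed.

(** * Discrete integrals of P dV along closed paths of segments *)

Section Loops.

Variables P V : X -> R.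
Variables C delta : R.
Hypothesis HC : 0 <= C.
Hypothesis Hdelta : 0 < delta.
Hypothesis HP : forall a b, d a b <= delta -> Rabs (P a - P b) <= C * cost a b.
Hypothesis HV : forall a b, d a b <= delta -> Rabs (V a - V b) <= C * cost a b.

Definition segint (n : nat) (p q : X) : R :=
  Rsum n (fun i => trap (P (seg p q (INR i / INR n))) (V (seg p q (INR i / INR n)))
           (P (seg p q (INR (S i) / INR n))) (V (seg p q (INR (S i) / INR n)))).

Inductive tpath : X -> X -> R -> Prop :=
| tpath_nil x : tpath x x 0
| tpath_cons p q z a b : near k p q -> (forall n, (1 <= n)%nat -> segint n p q = a) ->
    tpath q z b -> tpath p z (a + b).

Lemma tpath_app x y z a b : tpath x y a -> tpath y z b -> tpath x z (a + b).
Proof.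
  induction 1 as [x|p q y a a' Hn Hs H IH]; intros H'.
  - rewrite Rplus_0_l. assumption.
  - rewrite Rplus_assoc. eapply tpath_cons; eauto.
Qed.

Lemma tpath_zero (R : X -> X -> Prop) x y :
  (forall p q, R p q -> near k p q /\ forall n, (1 <= n)%nat -> segint n p q = 0) ->
  rpath R x y -> tpath x y 0.
Proof.
  intros HR. induction 1 as [x|x w y Hw H IH]; [constructor|].
  destruct (HR _ _ Hw). rewrite <- (Rplus_0_l 0). eapply tpath_cons; eassumption.
Qed.

Lemma tpath_exact (R : X -> X -> Prop) x y :
  (forall p q, R p q -> near k p q /\ forall n, (1 <= n)%nat -> segint n p q = V q - V p) ->
  rpath R x y -> tpath x y (V y - V x).
Proof.
  intros HR. induction 1 as [x|x w y Hw H IH].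
  - rewrite Rminus_diag. constructor.
  - destruct (HR _ _ Hw). replace (V y - V x) with ((V w - V x) + (V y - V w)) by ring.
    eapply tpath_cons; eassumption.
Qed.

(** The list of edges comes first, so that the cone can be built from it; the approximate primitive
    h and the grid size n depend on that cone. *)
Lemma tpath_primitive x y a : tpath x y a ->
  exists l : list (X * X), (forall pq, In pq l -> near k (fst pq) (snd pq)) /\
    forall n (h : X -> R) eps, (1 <= n)%nat ->
      (forall p q, In (p, q) l -> Rabs (segint n p q - (h q - h p)) <= eps) ->
      Rabs (a - (h y - h x)) <= INR (length l) * eps.
Proof.
  induction 1 as [x|p q z a b Hn Hs H (l & Hl & Hh)].
  - exists nil. split; [intros _ []|]. intros. simpl.
    rewrite !Rminus_diag, Rabs_R0. lra.
  - exists ((p, q) :: l). split; [intros pq [<-|]; auto|].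
    intros n h eps Hn1 Hi.
    assert (I1 := Hh n h eps Hn1 (fun p q Hin => Hi p q (or_intror Hin))).
    assert (I2 := Hi p q (or_introl eq_refl)). rewrite (Hs n Hn1) in I2.
    cbn [length]. rewrite S_INR.
    replace (a + b - (h z - h p)) with ((a - (h q - h p)) + (b - (h z - h q))) by ring.
    eapply Rle_trans; [apply Rabs_triang|]. lra.
Qed.

Lemma eq_at_zero_dist W : (forall a b, d a b <= delta -> Rabs (W a - W b) <= C * cost a b) ->
  forall a b, d a b = 0 -> W a = W b.
Proof.
  intros HW a b H. specialize (HW a b ltac:(lra)).
  rewrite (cost_zero a b H), Rmult_0_r in HW.
  apply Rminus_diag_uniq, Rabs_eq_0. assert (H0 := Rabs_pos (W a - W b)). lra.
Qed.

(* Coning the loop off, Stokes makes the integral over the radial edges a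
   primitive of [P dV] at the vertices. *)
Lemma closed_tpath x a : tpath x x a -> a = 0.
Proof.
  intros Ht. destruct (tpath_primitive x x a Ht) as (l & Hl & Hh).
  assert (EP := eq_at_zero_dist P HP). assert (EV := eq_at_zero_dist V HV).
  assert (K : forall eps, 0 < eps -> Rabs a <= INR (length l) * eps).
  { intros eps Heps.
    destruct (cone_exists k l hk Hl) as (h0 & Q & HQ).
    assert (HE : evm (fun n => forall pq, In pq l ->
      Rabs (loop (grid n (fun a => P (Q (fst pq) (snd pq) a)))
                 (grid n (fun a => V (Q (fst pq) (snd pq) a))) 0 0 n n) <= eps)).
    { apply evm_forall_in. intros [p q] Hin. cbn [fst snd].
      destruct (HQ p q Hin) as ((Lq & HLq) & _).
      (* The cone map expands distances by at most [Lq], so this scale in the square corresponds to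
         steps of at most delta on the sphere. *)
      apply (stokes_local (fun a => f (Q p q a)) (Lf * Lq) _ _ C (delta / (Rabs Lq + 1)));
        auto.
      - assert (H := Rabs_pos Lq). apply Rdiv_lt_0_compat; lra.
      - intros u w Hu Hw. eapply Rle_trans; [apply f_lip|]. rewrite Rmult_assoc.
        apply Rmult_le_compat_l; auto.
      - intros u w Hu Hw Hd. apply HP. eapply Rle_trans; [apply HLq; assumption|].
        assert (H := Rabs_pos Lq). assert (H' := Rle_abs Lq). assert (D := dist1_nonneg u w).
        apply Rle_trans with ((Rabs Lq + 1) * dist1 u w); [nra|].
        apply (Rmult_le_compat_l (Rabs Lq + 1)) in Hd; [|lra].
        replace ((Rabs Lq + 1) * (delta / (Rabs Lq + 1))) with delta in Hd by (field; lra). exact Hd.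
      - intros u w Hu Hw Hd. apply HV. eapply Rle_trans; [apply HLq; assumption|].
        assert (H := Rabs_pos Lq). assert (H' := Rle_abs Lq). assert (D := dist1_nonneg u w).
        apply Rle_trans with ((Rabs Lq + 1) * dist1 u w); [nra|].
        apply (Rmult_le_compat_l (Rabs Lq + 1)) in Hd; [|lra].
        replace ((Rabs Lq + 1) * (delta / (Rabs Lq + 1))) with delta in Hd by (field; lra). exact Hd. }
    destruct (evm_ex _ HE) as (n & Hn & HE').
    assert (Hn0 : 0 < INR n) by (apply lt_0_INR; lia).
    (* The integral of P dV from the apex to p along the radial edge. *)
    set (h := fun p => Rsum n (fun i =>
       trap (P (h0 p (INR i / INR n))) (V (h0 p (INR i / INR n)))
            (P (h0 p (INR (S i) / INR n))) (V (h0 p (INR (S i) / INR n))))).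
    assert (Hfin := Hh n h eps Hn). rewrite Rminus_diag, Rminus_0_r in Hfin. apply Hfin.
    intros p q Hin. specialize (HE' (p, q) Hin). cbn [fst snd] in HE'.
    destruct (HQ p q Hin) as (_ & HB).
    match type of HE' with Rabs ?L <= _ =>
      replace (segint n p q - (h q - h p)) with L; [exact HE'|] end.
    assert (N0 : INR 0 / INR n = 0) by (simpl; field; lra).
    assert (N1 : INR n / INR n = 1) by (field; lra).
    assert (Hnode : forall i, (i <= n)%nat -> 0 <= INR i / INR n <= 1)
      by (intros; apply node_unit; assumption).
    unfold loop, grid. rewrite !Nat.add_0_l, N0, N1.
    rewrite (Rsum_ext n _ (fun i =>
       trap (P (h0 p (INR i / INR n))) (V (h0 p (INR i / INR n)))
            (P (h0 p (INR (S i) / INR n))) (V (h0 p (INR (S i) / INR n))))).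
    2: { intros i Hi. rewrite !Nat.add_0_l.
         destruct (HB _ (Hnode i ltac:(lia))) as (E & _).
         destruct (HB _ (Hnode (S i) ltac:(lia))) as (E' & _).
         rewrite (EP _ _ E), (EV _ _ E), (EP _ _ E'), (EV _ _ E'). reflexivity. }
    rewrite (Rsum_ext n (fun l0 => trap (P (Q p q (1, _))) _ _ _) (fun i =>
       trap (P (seg p q (INR i / INR n))) (V (seg p q (INR i / INR n)))
           (P (seg p q (INR (S i) / INR n))) (V (seg p q (INR (S i) / INR n))))).
    2: { intros i Hi. rewrite !Nat.add_0_l.
         destruct (HB _ (Hnode i ltac:(lia))) as (_ & _ & E & _).
         destruct (HB _ (Hnode (S i) ltac:(lia))) as (_ & _ & E' & _).
         rewrite (EP _ _ E), (EV _ _ E), (EP _ _ E'), (EV _ _ E'). reflexivity. }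
    rewrite (Rsum_ext n (fun l0 => trap (P (Q p q (_, 1))) _ _ _) (fun i =>
       trap (P (h0 q (INR i / INR n))) (V (h0 q (INR i / INR n)))
            (P (h0 q (INR (S i) / INR n))) (V (h0 q (INR (S i) / INR n))))).
    2: { intros i Hi. rewrite !Nat.add_0_l.
         destruct (HB _ (Hnode i ltac:(lia))) as (_ & E & _).
         destruct (HB _ (Hnode (S i) ltac:(lia))) as (_ & E' & _).
         rewrite (EP _ _ E), (EV _ _ E), (EP _ _ E'), (EV _ _ E'). reflexivity. }
    (* The fourth side of the square is collapsed to the apex, so V does not vary on it. *)
    rewrite (Rsum_zero n (fun l0 => trap (P (Q p q (0, _))) _ _ _)).
    2: { intros i Hi. rewrite !Nat.add_0_l.
         destruct (HB _ (Hnode i ltac:(lia))) as (_ & _ & _ & E).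
         destruct (HB _ (Hnode (S i) ltac:(lia))) as (_ & _ & _ & E').
         rewrite (EV _ _ E), (EV _ _ E'). unfold trap. ring. }
    fold (segint n p q). fold (h p) (h q). ring. }
  apply Rabs_eq_0. apply Rle_antisym; [|apply Rabs_pos].
  apply le_epsilon. intros e He. rewrite Rplus_0_l.
  assert (Hln := pos_INR (length l)).
  eapply Rle_trans; [apply (K (e / (INR (length l) + 1)))|].
  - apply Rdiv_lt_0_compat; lra.
  - apply (Rmult_le_reg_r (INR (length l) + 1)); [lra|].
    replace (INR (length l) * (e / (INR (length l) + 1)) * (INR (length l) + 1))
      with (INR (length l) * e) by (field; lra). nra.
Qed.

(** Each trapezoid is c times the increment of V, either because the increment is 0 or because P is
    c at both nodes; the sum telescopes. *)
Lemma segint_local (ok : X -> Prop) (c : R) p q :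
  (forall s, 0 <= s <= 1 -> ok (seg p q s)) ->
  (forall a b, ok a -> ok b -> V a = V b \/ (P a = c /\ P b = c)) ->
  forall n, (1 <= n)%nat -> segint n p q = c * (V q - V p).
Proof.
  intros Hok HPV n Hn. assert (Hn0 : 0 < INR n) by (apply lt_0_INR; lia).
  assert (E0 : V (seg p q (INR 0 / INR n)) = V p).
  { replace (INR 0 / INR n) with 0 by (simpl; field; lra).
    apply (eq_at_zero_dist V HV), segment_0. }
  assert (E1 : V (seg p q (INR n / INR n)) = V q).
  { replace (INR n / INR n) with 1 by (field; lra).
    apply (eq_at_zero_dist V HV), segment_1. }
  rewrite <- E0, <- E1, <- (Rsum_telescope n (fun i => V (seg p q (INR i / INR n)))),
    <- Rsum_scal.
  apply Rsum_ext. intros i Hi. unfold trap.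
  destruct (HPV (seg p q (INR i / INR n)) (seg p q (INR (S i) / INR n))) as [->|[-> ->]];
    [apply Hok, node_unit; lia|apply Hok, node_unit; lia| |]; field.
Qed.

End Loops.

Local Notation B := Bseg.

(** The cut is made before the step that would exceed [tau], so at most the cost of one step is
    lost. *)
Lemma chain_split delta e x z c tau :
  (forall a b, d a b <= delta -> cost a b <= e) -> 0 <= e ->
  chain delta x z c -> 0 <= tau <= c ->
  exists x' c1 c2, chain delta x x' c1 /\ chain delta x' z c2 /\
    c1 + c2 = c /\ tau - e <= c1 <= tau.
Proof.
  intros He He0 H. revert tau. induction H as [x|x w y c Hd H IH]; intros tau Ht.
  - exists x, 0, 0. split; [apply chain_nil|]. split; [apply chain_nil|]. lra.
  - destruct (Rle_lt_dec (cost x w) tau) as [Hc|Hc].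
    + destruct (IH (tau - cost x w) ltac:(lra)) as (x' & c1 & c2 & H1 & H2 & E & Hle).
      exists x', (cost x w + c1), c2. split; [apply chain_cons; assumption|].
      split; [assumption|]. lra.
    + exists x, 0, (cost x w + c). specialize (He x w Hd).
      split; [apply chain_nil|]. split; [apply chain_cons; assumption|]. lra.
Qed.

(** * Comparison of image distance and height at a fixed scale *)

Section Key.

Variable delta : R.
Hypothesis Hdelta : 0 < delta <= 1.

Local Notation cd := (cdist delta).
Local Notation v := (cdist delta o).

Let Hd0 : 0 < delta := proj1 Hdelta.

Lemma v_tri a b : v b <= v a + cd a b.
Proof. apply cdist_tri; auto. Qed.

Lemma v_tri' a b : v a <= v b + cd a b.
Proof.
  rewrite (cdist_sym delta Hd0 a b).
  apply cdist_tri; auto.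
Qed.

Lemma near_of_delta p q : d p q <= delta -> near k p q.
Proof. intros H. apply near_of_close. lra. Qed.

Lemma B_delta p q : d p q <= delta -> B * d p q <= B * delta.
Proof. apply Rmult_le_compat_l, Bseg_nonneg. Qed.

(** This is the invariant of the lower part of a chain: the cost left to x' is at most m - v. Hence
    an edge that reaches nearly height m is close to x', which is where the cut-off is 1. *)
Let before (m : R) (x' p q : X) : Prop :=
  d p q <= delta /\ cd p x' <= m - v p /\ cd q x' <= m - v q.

Let above (kap : R) (p q : X) : Prop := d p q <= delta /\ kap <= v p /\ kap <= v q.

Lemma chain_before m x' p c : chain delta p x' c -> v p + c <= m -> rpath (before m x') p x'.
Proof.
  intros H. induction H as [x|x w y c Hd H IH]; intros Hm; [constructor|].
  assert (Hs := cdist_step delta Hd0 x w Hd).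
  assert (Hv := v_tri x w).
  assert (H1 := cdist_le delta Hd0 _ _ _ (chain_cons delta x w y c Hd H)).
  assert (H2 := cdist_le delta Hd0 _ _ _ H).
  apply rpath_cons with w; [|apply IH; lra]. repeat split; lra.
Qed.

Lemma chain_above kap p x c : chain delta p x c -> kap <= v x - c -> rpath (above kap) p x.
Proof.
  intros H. induction H as [x|x w y c Hd H IH]; intros Hm; [constructor|].
  assert (Hc := rho_nonneg (f x) (f w)).
  assert (H1 := cdist_le delta Hd0 _ _ _ (chain_cons delta x w y c Hd H)).
  assert (H2 := cdist_le delta Hd0 _ _ _ H).
  assert (V1 := v_tri x y). assert (V2 := v_tri w y).
  apply rpath_cons with w; [|apply IH; lra]. repeat split; lra.
Qed.

(* Near-optimal chains from the base point to x and to y, cut at height about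
   m, end at x' and y'. If x' and y' were far apart, the form P dV, where V is
   the height clamped to a thin slab below m and P cuts off around x', would
   integrate to the thickness of the slab along the first chain and to zero
   along the rest of the closed path through x', x, y, y'. *)
Lemma cost_le_height m x y :
  m <= v x -> m <= v y ->
  rpath (fun p q => near k p q /\ forall t, 0 <= t <= 1 -> m <= v (seg p q t)) x y ->
  cost x y <= v x + v y - 2 * m + (4 * Lf + 6 * B + 7) * delta.
Proof.
  intros Hx Hy Hxy.
  assert (HB : 0 <= B) by (apply Bseg_nonneg).
  assert (HBd : 0 <= B * delta) by (apply Rmult_le_pos; lra).
  assert (HLd : 0 <= Lf * delta) by (apply Rmult_le_pos; lra).
  assert (Hcost := cost_le_cdist delta Hd0 x y).
  assert (tri := cdist_tri delta Hd0).
  assert (sym := cdist_sym delta Hd0).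
  (* [kap] bounds from below the heights of the vertices of the upper parts of the chains: delta is
     lost to near-optimality and [Lf] delta to the cut. [m0] does so for all points of their
     edges. *)
  set (kap := m - (Lf + 1) * delta). set (m0 := kap - B * delta).
  (* A lower edge that meets heights above [m0] - delta lies within [T1] of the end of its chain;
     the cut-off falls from 1 to 0 between distances [T1] and [T2]. *)
  set (T1 := (Lf + 3 * B + 2) * delta). set (T2 := T1 + delta).
  assert (HT1 : T1 = m - m0 + delta + 2 * (B * delta)) by (unfold T1, m0, kap; ring).
  (* If the slab would reach below height 0, then m is itself of order delta and passing through the
     base point suffices. *)
  destruct (Rlt_le_dec m0 delta) as [Hm|Hm].
  { assert (T := tri x o y). rewrite (sym x o) in T. unfold m0, kap in Hm. lra. }
  destruct (cdist_approx delta Hd0 o x delta Hd0) as (cx & Hcx & Lx).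
  destruct (cdist_approx delta Hd0 o y delta Hd0) as (cy & Hcy & Ly).
  assert (Gx := cdist_le delta Hd0 _ _ _ Hcx).
  assert (Gy := cdist_le delta Hd0 _ _ _ Hcy).
  assert (Hm0 : 0 <= m) by (unfold m0, kap in Hm; lra).
  assert (step : forall a b, d a b <= delta -> cost a b <= Lf * delta).
  { intros a b Hab. eapply Rle_trans; [apply f_lip|]. apply Rmult_le_compat_l; assumption. }
  destruct (chain_split delta _ _ _ _ m step HLd Hcx ltac:(lra))
    as (x' & cx1 & cx2 & Hx1 & Hx2 & Ex & Bx).
  destruct (chain_split delta _ _ _ _ m step HLd Hcy ltac:(lra))
    as (y' & cy1 & cy2 & Hy1 & Hy2 & Ey & By).
  assert (Hx2' := cdist_le delta Hd0 _ _ _ Hx2).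
  assert (Hy2' := cdist_le delta Hd0 _ _ _ Hy2).
  assert (Hclose : cd x' y' <= T1 + T2).
  { apply Rnot_lt_le. intros Hfar.
    set (V := fun a => clamp (m0 - delta) m0 (v a)).
    set (P := fun a => clamp 0 1 ((T2 - cd x' a) / delta)).
    assert (Hid : 0 < / delta) by (apply Rinv_0_lt_compat; assumption).
    (* The cut-off has slope 1/delta and the height slope 1; a large constant does no harm since
       [closed_tpath] has no error term. *)
    set (C := / delta + 1).
    assert (HP : forall a b, d a b <= delta -> Rabs (P a - P b) <= C * cost a b).
    { intros a b Hab. assert (Hs := cdist_step delta Hd0 a b Hab).
      assert (Hr := rho_nonneg (f a) (f b)).
      eapply Rle_trans; [apply clamp_lip|].
      replace ((T2 - cd x' a) / delta - (T2 - cd x' b) / delta)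
        with (/ delta * (cd x' b - cd x' a)) by (field; lra).
      rewrite Rabs_mult, (Rabs_right (/ delta)) by lra.
      assert (Hab' : Rabs (cd x' b - cd x' a) <= cost a b).
      { assert (R1 := tri x' a b). assert (R2 := tri x' b a). rewrite (sym b a) in R2.
        apply Rabs_le. lra. }
      unfold C. apply (Rmult_le_compat_l (/ delta)) in Hab'; lra. }
    assert (HV : forall a b, d a b <= delta -> Rabs (V a - V b) <= C * cost a b).
    { intros a b Hab. assert (Hs := cdist_step delta Hd0 a b Hab).
      assert (Hr := rho_nonneg (f a) (f b)).
      eapply Rle_trans; [apply clamp_lip|].
      assert (Hab' : Rabs (v a - v b) <= cost a b).
      { assert (R1 := v_tri a b). assert (R2 := v_tri' a b). apply Rabs_le. lra. }
      unfold C. assert (0 <= / delta * cost a b) by (apply Rmult_le_pos; lra). lra. }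
    assert (HC : 0 <= C) by (unfold C; lra).
    assert (Pone : forall a, cd a x' <= T1 -> P a = 1).
    { intros a Ha. apply clamp_high; [lra|].
      apply (Rmult_le_reg_r delta); [assumption|].
      replace ((T2 - cd x' a) / delta * delta) with (T2 - cd x' a) by (field; lra).
      rewrite (sym x' a). unfold T2. lra. }
    assert (Pzero : forall a, cd a y' <= T1 -> P a = 0).
    { intros a Ha. apply clamp_low; [lra|].
      apply (Rmult_le_reg_r delta); [assumption|].
      replace ((T2 - cd x' a) / delta * delta) with (T2 - cd x' a) by (field; lra).
      assert (T := tri x' a y'). lra. }
    assert (Vtop : forall a, m0 <= v a -> V a = m0)
      by (intros; apply clamp_high; lra).
    assert (low : forall z p q, before m z p q ->
      forall s t, 0 <= s <= 1 -> 0 <= t <= 1 -> m0 - delta < v (seg p q s) ->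
        cd (seg p q t) z <= T1).
    { intros z p q (Hpq & Hp & Hq) s t Hs Ht Hv.
      assert (Hn := near_of_delta p q Hpq). assert (HBpq := B_delta p q Hpq).
      assert (D1 := cdist_vertex_segment delta Hd0 p q s Hn Hs).
      assert (D2 := cdist_vertex_segment delta Hd0 p q t Hn Ht).
      assert (V1 := v_tri p (seg p q s)).
      assert (T := tri (seg p q t) p z). rewrite (sym (seg p q t) p) in T. lra. }
    assert (lowseg : forall z c, (forall a, cd a z <= T1 -> P a = c) ->
      forall p q, before m z p q ->
        near k p q /\ forall n, (1 <= n)%nat -> segint P V n p q = c * (V q - V p)).
    { intros z c Hc p q Hpq. split; [apply near_of_delta, Hpq|].
      apply (segint_local P V C delta Hd0 HV
               (fun a => exists t, 0 <= t <= 1 /\ a = seg p q t)).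
      - intros s Hs. exists s. auto.
      - intros a b (s & Hs & ->) (t & Ht & ->).
        assert (Hl := low z p q Hpq).
        (* Both points below the slab: V is constant. Otherwise the whole edge lies within [T1] of
           z, where P has its constant value. *)
        destruct (Rle_lt_dec (v (seg p q s)) (m0 - delta)) as [Ha|Ha];
          [destruct (Rle_lt_dec (v (seg p q t)) (m0 - delta)) as [Hb|Hb]|].
        + left. unfold V. rewrite !clamp_low by lra. reflexivity.
        + right. split; apply Hc; apply (Hl t); assumption.
        + right. split; apply Hc; apply (Hl s); assumption. }
    assert (flat : forall p q, near k p q -> (forall t, 0 <= t <= 1 -> m0 <= v (seg p q t)) ->
      near k p q /\ forall n, (1 <= n)%nat -> segint P V n p q = 0).
    { intros p q Hn Hf. split; [assumption|]. intros n Hn1.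
      rewrite <- (Rmult_0_l (V q - V p)).
      apply (segint_local P V C delta Hd0 HV (fun a => m0 <= v a));
        auto.
      intros a b Ha Hb. left. rewrite !Vtop by assumption. reflexivity. }
    assert (flat_above : forall p q, above kap p q ->
      near k p q /\ forall n, (1 <= n)%nat -> segint P V n p q = 0).
    { intros p q (Hpq & Hp & Hq). assert (Hn := near_of_delta p q Hpq).
      apply flat; [assumption|]. intros t Ht. assert (HBpq := B_delta p q Hpq).
      assert (D1 := cdist_vertex_segment delta Hd0 p q t Hn Ht).
      assert (V1 := v_tri' p (seg p q t)). unfold m0. lra. }
    assert (above_sym : forall p q, above kap p q -> above kap q p).
    { intros p q (H1 & H2 & H3). split; [rewrite sdist_sym; assumption|]. split; assumption. }
    assert (before_sym : forall z p q, before m z p q -> before m z q p).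
    { intros z p q (H1 & H2 & H3). split; [rewrite sdist_sym; assumption|]. split; assumption. }
    assert (vo : v o = 0) by (apply cdist_refl; assumption).
    assert (L1 : tpath P V o x' (V x' - V o)).
    { apply (tpath_exact P V (before m x')).
      - intros p q Hpq. destruct (lowseg x' 1 Pone p q Hpq) as [Hn Hs].
        split; [assumption|]. intros n Hn1. rewrite Hs by assumption. ring.
      - apply chain_before with cx1; [assumption|]. lra. }
    assert (L2 : tpath P V x' x 0).
    { apply (tpath_zero P V (above kap) _ _ flat_above).
      apply chain_above with cx2; [assumption|]. unfold kap. lra. }
    assert (L3 : tpath P V x y 0).
    { refine (tpath_zero P V _ _ _ _ Hxy). intros p q [Hn Hv]. apply flat; [assumption|].
      intros t Ht. specialize (Hv t Ht). unfold m0, kap. lra. }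
    assert (L4 : tpath P V y y' 0).
    { apply (tpath_zero P V (above kap) _ _ flat_above).
      apply rpath_rev; [assumption|].
      apply chain_above with cy2; [assumption|]. unfold kap. lra. }
    assert (L5 : tpath P V y' o 0).
    { apply (tpath_zero P V (before m y')).
      - intros p q Hpq. destruct (lowseg y' 0 Pzero p q Hpq) as [Hn Hs].
        split; [assumption|]. intros n Hn1. rewrite Hs by assumption. ring.
      - apply rpath_rev; [apply before_sym|].
        apply chain_before with cy1; [assumption|]. lra. }
    assert (Z := closed_tpath P V C delta HC Hd0 HP HV o _
      (tpath_app _ _ _ _ _ _ _ L1 (tpath_app _ _ _ _ _ _ _ L2
        (tpath_app _ _ _ _ _ _ _ L3 (tpath_app _ _ _ _ _ _ _ L4 L5))))).
    assert (Vo : V o = m0 - delta) by (apply clamp_low; lra).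
    assert (Vx' : V x' = m0).
    { apply Vtop. assert (V1 := v_tri x' x). unfold m0, kap. lra. }
    lra. }
  (* Each upper part costs at most the height above m plus ([Lf] + 1) delta; adding [T1] + [T2]
     gives 4 [Lf] + 6 B + 7. *)
  assert (R1 := tri x x' y). assert (R2 := tri x' y' y).
  rewrite (sym x x') in R1.
  unfold T2, T1 in Hclose. lra.
Qed.

End Key.

(** * Limit heights and merge heights *)

Definition height (x : X) : R :=
  epsilon (inhabits 0)
    (fun s => is_lub (fun c => exists delta, 0 < delta <= 1 /\ c = cdist delta o x) s).

Lemma height_lub x : is_lub (fun c => exists delta, 0 < delta <= 1 /\ c = cdist delta o x) (height x).
Proof.
  apply (epsilon_spec (inhabits 0) (fun s => is_lub _ s)).
  destruct (completeness (fun c => exists delta, 0 < delta <= 1 /\ c = cdist delta o x))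
    as (s & Hs).
  - exists (Dmax). intros c (delta & Hd & ->).
    apply cdist_bounded; auto. lra.
  - exists (cdist 1 o x), 1. split; [lra|reflexivity].
  - exists s. exact Hs.
Qed.

Lemma cdist_le_height delta x : 0 < delta <= 1 -> cdist delta o x <= height x.
Proof. intros Hd. apply (height_lub x). exists delta. auto. Qed.

Lemma height_le x b : (forall delta, 0 < delta <= 1 -> cdist delta o x <= b) -> height x <= b.
Proof. intros H. apply (height_lub x). intros c (delta & Hd & ->). auto. Qed.

(** By monotonicity an approximation at one scale persists at all finer scales, so finitely many
    points can share a scale. *)
Lemma height_approx x eta : 0 < eta -> exists delta0, 0 < delta0 <= 1 /\
  forall delta, 0 < delta <= delta0 -> height x - eta <= cdist delta o x.
Proof.
  intros He. apply NNPP. intros H.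
  assert (height x <= height x - eta); [|lra].
  apply height_le. intros delta Hd. apply Rnot_lt_le. intros Hlt.
  apply H. exists delta. split; [assumption|]. intros delta' Hd'.
  assert (M := cdist_mono delta' delta o x ltac:(lra) ltac:(lra)). lra.
Qed.

Lemma height_nonneg x : 0 <= height x.
Proof.
  eapply Rle_trans; [|apply (cdist_le_height 1); lra].
  apply cdist_nonneg; auto; lra.
Qed.

Lemma height_base : height o = 0.
Proof.
  apply Rle_antisym; [|apply height_nonneg].
  apply height_le. intros delta Hd. rewrite cdist_refl; auto; lra.
Qed.

Lemma height_bounded x : height x <= Dmax.
Proof. apply height_le. intros. apply cdist_bounded; auto. lra. Qed.

Lemma height_lip a b K : (forall delta, 0 < delta <= 1 -> cdist delta a b <= K) ->
  Rabs (height a - height b) <= K.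
Proof.
  intros H.
  assert (H1 : forall x y, (forall delta, 0 < delta <= 1 -> cdist delta x y <= K) ->
                 height x <= height y + K).
  { intros x y Hxy. apply height_le. intros delta Hd.
    assert (M := cdist_le_height delta y Hd). specialize (Hxy delta Hd).
    assert (T := cdist_tri delta ltac:(lra) o y x).
    rewrite (cdist_sym delta ltac:(lra) y x) in T. lra. }
  assert (A1 := H1 a b H).
  assert (A2 := H1 b a).
  apply Rabs_le. split; [|lra].
  assert (height b <= height a + K); [|lra]. apply A2.
  intros delta Hd. rewrite cdist_sym; auto; lra.
Qed.

Lemma height_segment p q s t : near k p q -> 0 <= s <= 1 -> 0 <= t <= 1 ->
  Rabs (height (seg p q s) - height (seg p q t)) <= B * (d p q * Rabs (s - t)).
Proof. intros. apply height_lip. intros. apply cdist_segment; auto. lra. Qed.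

Lemma height_zero a b : d a b = 0 -> height a = height b.
Proof.
  intros H. apply Rminus_diag_uniq, Rabs_eq_0, Rle_antisym; [|apply Rabs_pos].
  apply height_lip. intros. rewrite cdist_zero; auto; lra.
Qed.

Definition superpath (eta c : R) : X -> X -> Prop :=
  rpath (fun p q => d p q <= eta /\ c <= height p /\ c <= height q).

(** Connectedness by arbitrarily fine chains is used, so that no continuous path has to be produced.
    The bounds at x and y are stated because an empty chain imposes none. *)
Definition connected_at (c : R) (x y : X) : Prop :=
  c <= height x /\ c <= height y /\ forall eta, 0 < eta -> superpath eta c x y.

Lemma connected_at_sym c x y : connected_at c x y -> connected_at c y x.
Proof.
  intros (H1 & H2 & H3). split; [assumption|]. split; [assumption|].
  intros eta He. apply rpath_rev; [|apply H3, He].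
  intros p q (A1 & A2 & A3). rewrite sdist_sym. auto.
Qed.

Lemma connected_at_mono c c' x y : c' <= c -> connected_at c x y -> connected_at c' x y.
Proof.
  intros Hc (H1 & H2 & H3). split; [lra|]. split; [lra|].
  intros eta He. eapply rpath_impl; [|apply H3, He].
  intros p q (A1 & A2 & A3). cbv beta. repeat split; lra.
Qed.

Lemma connected_at_trans c x y z : connected_at c x y -> connected_at c y z -> connected_at c x z.
Proof.
  intros (H1 & H2 & H3) (H1' & H2' & H3'). split; [assumption|]. split; [assumption|].
  intros eta He. eapply rpath_app; [apply H3, He|apply H3', He].
Qed.

Lemma connected_at_refl c x : c <= height x -> connected_at c x x.
Proof. intros H. split; [assumption|]. split; [assumption|]. constructor. Qed.

Lemma connected_at_0 x y : connected_at 0 x y.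
Proof.
  split; [apply height_nonneg|]. split; [apply height_nonneg|]. intros eta He.
  destruct (chain_exists eta x y He) as (c & Hc & _).
  induction Hc as [x|x w y c Hd H IH]; [constructor|].
  apply rpath_cons with w; [|assumption]. split; [assumption|]. split; apply height_nonneg.
Qed.

Lemma connected_at_zero_dist c x y : d x y = 0 -> c <= height x -> connected_at c x y.
Proof.
  intros H Hc. assert (E := height_zero x y H).
  split; [assumption|]. split; [lra|]. intros eta He.
  apply rpath_cons with y; [|constructor]. repeat split; lra.
Qed.

Lemma connected_at_segment c p q T : near k p q -> 0 <= T <= 1 ->
  (forall t, 0 <= t <= T -> c <= height (seg p q t)) -> connected_at c p (seg p q T).
Proof.
  intros Hn HT Hc.
  assert (E0 := height_zero _ _ (segment_0 k p q)).
  assert (C0 : c <= height (seg p q 0)) by (apply Hc; lra).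
  apply connected_at_trans with (seg p q 0).
  - apply connected_at_zero_dist; [rewrite sdist_sym; apply segment_0|lra].
  - split; [assumption|]. split; [apply Hc; lra|]. intros eta He.
    destruct (segment_subdivision p q 0 T eta Hn ltac:(lra) HT He)
      as (N & g & HN & G0 & G1 & Hg & Hd).
    rewrite Rmin_left, Rmax_right in Hg by lra.
    assert (Hp : superpath eta c (seg p q (g O)) (seg p q (g N))).
    { apply (rpath_seq _ (fun i => seg p q (g i))). intros i Hi.
      split; [apply Hd; assumption|]. split; apply Hc; apply Hg; lia. }
    rewrite G0, G1 in Hp. exact Hp.
Qed.

(** An intermediate value argument: unless the whole segment stays above c, its last point T before
    the height first drops below c has height exactly c. *)
Lemma ancestor_step p q c : near k p q -> c <= height p ->
  (exists a, height a = c /\ connected_at c p a) \/ connected_at c p q.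
Proof.
  intros Hn Hc.
  set (g := fun t => height (seg p q t)).
  assert (E0 := height_zero _ _ (segment_0 k p q)).
  destruct (classic (forall t, 0 <= t <= 1 -> c <= g t)) as [Hall|Hex].
  - right. apply connected_at_trans with (seg p q 1).
    + apply connected_at_segment; [assumption|lra|assumption].
    + apply connected_at_zero_dist; [apply segment_1|apply Hall; lra].
  - left. apply not_all_ex_not in Hex. destruct Hex as (t1 & Ht1).
    apply imply_to_and in Ht1. destruct Ht1 as [Ht1 Hg1]. apply Rnot_le_lt in Hg1.
    set (M := B * d p q).
    assert (HM : 0 <= M).
    { apply Rmult_le_pos; [apply Bseg_nonneg|apply sdist_nonneg]. }
    assert (Hlip : forall s t, 0 <= s <= 1 -> 0 <= t <= 1 -> Rabs (g s - g t) <= M * Rabs (s - t)).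
    { intros s t Hs Ht. unfold M. rewrite Rmult_assoc. apply height_segment; assumption. }
    destruct (completeness (fun T => 0 <= T <= 1 /\ forall s, 0 <= s <= T -> c <= g s)) as (T & HT).
    { exists 1. intros T [HT _]. lra. }
    { exists 0. split; [lra|]. intros s Hs. replace s with 0 by lra. unfold g. lra. }
    assert (HT0 : 0 <= T).
    { apply HT. split; [lra|]. intros s Hs. replace s with 0 by lra. unfold g. lra. }
    assert (HT1 : T <= t1).
    { apply HT. intros T' [HT' Hs]. apply Rnot_lt_le. intros Hlt.
      specialize (Hs t1 ltac:(lra)). lra. }
    assert (Hbelow : forall s, 0 <= s < T -> c <= g s).
    { intros s Hs. apply Rnot_lt_le. intros Hlt.
      assert (T <= s); [|lra]. apply HT. intros T' [HT' Hs'].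
      apply Rnot_lt_le. intros Hlt'. specialize (Hs' s ltac:(lra)). lra. }
    assert (HgT : c <= g T).
    { apply le_epsilon. intros e He.
      destruct (Rle_lt_dec T 0) as [Hz|Hpos].
      { replace T with 0 by lra. unfold g. lra. }
      set (s := Rmax 0 (T - e / (M + 1))).
      assert (He' : 0 < e / (M + 1)) by (apply Rdiv_lt_0_compat; lra).
      assert (Hs : 0 <= s < T) by (unfold s, Rmax; destruct (Rle_dec _ _); lra).
      assert (Hst : T - s <= e / (M + 1)) by (unfold s, Rmax; destruct (Rle_dec _ _); lra).
      specialize (Hbelow s Hs). assert (Hl := Hlip s T ltac:(lra) ltac:(lra)).
      rewrite (Rabs_left (s - T)) in Hl by lra.
      assert (M * (- (s - T)) <= e).
      { apply Rle_trans with ((M + 1) * (e / (M + 1))); [|apply Req_le; field; lra].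
        apply Rmult_le_compat; lra. }
      apply Rabs_le_between in Hl. lra. }
    assert (HgT' : g T <= c).
    { apply Rnot_lt_le. intros Hlt.
      assert (HTt : T < t1).
      { destruct HT1 as [|E]; [assumption|]. rewrite <- E in Hg1. lra. }
      set (T' := Rmin t1 (T + (g T - c) / (M + 1))).
      assert (He' : 0 < (g T - c) / (M + 1)) by (apply Rdiv_lt_0_compat; lra).
      assert (HT' : T < T' <= t1) by (unfold T', Rmin; destruct (Rle_dec _ _); lra).
      assert (HT'' : T' - T <= (g T - c) / (M + 1))
        by (unfold T', Rmin; destruct (Rle_dec _ _); lra).
      assert (T' <= T); [|lra]. apply HT. split; [lra|]. intros s Hs.
      destruct (Rlt_le_dec s T) as [Hs'|Hs']; [apply Hbelow; lra|].
      assert (Hl := Hlip s T ltac:(lra) ltac:(lra)).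
      rewrite (Rabs_right (s - T)) in Hl by lra.
      assert (M * (s - T) <= g T - c).
      { apply Rle_trans with ((M + 1) * ((g T - c) / (M + 1))); [|apply Req_le; field; lra].
        apply Rmult_le_compat; lra. }
      apply Rabs_le_between in Hl. lra. }
    exists (seg p q T). split; [unfold g in *; lra|].
    apply connected_at_segment; [assumption|lra|].
    intros t Ht. destruct (Rlt_le_dec t T) as [H|H]; [apply Hbelow; lra|].
    replace t with T by lra. exact HgT.
Qed.

(** Walk from x to the base point, whose height is 0: the level c is met on the way, or c is 0 and
    the base point serves. *)
Lemma ancestor_exists x c : 0 <= c <= height x ->
  exists a, height a = c /\ connected_at c x a.
Proof.
  intros Hc. destruct (near_base k x ltac:(lia)) as (z & Hxz & Hzo).
  destruct (ancestor_step x z c Hxz ltac:(lra)) as [H|H]; [exact H|].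
  assert (Hz : c <= height z) by apply H.
  destruct (ancestor_step z o c Hzo Hz) as [(a & Ha & Hza)|Ho].
  - exists a. split; [assumption|]. eapply connected_at_trans; eassumption.
  - exists o. assert (Ho' : c <= height o) by apply Ho.
    rewrite height_base in *. split; [lra|]. eapply connected_at_trans; eassumption.
Qed.

Definition merge (x y : X) : R :=
  epsilon (inhabits 0) (fun s => is_lub (fun c => connected_at c x y) s).

Lemma merge_lub x y : is_lub (fun c => connected_at c x y) (merge x y).
Proof.
  apply (epsilon_spec (inhabits 0) (fun s => is_lub (fun c => connected_at c x y) s)).
  destruct (completeness (fun c => connected_at c x y)) as (s & Hs).
  - exists (height x). intros c Hc. apply Hc.
  - exists 0. apply connected_at_0.
  - exists s. exact Hs.
Qed.

Lemma merge_ge c x y : connected_at c x y -> c <= merge x y.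
Proof. apply (merge_lub x y). Qed.

Lemma merge_le_bound b x y : (forall c, connected_at c x y -> c <= b) -> merge x y <= b.
Proof. apply (merge_lub x y). Qed.

Lemma merge_approx x y e : 0 < e -> connected_at (merge x y - e) x y.
Proof.
  intros He. apply NNPP. intros H.
  assert (merge x y <= merge x y - e); [|lra].
  apply merge_le_bound. intros c Hc. apply Rnot_lt_le. intros Hlt.
  apply H. apply (connected_at_mono c); [lra|assumption].
Qed.

Lemma merge_nonneg x y : 0 <= merge x y.
Proof. apply merge_ge, connected_at_0. Qed.

Lemma merge_le_height x y : merge x y <= height x.
Proof. apply merge_le_bound. intros c Hc. apply Hc. Qed.

Lemma merge_sym x y : merge x y = merge y x.
Proof.
  apply Rle_antisym; apply merge_le_bound; intros c Hc;
    apply merge_ge, connected_at_sym, Hc.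
Qed.

Lemma merge_refl x : merge x x = height x.
Proof.
  apply Rle_antisym; [apply merge_le_height|].
  apply merge_ge, connected_at_refl. lra.
Qed.

Lemma merge_ultra x y z : Rmin (merge x y) (merge y z) <= merge x z.
Proof.
  apply le_epsilon. intros e He.
  assert (H1 := merge_approx x y e He). assert (H2 := merge_approx y z e He).
  assert (Rmin (merge x y) (merge y z) - e <= merge x z); [|lra].
  apply merge_ge. apply connected_at_trans with y.
  - eapply connected_at_mono; [|exact H1]. assert (H := Rmin_l (merge x y) (merge y z)). lra.
  - eapply connected_at_mono; [|exact H2]. assert (H := Rmin_r (merge x y) (merge y z)). lra.
Qed.

Lemma merge_ancestor x c : 0 <= c <= height x -> exists a, height a = c /\ merge x a = c.
Proof.
  intros Hc. destruct (ancestor_exists x c Hc) as (a & Ha & Hxa).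
  exists a. split; [assumption|]. apply Rle_antisym; [|apply merge_ge, Hxa].
  rewrite merge_sym, <- Ha. apply merge_le_height.
Qed.

(** A chain has finitely many vertices, so one scale approximates all their heights. *)
Lemma superpath_scale eta c e x y : 0 < e -> superpath eta c x y ->
  exists delta0, 0 < delta0 <= 1 /\ forall delta, 0 < delta <= delta0 ->
    rpath (fun p q => d p q <= eta /\ c - e <= cdist delta o p /\ c - e <= cdist delta o q) x y.
Proof.
  intros He. induction 1 as [x|x w y (Hd & Hx & Hw) H (d1 & Hd1 & H1)].
  - exists 1. split; [lra|]. constructor.
  - destruct (height_approx x e He) as (d2 & Hd2 & H2).
    destruct (height_approx w e He) as (d3 & Hd3 & H3).
    exists (Rmin d1 (Rmin d2 d3)). split.
    { unfold Rmin. repeat destruct (Rle_dec _ _); lra. }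
    intros delta Hdelta.
    assert (M1 := Rmin_l d1 (Rmin d2 d3)). assert (M2 := Rmin_r d1 (Rmin d2 d3)).
    assert (M3 := Rmin_l d2 d3). assert (M4 := Rmin_r d2 d3).
    specialize (H2 delta ltac:(lra)). specialize (H3 delta ltac:(lra)).
    apply rpath_cons with w; [|apply H1; lra]. repeat split; lra.
Qed.

Lemma cost_le_of_connected c x y : connected_at c x y -> cost x y <= height x + height y - 2 * c.
Proof.
  intros (Hx & Hy & Hp).
  assert (HB : 0 <= B) by (apply Bseg_nonneg).
  (* The level is lowered by e for the vertices and by B e for the interiors of the edges, and it
     counts twice; the rest is the error of [cost_le_height]. *)
  set (K := 2 + 2 * B + (4 * Lf + 6 * B + 7)).
  assert (HK : 0 < K) by (unfold K; lra).
  assert (main : forall e, 0 < e <= 1 -> cost x y <= height x + height y - 2 * c + K * e).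
  { intros e He.
    destruct (superpath_scale e c e x y ltac:(lra) (Hp e ltac:(lra))) as (d1 & Hd1 & P1).
    destruct (height_approx x e ltac:(lra)) as (d2 & Hd2 & H2).
    destruct (height_approx y e ltac:(lra)) as (d3 & Hd3 & H3).
    set (delta := Rmin e (Rmin d1 (Rmin d2 d3))).
    assert (Hdelta : 0 < delta /\ delta <= e /\ delta <= d1 /\ delta <= d2 /\ delta <= d3).
    { unfold delta, Rmin. repeat destruct (Rle_dec _ _); repeat split; lra. }
    destruct Hdelta as (D0 & De & D1 & D2 & D3).
    specialize (P1 delta ltac:(lra)). specialize (H2 delta ltac:(lra)). specialize (H3 delta ltac:(lra)).
    assert (HBe : 0 <= B * e) by (apply Rmult_le_pos; lra).
    assert (Key := cost_le_height delta ltac:(lra) (c - e - B * e) x y ltac:(lra) ltac:(lra)).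
    assert (U1 := cdist_le_height delta x ltac:(lra)).
    assert (U2 := cdist_le_height delta y ltac:(lra)).
    assert ((4 * Lf + 6 * B + 7) * delta <= (4 * Lf + 6 * B + 7) * e)
      by (apply Rmult_le_compat_l; lra).
    eapply Rle_trans; [apply Key|unfold K; lra].
    eapply rpath_impl; [|exact P1]. cbv beta. intros p q (Hpq & Hp' & Hq').
    assert (Hn : near k p q) by (apply near_of_close; lra).
    split; [assumption|]. intros t Ht.
    assert (S1 := cdist_vertex_segment delta D0 p q t Hn Ht).
    assert (S2 := cdist_tri delta D0 o (seg p q t) p).
    rewrite (cdist_sym delta D0 (seg p q t) p) in S2.
    assert (B * d p q <= B * e) by (apply Rmult_le_compat_l; lra). lra. }
  apply le_epsilon. intros e He.
  set (e' := Rmin 1 (e / K)).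
  assert (HeK : 0 < e / K) by (apply Rdiv_lt_0_compat; assumption).
  assert (He' : 0 < e' <= 1) by (unfold e', Rmin; destruct (Rle_dec _ _); lra).
  assert (Hle : K * e' <= e).
  { apply Rle_trans with (K * (e / K)); [|apply Req_le; field; lra].
    apply Rmult_le_compat_l; [lra|apply Rmin_r]. }
  specialize (main e' He'). lra.
Qed.

Lemma cost_le_merge_dist x y : cost x y <= merge_dist X height merge x y.
Proof.
  apply le_epsilon. intros e He.
  assert (H := cost_le_of_connected _ x y (merge_approx x y (e / 2) ltac:(lra))).
  unfold merge_dist. lra.
Qed.

(** For close points the segment between them stays above [height x] - B d, which bounds the merge
    height and gives 3 B d. For distant points the total bound 2 [Dmax] is enough. *)
Lemma merge_dist_lip x y :
  merge_dist X height merge x y <= (3 * B + 2 * Dmax) * d x y.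
Proof.
  assert (HB : 0 <= B) by (apply Bseg_nonneg).
  assert (HD : 0 <= Dmax).
  { eapply Rle_trans; [apply (height_nonneg o)|apply height_bounded]. }
  assert (Hd := sdist_nonneg k x y). unfold merge_dist.
  destruct (Rle_lt_dec (d x y) 1) as [H1|H1].
  - assert (Hn := near_of_close k x y H1).
    assert (E0 := height_zero _ _ (segment_0 k x y)).
    assert (E1 := height_zero _ _ (segment_1 k x y)).
    assert (HBd : 0 <= B * d x y) by (apply Rmult_le_pos; assumption).
    assert (Hs : forall t, 0 <= t <= 1 -> Rabs (height (seg x y t) - height x) <= B * d x y).
    { intros t Ht. rewrite <- E0. eapply Rle_trans; [apply height_segment; auto; lra|].
      apply Rmult_le_compat_l; [assumption|]. rewrite <- (Rmult_1_r (d x y)) at 2.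
      apply Rmult_le_compat_l; [assumption|]. apply Rabs_le. lra. }
    assert (Hc : connected_at (height x - B * d x y) x (seg x y 1)).
    { apply connected_at_segment; [assumption|lra|].
      intros t Ht. specialize (Hs t Ht). apply Rabs_le_between in Hs. lra. }
    assert (Hc' : connected_at (height x - B * d x y) x y).
    { eapply connected_at_trans; [exact Hc|].
      apply connected_at_zero_dist; [apply segment_1|apply Hc]. }
    apply merge_ge in Hc'. specialize (Hs 1 ltac:(lra)). rewrite E1 in Hs.
    apply Rabs_le_between in Hs.
    assert (0 <= Dmax * d x y) by (apply Rmult_le_pos; assumption). lra.
  - assert (Hx := height_bounded x). assert (Hy := height_bounded y).
    assert (Hm := merge_nonneg x y).
    assert (Dmax * 1 <= Dmax * d x y) by (apply Rmult_le_compat_l; lra).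
    assert (0 <= B * d x y) by (apply Rmult_le_pos; assumption). lra.
Qed.

End Chains.

(** * Factorisation through the merge tree *)

Theorem theorem5 (k : nat) (hk : (2 <= k)%nat) (f : sphere k -> H1)
  (hf : lipschitz (sphere_dist k) cc_dist f) :
  exists (Z : MetricSpace) (psi : sphere k -> Z) (phi : Z -> H1),
    metric_tree Z /\
    lipschitz (sphere_dist k) (@mdist Z) psi /\
    lipschitz (@mdist Z) cc_dist phi /\
    (forall x, f x = phi (psi x)).
Proof.
  destruct hf as (C & HC).
  set (Lf := 2 * Rabs C).
  assert (HL : 0 <= Lf) by (unfold Lf; assert (H := Rabs_pos C); lra).
  assert (Hf : forall a b, rho (f a) (f b) <= Lf * sdist k a b).
  { intros a b. eapply Rle_trans; [apply rho_le_cc|].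
    assert (H := HC a b). assert (HA := Rle_abs C). assert (HP := Rabs_pos C).
    assert (H0 : 0 <= sphere_dist k a b) by apply sqrt_pos.
    assert (H1 := sphere_dist_le_sdist k a b).
    assert (C * sphere_dist k a b <= Rabs C * sphere_dist k a b)
      by (apply Rmult_le_compat_r; assumption).
    assert (Rabs C * sphere_dist k a b <= Rabs C * sdist k a b)
      by (apply Rmult_le_compat_l; assumption).
    unfold Lf. lra. }
  set (v := height k f). set (m := merge k f).
  assert (M1 := merge_nonneg k hk f Lf HL Hf).
  assert (M2 := merge_le_height k hk f Lf HL Hf).
  assert (M3 := merge_sym k hk f Lf HL Hf).
  assert (M4 := merge_refl k hk f Lf HL Hf).
  assert (M5 := merge_ultra k hk f Lf HL Hf).
  assert (M6 := merge_ancestor k hk f Lf HL Hf).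
  set (cls := merge_class (sphere k) (base k) v m M2 M3 M4 M5).
  assert (Hcls : forall x y, mdist (cls x) (cls y) = merge_dist (sphere k) v m x y)
    by apply merge_class_dist.
  (* The second map evaluates f at the chosen representative; it composes to f because points at
     merge distance 0 have equal images. *)
  exists (merge_space (sphere k) (base k) v m M2 M3 M4 M5), cls, (fun a => f (proj1_sig a)).
  split; [apply merge_space_tree; assumption|]. split; [|split].
  - exists ((3 * Bseg k Lf + 2 * Dmax k Lf) * INR (S k)). intros a b. rewrite Hcls.
    eapply Rle_trans; [apply (merge_dist_lip k hk f Lf HL Hf)|].
    rewrite Rmult_assoc. apply Rmult_le_compat_l; [|apply sdist_le_sphere_dist].
    assert (B1 := Bseg_nonneg k Lf HL).
    assert (D1 := height_nonneg k hk f Lf HL Hf a).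
    assert (D2 := height_bounded k hk f Lf HL Hf a). lra.
  - exists 200. intros a b. eapply Rle_trans; [apply cc_le_rho|].
    apply Rmult_le_compat_l; [lra|]. apply (cost_le_merge_dist k hk f Lf HL Hf).
  - intros x. apply rho_eq0.
    eapply Rle_trans; [apply (cost_le_merge_dist k hk f Lf HL Hf)|].
    apply Req_le. apply merge_rep_spec. assumption.
Qed.
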